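(* Let $0<\alpha<\pi/2$, and let $z_1,z_2\in\mathbb{C}\setminus\{0\}$ with $\arg z_1=0$ and $\arg z_2=\alpha$. Let $\Gamma_1$ be a piecewise smooth non-self-intersecting curve with end-points $z_1,z_2$ which lies in the sector $\{0<\arg z<\alpha\}$, and suppose $\Gamma_1$ is decomposed into a union of two non-intersecting sets $\Gamma_{1,1}$ and $\Gamma_{1,2}$ (one of which may be empty). Let the domain $K$ and the parts $\partial_1K$, $\partial_2K$ of its boundary be constructed from these data as described in the context. Then the problem $$-\Delta u=\lambda u\ \text{ in }K,\qquad u|_{\partial_1K}=0,\qquad \left.\frac{\partial u}{\partial n}\right|_{\partial_2K}=0$$ is isospectral with respect to exchanging the Dirichlet and Neumann boundary conditions; that is, it has the same spectrum, with account of multiplicities, as the problem $$-\Delta v=\lambda v\ \text{ in }K,\qquad v|_{\partial_2K}=0,\qquad \left.\frac{\partial v}{\partial n}\right|_{\partial_1K}=0.$$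
   Context: The plane $\mathbb{R}^2$ is identified with $\mathbb{C}$, and $(r,\phi)$ are polar coordinates. $\Delta$ is the Laplace operator and $\partial/\partial n$ is the normal derivative on the boundary; the spectra are those of $-\Delta$ with mixed Dirichlet-Neumann boundary conditions in the usual variational (weak) sense. Parts of a boundary on which boundary conditions are imposed are understood to be finite unions of open segments (arcs) of the boundary, the whole boundary being the closure of the union of the two parts. Construction. For an angle $\beta$ let $\mathcal{S}_\beta:(r,\phi)\mapsto(r,2\beta-\phi)$ be the reflection with respect to the axis $\{\arg z=\beta\}$. Let $K_1$ be the open set bounded by the radii $[0,z_1]$, $[0,z_2]$ and the curve $\Gamma_1$. (The curve $\Gamma_1$ lies in the open sector apart from its end-points.) Put $$\Gamma_2:=\mathcal{S}_\alpha\Gamma_1,\quad \Gamma_3:=\mathcal{S}_{2\alpha}\Gamma_2,\quad \Gamma_4:=\mathcal{S}_{2\alpha}\Gamma_1,$$ $$K_2:=\mathcal{S}_\alpha K_1,\quad K_3:=\mathcal{S}_{2\alpha}K_2,\quad K_4:=\mathcal{S}_{2\alpha}K_1,$$ and let $K$ be the interior of $\overline{K_1\cup K_2\cup K_3\cup K_4}$. The domain $K$ is bounded by the radii $[0,z_1]$, $[0,\mathcal{S}_{2\alpha}z_1]$ and the curve $\overline{\Gamma_1\cup\Gamma_2\cup\Gamma_3\cup\Gamma_4}$. For $m=1,2$ define, in the same way, $$\Gamma_{2,m}:=\mathcal{S}_\alpha\Gamma_{1,m},\quad \Gamma_{3,m}:=\mathcal{S}_{2\alpha}\Gamma_{2,m},\quad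 \Gamma_{4,m}:=\mathcal{S}_{2\alpha}\Gamma_{1,m}.$$ Finally set $$\partial_1K:=\Gamma_{1,1}\cup\Gamma_{2,2}\cup\Gamma_{3,2}\cup\Gamma_{4,1}\cup[0,\mathcal{S}_{2\alpha}z_1],$$ $$\partial_2K:=[0,z_1]\cup\Gamma_{1,2}\cup\Gamma_{2,1}\cup\Gamma_{3,1}\cup\Gamma_{4,2}.$$ *)

(* Defs.v *)
(* MathComp-Analysis; R : realType is the real line and R * R the plane. *)
From HB Require Import structures.
From mathcomp Require Export all_boot all_order all_algebra.
From mathcomp Require Export all_classical all_reals all_analysis.
Export Order.TTheory GRing.Theory Num.Theory.
Export numFieldNormedType.Exports.

Set Implicit Arguments.
Unset Strict Implicit.
Unset Printing Implicit Defensive.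

Local Open Scope classical_set_scope.
Local Open Scope ring_scope.

Section Geometry.
Context {R : realType}.
Implicit Types (z w : R * R) (A J : set (R * R)) (a b : R).

Definition polar (r phi : R) : R * R := (r * cos phi, r * sin phi).

Definition has_arg z (phi : R) := exists2 r, 0 < r & z = polar r phi.

Definition open_sector a b : set (R * R) :=
  [set z | exists r phi, [/\ 0 < r, a < phi < b & z = polar r phi]].

Definition radius w : set (R * R) := [set t *: w | t in `[0, 1]%classic].

(* The orthogonal reflection in the line spanned by polar 1 b; reflect_polar
   below gives its expression in polar coordinates. *)
Definition reflect b z : R * R :=
  (z.1 * cos (2 * b) + z.2 * sin (2 * b),
   z.1 * sin (2 * b) - z.2 * cos (2 * b)).

Lemma reflect_polar b r phi : reflect b (polar r phi) = polar r (2 * b - phi).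
Proof.
rewrite /reflect /polar /= cosB sinB; congr pair;
  by rewrite !mulrDr ?mulrN -!mulrA [cos phi * _]mulrC [sin phi * _]mulrC.
Qed.

(* The union of the bounded connected components of the complement of J.  When
   J is a Jordan curve there is exactly one of them, the domain bounded by J. *)
Definition inside J : set (R * R) :=
  [set z | ~ J z /\ bounded_set (connected_component (~` J) z)].

(* Piecewise continuously differentiable, with a nonzero derivative on every
   closed piece (one-sided at the break points t_0 = 0 < t_1 < ... < t_n = 1):
   each piece is the restriction of a C^1 function on the whole line. *)
Definition piecewise_smooth (gamma : R -> R * R) :=
  exists ts : seq R,
    [/\ path <%R 0 ts, last 0 ts = 1 &
      forall i, (i < size ts)%N ->
        let I := `[nth 0 (0 :: ts) i, nth 0 ts i]%classic in
        exists c : R -> R * R,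
          [/\ forall t, derivable c t 1, continuous (derive1 c),
              forall t, I t -> derive1 c t != 0 &
              forall t, I t -> gamma t = c t]].

(* An injective piecewise smooth parametrization on [0, 1] of a curve which
   joins z1 to z2 and otherwise lies in S. *)
Definition simple_curve (gamma : R -> R * R) z1 z2 (S : set (R * R)) :=
  [/\ gamma 0 = z1, gamma 1 = z2,
      {in `[0, 1]%classic &, injective gamma},
      (forall t, 0 < t < 1 -> S (gamma t)) &
      {within `[0, 1]%classic, continuous gamma} /\ piecewise_smooth gamma].

Definition trace_of (gamma : R -> R * R) : set (R * R) :=
  gamma @` `[0, 1]%classic.

(* A finite (possibly empty) union of open arcs of the curve. *)
Definition union_of_arcs (gamma : R -> R * R) A :=
  exists s : seq (R * R),
    (forall p, p \in s -> 0 <= p.1 < p.2 /\ p.2 <= 1) /\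
    A = [set z | exists2 p, p \in s & (gamma @` `]p.1, p.2[%classic) z].

Definition decomposition (gamma : R -> R * R) (G1 G2 : set (R * R)) :=
  [/\ union_of_arcs gamma G1, union_of_arcs gamma G2, G1 `&` G2 = set0 &
      closure (G1 `|` G2) = trace_of gamma].

Section Unfolding.
Variables (alpha : R).

Definition copy2 A := reflect alpha @` A.
Definition copy3 A := reflect (2 * alpha) @` copy2 A.
Definition copy4 A := reflect (2 * alpha) @` A.

Definition base_domain z1 z2 (Gamma1 : set (R * R)) : set (R * R) :=
  inside (radius z1 `|` radius z2 `|` Gamma1).

Definition unfolded_domain z1 z2 (Gamma1 : set (R * R)) : set (R * R) :=
  let K1 := base_domain z1 z2 Gamma1 in
  (closure (K1 `|` copy2 K1 `|` copy3 K1 `|` copy4 K1))°.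

Definition boundary1 z1 (G1 G2 : set (R * R)) : set (R * R) :=
  G1 `|` copy2 G2 `|` copy3 G2 `|` copy4 G1
  `|` radius (reflect (2 * alpha) z1).

Definition boundary2 z1 (G1 G2 : set (R * R)) : set (R * R) :=
  radius z1 `|` G2 `|` copy2 G1 `|` copy3 G1 `|` copy4 G2.

End Unfolding.
End Geometry.

Section MixedProblem.
Context {R : realType}.
Implicit Types (K D : set (R * R)) (u v f phi psi : R * R -> R).
Implicit Types (g h : R * R -> R * R).

(* measurableTypeR R is R with its Borel sigma-algebra. *)
Definition area :
    {measure set (measurableTypeR R * measurableTypeR R) -> \bar R} :=
  (@lebesgue_measure R \x @lebesgue_measure R)%E.

Definition e1 : R * R := (1, 0).
Definition e2 : R * R := (0, 1).

(* C^oo: all iterated directional derivatives exist and are continuous. *)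
Definition smooth phi := forall es : seq (R * R),
  let dphi := foldr (fun (e : R * R) psi => 'D_e psi) phi es in
  continuous dphi /\ forall z e, derivable dphi z e.

(* C^oo_c(U), as functions on the whole plane. *)
Definition test_function (U : set (R * R)) phi :=
  let supp := closure [set z | phi z != 0] in
  [/\ smooth phi, compact supp & supp `<=` U].

Definition L2 K u :=
  measurable_fun (K : set (measurableTypeR R * measurableTypeR R)) u /\
  area.-integrable K (fun z => (u z ^+ 2)%:E).

Definition weak_derivative K (e : R * R) u (w : R * R -> R) :=
  forall phi, test_function K phi ->
    \int[area]_(z in K) (u z * 'D_e phi z) =
    - \int[area]_(z in K) (w z * phi z).

(* u is in H^1(K), with weak gradient g. *)
Definition H1 K u g :=
  [/\ L2 K u, L2 K (fst \o g), L2 K (snd \o g),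
      weak_derivative K e1 u (fst \o g) & weak_derivative K e2 u (snd \o g)].

(* The form domain: the closure in H^1(K) of the (restrictions to K of the)
   functions of C^oo_c(R^2) whose support does not meet the closure of D.  The
   Dirichlet condition is imposed on D only; the Neumann condition on the rest
   of the boundary is the natural one of the variational formulation. *)
Definition form_domain K D u g :=
  H1 K u g /\
  forall eps : R, 0 < eps ->
    exists2 psi, test_function (~` closure D) psi &
      (\int[area]_(z in K) ((u z - psi z) ^+ 2
         + ((g z).1 - 'D_e1 psi z) ^+ 2
         + ((g z).2 - 'D_e2 psi z) ^+ 2)%:E < eps%:E)%E.

(* - Delta u = lambda u + f in K, u = 0 on D, du/dn = 0 on the rest of the
   boundary, in the weak sense. *)
Definition weak_solution K D (lambda : R) f u :=
  exists2 g, form_domain K D u g &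
    forall v h, form_domain K D v h ->
      \int[area]_(z in K) ((g z).1 * (h z).1 + (g z).2 * (h z).2) =
      lambda * (\int[area]_(z in K) (u z * v z)) +
      \int[area]_(z in K) (f z * v z).

Definition eigenspace K D (lambda : R) u :=
  weak_solution K D lambda (fun=> 0) u.

Definition ae_eq_on K u v := {ae area, forall z, K z -> u z = v z}.

Definition ae_free K n (u : 'I_n -> R * R -> R) :=
  forall c : 'I_n -> R,
    ae_eq_on K (fun z => \sum_(i < n) c i * u i z) (fun=> 0) ->
    forall i, c i = 0.

(* The dimension, in L^2(K), of the eigenspace; it is 0 exactly when lambda is
   not an eigenvalue. *)
Definition multiplicity K D (lambda : R) : \bar R :=
  ereal_sup [set n%:R%:E | n in [set n : nat |
    exists u : 'I_n -> R * R -> R,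
      (forall i, eigenspace K D lambda (u i)) /\ ae_free K u]].

(* The operator is self-adjoint, so its spectrum is real, and lambda is in the
   resolvent set as soon as the equation is uniquely solvable for every right
   hand side (boundedness of the inverse is automatic). *)
Definition resolvent_set K D : set R :=
  [set lambda | forall f, L2 K f ->
    (exists u, weak_solution K D lambda f u) /\
    (forall u v, weak_solution K D lambda f u ->
                 weak_solution K D lambda f v -> ae_eq_on K u v)].

Definition spectrum K D : set R := ~` resolvent_set K D.

Definition isospectral K D D' :=
  spectrum K D = spectrum K D' /\
  forall lambda, multiplicity K D lambda = multiplicity K D' lambda.

End MixedProblem.

(* Main.v *)
(* Write tau and sig for the reflections in the axes at angles alpha and 2 alpha,
   and W for the transplantation: on the half of K below the axis of sig,
   W u = u o tau + u o sig o tau, and on the other half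
   W u = u o tau o sig - u o sig o tau o sig.  Since tau preserves the lower half
   and sig exchanges the halves, W is self-adjoint on L^2(K), W^2 = 2, and the
   same holds for the induced action on gradients.  It therefore suffices that W
   exchanges the form domains of the problems in which Gamma_{1,1} and
   Gamma_{1,2} have been swapped; the reflection sig then turns the second
   problem into the one with the Dirichlet and Neumann conditions exchanged.

   By density it is enough to treat W psi for a test function psi which vanishes
   near the Dirichlet part.  Then W psi is smooth on each half, continuous across
   the axis of sig inside K, zero on the new Dirichlet part, and zero near the
   origin, so no corner has to be analysed.  Smooth cut-offs of width d across the
   axis and along the outer ray turn it into test functions: the cut-offs have
   gradient O(1/d), but multiply quantities of size O(d), so the error in the
   gradient stays bounded and is supported on strips of width O(d). *)

Require Import Defs.
From HB Require Import structures.
From mathcomp Require Import measurable_realfun ring lra.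

Set Implicit Arguments.
Unset Strict Implicit.
Unset Printing Implicit Defensive.

Local Open Scope classical_set_scope.
Local Open Scope ring_scope.

(** * Functions of class C^n *)

(** The signs in W serve the two rays. Write u_i for the values of u on K_i, read back on K_1: W u
    is (u_2 + u_3, u_1 + u_4, u_1 - u_4, u_2 - u_3). The second and third entries agree on the axis
    of sig because u_4 vanishes on the outer ray; the fourth vanishes on the outer ray because u_2 =
    u_3 on that axis. The arcs are exchanged because u_1 and u_4 share one Dirichlet part of
    Gamma_1, u_2 and u_3 the other. Across the axes at alpha and 3 alpha there is nothing to glue,
    since W is written with reflections of a whole half. No Neumann condition is ever verified:
    self-adjointness moves W from the solution to the test function, so only membership in the form
    domains matters. The form domain being a closure of functions smooth on the plane, the glued W
    psi has to be approximated; a bounded energy density that lives on shrinking strips allows this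
    by dominated convergence, without a rate. *)

Section SmoothClass.
Context {R : realType} {V : normedModType R}.
Implicit Types (f g : V -> R) (e z : V).

(** Graded by the order, unlike [smooth], so that products and inverses go by induction and order 1
    can be asked for alone. Quantifying over all directions makes composition with an affine map a
    mere relabelling of directions. *)
Fixpoint class_C n f : Prop :=
  if n is n'.+1 then
    [/\ continuous f, forall z e, derivable f z e &
        forall e, class_C n' (fun z => 'D_e f z)]
  else continuous f.

Lemma class_C_continuous n f : class_C n f -> continuous f.
Proof. by case: n => [//|n] []. Qed.

Lemma class_C_derivable n f z e : class_C n.+1 f -> derivable f z e.
Proof. by move=> [_ + _]; apply. Qed.

Lemma class_C_le n f : class_C n.+1 f -> class_C n f.
Proof.
elim: n f => [f []//|n IH f [cf df Df]]; split=> // e; exact: IH.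
Qed.

Lemma class_C_cst n (c : R) : class_C n (fun=> c).
Proof.
elim: n c => [|n IH] c /=; first exact: cst_continuous.
split; [exact: cst_continuous|move=> z e; exact: derivable_cst|move=> e].
have -> : (fun z => 'D_e (fun=> c) z) = (fun=> 0 : R).
  by apply/funext => z; exact: derive_cst.
exact: IH.
Qed.

Lemma class_CD n f g : class_C n f -> class_C n g -> class_C n (fun z => f z + g z).
Proof.
elim: n f g => [|n IH] f g /=; first by move=> cf cg z; apply: cvgD; [exact: cf|exact: cg].
move=> [cf df Df] [cg dg Dg]; split.
- by move=> z; apply: cvgD; [exact: cf|exact: cg].
- by move=> z e; apply: derivableD.
- move=> e; rewrite (_ : (fun z => 'D_e _ z) = fun z => 'D_e f z + 'D_e g z); first exact: IH.
  by apply/funext => z; rewrite -deriveD.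
Qed.

Lemma class_CN n f : class_C n f -> class_C n (fun z => - f z).
Proof.
elim: n f => [|n IH] f /=; first by move=> cf z; apply: cvgN; exact: cf.
move=> [cf df Df]; split.
- by move=> z; apply: cvgN; exact: cf.
- by move=> z e; apply: derivableN.
- move=> e; rewrite (_ : (fun z => 'D_e _ z) = fun z => - 'D_e f z); first exact: IH.
  by apply/funext => z; rewrite -deriveN.
Qed.

Lemma class_CM n f g : class_C n f -> class_C n g -> class_C n (fun z => f z * g z).
Proof.
elim: n f g => [|n IH] f g; first by move=> cf cg z; apply: cvgM; [exact: cf|exact: cg].
move=> Hf Hg; have Hf' := class_C_le Hf; have Hg' := class_C_le Hg.
move: Hf Hg => [cf df Df] [cg dg Dg]; split.
- by move=> z; apply: cvgM; [exact: cf|exact: cg].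
- by move=> z e; apply: derivableM.
- move=> e; rewrite (_ : (fun z => 'D_e _ z) = fun z => f z * 'D_e g z + g z * 'D_e f z).
    by apply: class_CD; [exact: IH Hf' (Dg e)|exact: IH Hg' (Df e)].
  by apply/funext => z; rewrite -[RHS]deriveM.
Qed.

Lemma class_CV n f : (forall z, f z != 0) -> class_C n f -> class_C n (fun z => (f z)^-1).
Proof.
move=> f0; elim: n => [|n IH].
  by move=> cf z; apply: cvgV => //; exact: cf.
move=> Hf; have Hf' := class_C_le Hf.
move: Hf => [cf df Df]; split.
- by move=> z; apply: cvgV => //; exact: cf.
- by move=> z e; apply: derivableV.
- move=> e; rewrite (_ : (fun z => 'D_e _ z) = fun z => - ((f z)^-1 * (f z)^-1 * 'D_e f z)).
    have fV := IH Hf'.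
    exact: class_CN (class_CM (class_CM fV fV) (Df e)).
  apply/funext => z; rewrite deriveV// -[_ *: _]/(_ * _) expr2 invfM; ring.
Qed.

(** The grouping prepares the error estimates: derivatives of the cut-offs [h] and [k] occur only
    against [k z * g z - f z] and [g z], which will be small where those derivatives live. *)
Lemma derive_interpolation (h k f g : V -> R) z e :
  derivable h z e -> derivable k z e -> derivable f z e -> derivable g z e ->
  'D_e (fun z => f z + h z * (k z * g z - f z)) z =
  (1 - h z) * 'D_e f z + h z * k z * 'D_e g z
  + 'D_e h z * (k z * g z - f z) + h z * 'D_e k z * g z.
Proof.
move=> dh dk df dg.
have dkG : derivable (fun z => k z * g z) z e := derivableM dk dg.
have dB : derivable (fun z => k z * g z - f z) z e := derivableB dkG df.
have dM : derivable (fun z => h z * (k z * g z - f z)) z e := derivableM dh dB.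
rewrite -[LHS]/('D_e (f + (fun z => h z * (k z * g z - f z))) z) (deriveD df dM).
rewrite -['D_e (fun z => h z * _) z]/('D_e (h * (fun z => k z * g z - f z)) z) (deriveM dh dB).
rewrite -['D_e (fun z => k z * g z - f z) z]/('D_e ((fun z => k z * g z) - f) z) (deriveB dkG
  df).
rewrite -['D_e (fun z => k z * g z) z]/('D_e (k * g) z) (deriveM dk dg).
rewrite -![_ *: _]/(_ * _); ring.
Qed.

End SmoothClass.

Section Composition.
Context {R : realType} {V W : normedModType R}.

(** [L] is the linear part. The equation has the form of a difference quotient: that of [f] composed
    with [A] along [e] is literally that of [f] along [L e], so no chain rule is needed. *)
Definition affine_map (A L : V -> W) :=
  forall (h : R) e z, A (h *: e + z) = h *: L e + A z.

Lemma derive_comp_affine (A L : V -> W) (f : W -> R) (z e : V) :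
  affine_map A L -> 'D_e (fun z => f (A z)) z = 'D_(L e) f (A z).
Proof. by move=> HA; rewrite /derive; under eq_fun do rewrite /= HA. Qed.

Lemma derivable_comp_affine (A L : V -> W) (f : W -> R) (z e : V) :
  affine_map A L ->
  derivable f (A z) (L e) -> derivable (fun z => f (A z)) z e.
Proof. by move=> HA; rewrite /derivable; under [X in _ -> cvg (X @ _)]eq_fun do rewrite /= HA.
  Qed.

Lemma class_C_comp_affine n (A L : V -> W) (f : W -> R) :
  affine_map A L -> continuous A ->
  class_C n f -> class_C n (fun z => f (A z)).
Proof.
move=> HA cA; elim: n f => [|n IH] f /=.
  by move=> cf z; apply: continuous_comp; [exact: cA|exact: cf].
move=> [cf df Df]; split.
- by move=> z; apply: continuous_comp; [exact: cA|exact: cf].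
- by move=> z e; apply: derivable_comp_affine HA _.
- move=> e; have -> : (fun z => 'D_e (fun z => f (A z)) z) = fun z => 'D_(L e) f (A z).
    by apply/funext => z; exact: derive_comp_affine.
  by apply: (IH (fun w => 'D_(L e) f w)).
Qed.

End Composition.
Section Bridge.
Context {R : realType}.

Lemma smoothP (phi : R * R -> R) : smooth phi <-> forall n, class_C n phi.
Proof.
have E f n : class_C n f <-> forall es : seq (R * R), (size es <= n)%N ->
    let d := foldr (fun (e : R * R) psi => 'D_e psi) f es in
    continuous d /\ ((size es < n)%N -> forall z e, derivable d z e).
  elim: n f => [|n IH] f.
    split=> [cf es|H]; last by have [] := H [::] isT.
    by rewrite leqn0 => /nilP ->.
  split=> [[cf df Df] es|H].
    (* [foldr] differentiates first in the last direction of the list, so the induction peels the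
       list from its right end. *)
    case/lastP: es => [//|es e]; rewrite size_rcons !ltnS => sn.
    rewrite foldr_rcons; exact: (IH _).1 (Df e) es sn.
  split; first by have [] := H [::] isT.
    by have [_ /(_ isT)] := H [::] isT.
  move=> e; apply/IH => es sn.
  have := H (rcons es e); rewrite size_rcons !ltnS foldr_rcons; exact.
split=> [H n|H es].
  by apply/E => es _; have [? ?] := H es.
have [c1 d1] := (E _ _).1 (H (size es).+1) es (leqnSn _); split=> //; exact: d1.
Qed.
End Bridge.

(** * A smooth step function *)

Section Step.
Context {R : realType}.
Implicit Types (t : R) (f g : R -> R).

Lemma class_C_real n f f' :
  (forall t, is_derive t (1 : R) f (f' t)) -> class_C n f' -> class_C n.+1 f.
Proof.
move=> df Cf'; have dif t : differentiable f t.
  by apply/derivable1_diffP; exact: (@ex_derive _ _ _ _ _ _ _ (df t)).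
split.
- by move=> t; exact: differentiable_continuous.
- by move=> t e; exact: diff_derivable.
- move=> e; have -> : (fun t => 'D_e f t) = fun t => e * f' t.
    apply/funext => t; rewrite deriveE// deriv1E; last by apply/derivable1_diffP.
    by rewrite derive1E (@derive_val _ _ _ _ _ _ _ (df t)).
  by apply: class_CM => //; exact: class_C_cst.
Qed.

(* t^-k exp(-1/t) for t > 0, extended by 0: the derivative of flat k is a
   combination of flat k.+1 and flat k.+2, so that all are smooth. *)
Definition flat k t : R := if 0 < t then t ^- k * expR (- t^-1) else 0.

Lemma flat_ge0 k t : 0 <= flat k t.
Proof.
rewrite /flat; case: ifP => // t0; apply: mulr_ge0; last exact: expR_ge0.
by rewrite invr_ge0 exprn_ge0// ltW.
Qed.

(** One term of the exponential series at [t^-1], that of order [k.+1], beats [t ^- k] and leaves a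
    factor [t], enough for a limit at the origin. *)
Lemma flat_le k t : 0 < t -> flat k t <= k.+1`!%:R * t.
Proof.
move=> t0; rewrite /flat t0 expRN.
have H : t^-1 ^+ k.+1 / k.+1`!%:R <= expR t^-1.
  apply: le_trans (expR_ge1Dxn k _); last by rewrite invr_ge0 ltW.
  by rewrite lerDr.
have f0 : 0 < k.+1`!%:R :> R by rewrite ltr0n fact_gt0.
rewrite ler_pdivrMr ?expR_gt0//; apply: le_trans (ler_wpM2l _ H); last first.
  by rewrite mulr_ge0// ltW.
rewrite exprVn exprS invfM.
have -> : k.+1`!%:R * t * (t^-1 / t ^+ k / k.+1`!%:R) =
  (t / t) * (k.+1`!%:R / k.+1`!%:R) * t ^- k by ring.
by rewrite !divff ?gt_eqF// !mul1r.
Qed.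

Lemma flat_le0 k t : t <= 0 -> flat k t = 0.
Proof. by move=> t0; rewrite /flat ltNge t0. Qed.

Lemma is_derive_flat k t :
  is_derive t (1 : R) (flat k) (flat k.+2 t - k%:R * flat k.+1 t).
Proof.
have [t0|t0|->] := ltgtP t 0.
- apply: (@near_eq_is_derive _ _ _ (cst 0)); last first.
    by rewrite !flat_le0 ?ltW// mulr0 subr0; exact: is_derive_cst.
  by near=> x; rewrite flat_le0//; apply: ltW; near: x; exact: lt_nbhsl.
- apply: (@near_eq_is_derive R R^o R^o (fun x : R => x ^- k * expR (- x^-1))).
    by near=> x; rewrite /flat ifT//; near: x; exact: lt_nbhsr.
  have t0' : t != 0 by rewrite gt_eqF.
  have dV : is_derive t (1 : R) (fun x : R => - x^-1) (t ^- 2).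
    have d1 : is_derive t (1:R) (fun x : R => x^-1) (- t ^- 2 *: 1).
      by apply: DeriveDef; [exact: derivableV|rewrite deriveV// derive_id].
    by have := is_deriveN d1; rewrite scaleNr opprK -[_ *: _]/(_ * _) mulr1.
  have dX : is_derive t (1 : R) (fun x : R => x ^- k) (- k%:R * t ^- k.+1).
    have tk0 : t ^+ k != 0 by rewrite expf_neq0.
    have d1 : derivable (fun x : R => x ^+ k) t 1 by exact: exprn_derivable.
    apply: DeriveDef; first exact: derivableV.
    rewrite deriveV// exp_derive.
    rewrite -![_ *: _]/(_ * _) mulr1; case: (k) => [|j] /=; first by ring.
    by rewrite !exprS; field; rewrite expf_neq0.
  have dE : is_derive t (1 : R) (fun x => expR (- x^-1)) (t ^- 2 * expR (- t^-1)).
    rewrite mulrC; exact: (@is_derive1_comp _ expR (fun x : R => - x^-1)).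
  have := is_deriveM dX dE; rewrite /flat t0 -![_ *: _]/(_ * _).
  move=> H; apply: is_derive_eq H _.
  by rewrite !exprS; field; rewrite expf_neq0.
rewrite !flat_le0// mulr0 subr0.
(* At the origin the difference quotient of [flat k] is [flat k.+1 h] for h > 0, and [flat_le]
   applies to it. *)
have L : (fun h : R => h^-1 *: (flat k (h *: 1 + 0) - flat k 0)) @ 0^' --> (0 : R).
  apply/cvgrPdist_lt => /= e e0.
  have C0 : 0 < k.+2`!%:R :> R by rewrite ltr0n fact_gt0.
  have ed : 0 < e / k.+2`!%:R by rewrite divr_gt0.
  near=> h.
  have h0 : h != 0 by near: h; exact: nbhs_dnbhs_neq.
  rewrite sub0r normrN addr0 (@flat_le0 k 0)// subr0 -![_ *: _]/(_ * _) mulr1.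
  have [hn|hp] := leP h 0; first by rewrite flat_le0// mulr0 normr0.
  have -> : h^-1 * flat k h = flat k.+1 h by rewrite /flat hp exprS invfM mulrA.
  rewrite ger0_norm ?flat_ge0//; apply: le_lt_trans (flat_le _ hp) _.
  rewrite mulrC -ltr_pdivlMr//.
  apply: le_lt_trans (ler_norm h) _.
  by near: h; exact: dnbhs0_lt.
by apply: DeriveDef; [apply/cvg_ex; exists 0|exact: cvg_lim L].
Unshelve. all: by end_near. Qed.

Lemma class_C_flat n k : class_C n (flat k).
Proof.
elim: n k => [|n IH] k.
  move=> t; apply: differentiable_continuous; apply/derivable1_diffP.
  exact: (@ex_derive _ _ _ _ _ _ _ (is_derive_flat k t)).
apply: class_C_real (is_derive_flat k) _.
apply: class_CD (IH _) _; apply: class_CN; apply: class_CM (IH _).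
exact: class_C_cst.
Qed.

Definition step t : R := flat 0 t / (flat 0 t + flat 0 (1 - t)).

Lemma flat_gt0 k t : 0 < t -> 0 < flat k t.
Proof.
by move=> t0; rewrite /flat t0 mulr_gt0 ?expR_gt0// invr_gt0 exprn_gt0.
Qed.

Let den_gt0 t : 0 < flat 0 t + flat 0 (1 - t).
Proof.
have [t0|t0] := ltP 0 t.
  by apply: ltr_wpDr; [exact: flat_ge0|exact: flat_gt0].
by apply: ltr_wpDl; [exact: flat_ge0|apply: flat_gt0; lra].
Qed.

Lemma step_le0 t : t <= 0 -> step t = 0.
Proof. by move=> t0; rewrite /step flat_le0// mul0r. Qed.

Lemma step_ge1 t : 1 <= t -> step t = 1.
Proof.
move=> t1; rewrite /step (@flat_le0 _ (1 - t)) ?subr_le0// addr0 divff//.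
by rewrite gt_eqF// flat_gt0//; lra.
Qed.

Lemma step_ge0 t : 0 <= step t.
Proof. by rewrite divr_ge0 ?flat_ge0// ltW. Qed.

Lemma step_le1 t : step t <= 1.
Proof. by rewrite ler_pdivrMr// mul1r lerDl flat_ge0. Qed.

Lemma class_C_step n : class_C n step.
Proof.
apply: class_CM; first exact: class_C_flat.
apply: class_CV; first by move=> t; rewrite gt_eqF.
apply: class_CD; first exact: class_C_flat.
apply: (@class_C_comp_affine _ _ _ _ (fun t : R => 1 - t) -%R).
- by move=> h e z; rewrite scalerN; ring.
- by move=> t; apply: cvgB; [exact: cvg_cst|exact: cvg_id].
- exact: class_C_flat.
Qed.

End Step.

(** * Calculus in the plane *)

Section Plane.
Context {R : realType}.
Implicit Types (f g : R * R -> R) (z w e : R * R).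

Lemma ler_norm_pair z (c : R) : (`|z| <= c) = (`|z.1| <= c) && (`|z.2| <= c).
Proof. by rewrite prod_normE ge_max. Qed.

Lemma ltr_norm_pair z (c : R) : (`|z| < c) = (`|z.1| < c) && (`|z.2| < c).
Proof. by rewrite prod_normE gt_max. Qed.

Lemma norm_fst_le z : `|z.1| <= `|z|.
Proof. by have := lexx `|z|; rewrite {1}ler_norm_pair => /andP[]. Qed.

Lemma norm_snd_le z : `|z.2| <= `|z|.
Proof. by have := lexx `|z|; rewrite {1}ler_norm_pair => /andP[]. Qed.

Lemma directional_mvt f e z (h : R) : (forall w, derivable f w e) ->
  exists2 t, `|t| <= `|h| & f (h *: e + z) - f z = h * 'D_e f (t *: e + z).
Proof.
move=> df; pose g (t : R^o) : R := f (t *: e + z).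
have aff : affine_map (fun t : R^o => t *: e + z) (fun t : R^o => t *: e).
  by move=> k u v; rewrite scalerDl addrA -scalerA.
have dg t : is_derive t (1 : R) g ('D_e f (t *: e + z)).
  apply: DeriveDef.
    by apply: (derivable_comp_affine aff); rewrite scale1r.
  by rewrite (@derive_comp_affine _ _ _ _ _ f _ _ aff) scale1r.
have cg (a b : R) : {within `[a, b], continuous g}.
  apply: (@derivable_within_continuous _ _ g) => x _.
  exact: (@ex_derive _ _ _ _ _ _ _ (dg x)).
have g0 : g 0 = f z by rewrite /g scale0r add0r.
have [h0|h0] := leP 0 h.
  have [t] := MVT_segment h0 (fun x _ => dg x) (cg 0 h).
  rewrite in_itv /= g0 subr0 mulrC => /andP[t0 th] E; exists t => //.
  by rewrite !ger0_norm.
have [t] := MVT_segment (ltW h0) (fun x _ => dg x) (cg h 0).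
rewrite in_itv /= g0 sub0r => /andP[ht t0] E; exists t.
  by rewrite !ler0_norm ?lerN2// ltW.
by rewrite -[LHS]opprB E; ring.
Qed.

(** Derivability is only directional here, so linearity in the direction has to be earned: walk
    along [e1], then along [e2], use the mean value theorem on each leg and continuity of the
    partial derivatives. *)
Lemma deriveDdir f z (a b : R) : class_C 1 f ->
  'D_(a, b) f z = a * 'D_e1 f z + b * 'D_e2 f z.
Proof.
move=> [cf df Cf]; apply/cvg_lim => //.
apply/cvgrPdist_lt => /= eps eps0.
have c1 : 'D_e1 f @ z --> 'D_e1 f z := Cf e1 z.
have c2 : 'D_e2 f @ z --> 'D_e2 f z := Cf e2 z.
have A0 : 0 < `|a| + `|b| + 1 :> R by rewrite ltr_wpDl// addr_ge0.
have eA : 0 < eps / (`|a| + `|b| + 1) by rewrite divr_gt0.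
move/cvgrPdist_lt: c1 => /(_ _ eA)/nbhs_normP[r1 /= r10 H1].
move/cvgrPdist_lt: c2 => /(_ _ eA)/nbhs_normP[r2 /= r20 H2].
have r0 : 0 < Num.min r1 r2 / (`|a| + `|b| + 1) by rewrite divr_gt0// lt_min r10.
near=> h.
have h0 : h != 0 by near: h; exact: nbhs_dnbhs_neq.
have hr : `|h| * (`|a| + `|b| + 1) < Num.min r1 r2.
  by rewrite -ltr_pdivlMr//; near: h; exact: dnbhs0_lt.
have [t1 t1h E1] := @directional_mvt f e1 z (h * a) (fun w => df w e1).
have [t2 t2h E2] := @directional_mvt f e2 ((h * a) *: e1 + z) (h * b) (fun w => df w e2).
have -> : h *: (a, b) + z = (h * b) *: e2 + ((h * a) *: e1 + z).
  by rewrite [z]surjective_pairing; congr pair; rewrite /= -![_ *: _]/(_ * _); ring.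
have -> : h^-1 *: (f ((h * b) *: e2 + ((h * a) *: e1 + z)) - f z) =
    b * 'D_e2 f (t2 *: e2 + ((h * a) *: e1 + z)) + a * 'D_e1 f (t1 *: e1 + z).
  rewrite -[f _ - f z](subrKA (f ((h * a) *: e1 + z))) E1 E2 -[_ *: _]/(_ * _).
  by field.
rewrite normrM in t1h; rewrite normrM in t2h.
have B1 : `|'D_e1 f z - 'D_e1 f (t1 *: e1 + z)| < eps / (`|a| + `|b| + 1).
  apply: H1; rewrite /ball_ /= opprD addrCA subrr addr0 normrN ltr_norm_pair /=.
  rewrite -![_ *: _]/(_ * _) mulr1 mulr0 normr0.
  move: hr; rewrite lt_min => /andP[hr _]; rewrite r10 andbT.
  by have := normr_ge0 b; have := normr_ge0 h; nra.
have B2 : `|'D_e2 f z - 'D_e2 f (t2 *: e2 + ((h * a) *: e1 + z))| < eps / (`|a| + `|b| + 1).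
  apply: H2; rewrite /ball_ /= addrA opprD addrCA subrr addr0 normrN ltr_norm_pair /=.
  rewrite -![_ *: _]/(_ * _) !mulr1 !mulr0 addr0 add0r normrM.
  move: hr; rewrite lt_min => /andP[_ hr].
  by have := normr_ge0 b; have := normr_ge0 a; have := normr_ge0 h; move=> *; apply/andP;
    split; nra.
set d1 := 'D_e1 f z in B1 *; set d2 := 'D_e2 f z in B2 *.
set d1' := 'D_e1 f _ in B1 *; set d2' := 'D_e2 f _ in B2 *.
have -> : a * d1 + b * d2 - (b * d2' + a * d1') = a * (d1 - d1') + b * (d2 - d2') by ring.
apply: le_lt_trans (ler_normD _ _) _; rewrite !normrM.
have : (`|a| + `|b|) * (eps / (`|a| + `|b| + 1)) < eps.
  by rewrite mulrA ltr_pdivrMr// mulrC ltr_pM2l// ltrDl.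
have := ler_wpM2l (normr_ge0 a) (ltW B1); have := ler_wpM2l (normr_ge0 b) (ltW B2).
lra.
Unshelve. all: by end_near. Qed.

(** Two legs parallel to the axes, each at most the max norm of [z - w]: hence the factor 2. *)
Lemma lipschitz_of_bounded_derive f (M : R) : (forall z e, derivable f z e) ->
  (forall z, `|'D_e1 f z| <= M) -> (forall z, `|'D_e2 f z| <= M) ->
  forall z w, `|f z - f w| <= 2 * M * `|z - w|.
Proof.
move=> df b1 b2 z w.
have [t1 _ E1] := @directional_mvt f e1 w (z.1 - w.1) (fun w => df w e1).
have [t2 _ E2] := @directional_mvt f e2 ((z.1 - w.1) *: e1 + w) (z.2 - w.2) (fun w => df w e2).
have Ez : z = (z.2 - w.2) *: e2 + ((z.1 - w.1) *: e1 + w).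
  by rewrite [LHS]surjective_pairing; congr pair; rewrite /= -![_ *: _]/(_ * _); ring.
rewrite {1}Ez -[f _ - f w](subrKA (f ((z.1 - w.1) *: e1 + w))) E1 E2.
apply: le_trans (ler_normD _ _) _; rewrite !normrM.
have := norm_fst_le (z - w); have := norm_snd_le (z - w).
have := b1 (t1 *: e1 + w); have := b2 (t2 *: e2 + ((z.1 - w.1) *: e1 + w)).
rewrite /=; set D2 := `|'D_e2 f _|; set D1 := `|'D_e1 f _| => H2 H1 Hs Hf.
have D10 : 0 <= D1 by exact: normr_ge0.
have D20 : 0 <= D2 by exact: normr_ge0.
have := ler_pM (normr_ge0 _) D20 Hs H2; have := ler_pM (normr_ge0 _) D10 Hf H1.
lra.
Qed.

Lemma derive_supp f e z : ~ closure [set z | f z != 0] z -> 'D_e f z = 0.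
Proof.
move=> nz; rewrite (@near_eq_derive _ _ _ f (cst 0)) ?derive_cst//.
have : nbhs z (~` closure [set z | f z != 0]).
  by apply: open_nbhs_nbhs; split=> //; exact/closed_openC/closed_closure.
apply: filterS => w nw; apply: contrapT => fw; apply: nw; apply: subset_closure.
by apply/eqP.
Qed.

Lemma compact_supp_bounded f : continuous f -> compact (closure [set z | f z != 0]) ->
  exists M, forall z, `|f z| <= M.
Proof.
move=> cf cK; have cA : compact (f @` closure [set z | f z != 0]).
  by apply: continuous_compact => //; exact: continuous_subspaceT.
have [M [Mr HM]] := compact_bounded cA; exists (Num.max 0 (M + 1)) => z.
have [->|fz] := eqVneq (f z) 0; first by rewrite normr0 le_max lexx.
rewrite le_max; apply/orP; right; apply: (HM (M + 1)); first by rewrite ltrDl.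
by exists z => //; exact: subset_closure.
Qed.

Lemma closure_subset_closed (T : topologicalType) (A B : set T) : closed B -> A `<=` B ->
  closure A `<=` B.
Proof. by move=> /closure_id {2}-> AB; exact: closure_subset. Qed.

Lemma derive_compact_supp f e : compact (closure [set z | f z != 0]) ->
  compact (closure [set z | 'D_e f z != 0]).
Proof.
move=> cK; apply: (subclosed_compact (@closed_closure _ _) cK).
apply: closure_subset_closed; first exact: closed_closure.
by move=> z /= Dz; apply: contrapT => /(derive_supp e) /eqP; rewrite (negbTE Dz).
Qed.

End Plane.

(** * Invariance of the area under reflections *)

Section AreaInvariance.
Context {R : realType}.
Local Notation mR := (measurableTypeR R).
Local Notation plane := (mR * mR)%type.
Local Notation lambda := (@lebesgue_measure R).

Lemma lebesgue_measure_shift (c : R) (A : set mR) : measurable A ->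
  lambda ((fun x : mR => (x + c : mR)) @^-1` A) = lambda A.
Proof.
move=> mA; have mf : measurable_fun setT (fun x : mR => (x + c : mR)).
  exact: measurable_funD.
pose F : {mfun mR >-> mR} := HB.pack (fun x : mR => (x + c : mR)) (isMeasurableFun.Build _ _ _
  _ _ mf).
rewrite [RHS](@lebesgue_measure_unique R (pushforward lambda F))//.
move=> _ [[a b]] _ <-; rewrite -[RHS]/(lambda (F @^-1` `]a, b]%classic)).
rewrite (_ : F @^-1` _ = `]a - c, b - c]%classic); last first.
  by apply/seteqP; split=> x /=; rewrite !in_itv /= ltrBlDr lerBrDr.
by rewrite !lebesgue_measure_itv /= !lte_fin ltrD2r -!EFinB opprB addrA subrK.
Qed.

Definition area_preserving (A : R * R -> R * R) :=
  measurable_fun (setT : set plane) (A : plane -> plane) /\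
  forall X : set plane, measurable X -> @area R (A @^-1` X) = @area R X.

Lemma area_preserving_comp A B : area_preserving A -> area_preserving B ->
  area_preserving (fun z => A (B z)).
Proof.
move=> [mA iA] [mB iB]; split; first exact: (measurableT_comp mA mB).
move=> X mX; rewrite -[LHS]/(area (B @^-1` (A @^-1` X))) iB ?iA//.
by rewrite -[X in measurable X]setTI; exact: mA.
Qed.

(** [area] integrates over vertical sections. Uniqueness of the product measure permits horizontal
    ones, on which a shear in the first coordinate is a translation. *)
Lemma area_sectionE (X : set plane) : measurable X ->
  area X = (\int[lambda]_y lambda (ysection X y))%E.
Proof.
move=> mX; rewrite -[RHS]/((lambda \x^ lambda)%E X).
apply: product_measure_unique => // A B mA mB; exact: product_measure2E.
Qed.

Lemma area_preserving_flip : area_preserving (fun z => (z.1, - z.2)).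
Proof.
have mf : measurable_fun setT (fun z : plane => ((z.1, - z.2) : plane)).
  apply: measurable_fun_pair => //; exact: measurableT_comp.
split=> // X mX.
rewrite /area /= /product_measure1; apply: eq_integral => x _ /=.
rewrite -[RHS]lebesgue_measureN//; exact: measurable_xsection.
Qed.

Lemma area_preserving_sheary (t : R) : area_preserving (fun z => (z.1, z.2 + t * z.1)).
Proof.
have mf : measurable_fun setT (fun z : plane => ((z.1, z.2 + t * z.1) : plane)).
  apply: measurable_fun_pair => //; apply: measurable_funD => //.
  exact: measurable_funM.
split=> // X mX.
rewrite /area /= /product_measure1; apply: eq_integral => x _ /=.
rewrite -[RHS](lebesgue_measure_shift (t * x))//; exact: measurable_xsection.
Qed.

Lemma area_preserving_shearx (t : R) : area_preserving (fun z => (z.1 + t * z.2, z.2)).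
Proof.
have mf : measurable_fun setT (fun z : plane => ((z.1 + t * z.2, z.2) : plane)).
  apply: measurable_fun_pair => //; apply: measurable_funD => //.
  exact: measurable_funM.
split=> // X mX.
rewrite !area_sectionE//; last by rewrite -[X in measurable X]setTI; exact: mf.
apply: eq_integral => y _ /=.
rewrite -[RHS](lebesgue_measure_shift (t * y))//; exact: measurable_ysection.
Qed.

(* A rotation is the product of three shears, which preserve area by Fubini. *)
Lemma area_preserving_rot (c s : R) : c ^+ 2 + s ^+ 2 = 1 -> 1 + c != 0 ->
  area_preserving (fun z => (c * z.1 - s * z.2, s * z.1 + c * z.2)).
Proof.
(* For c = cos th and s = sin th this is - tan (th / 2), which exists unless the rotation is a half
   turn. *)
move=> cs c1; pose t := - (s / (1 + c)).
have -> : (fun z : R * R => (c * z.1 - s * z.2, s * z.1 + c * z.2)) =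
   fun z => let w := (z.1 + t * z.2, z.2) in let w' := (w.1, w.2 + s * w.1) in
   (w'.1 + t * w'.2, w'.2).
  have ts : t * s = c - 1.
    rewrite /t mulNr; apply/(mulIf c1).
    by rewrite mulNr mulrAC divfK// -expr2 (_ : s ^+ 2 = 1 - c ^+ 2); [ring|lra].
  apply/funext => -[x y] /=; congr pair.
    rewrite (_ : x + t * y + t * _ = x * (1 + t * s) + t * y * (2 + t * s)); last by ring.
    rewrite ts; have tc : t * (1 + c) = - s by rewrite /t mulNr divfK.
    rewrite (_ : t * y * _ = t * (1 + c) * y); first by rewrite tc; ring.
    by ring.
  rewrite (_ : y + s * _ = s * x + y * (1 + t * s)); last by ring.
  by rewrite ts; ring.
exact: area_preserving_comp (area_preserving_comp (area_preserving_shearx _)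
  (area_preserving_sheary _)) (area_preserving_shearx _).
Qed.

(** Rotate the axis onto the real line, flip, rotate back. The range of [b] avoids the half turn, at
    which the shears degenerate. *)
Lemma area_preserving_reflect (b : R) : 0 < b < pi -> area_preserving (reflect b).
Proof.
move=> /andP[b0 bpi]; have cs := cos2Dsin2 b.
have c1 : 1 + cos b != 0.
  rewrite gt_eqF//; have : cos pi < cos b.
    by rewrite ltr_cos ?in_itv/= ?lexx ?pi_ge0 ?(ltW b0) ?(ltW bpi).
  by rewrite cospi; lra.
have -> : reflect b = fun z => let w := (cos b * z.1 - (- sin b) * z.2, - sin b * z.1 + cos b *
  z.2) in
   let w' := (w.1, - w.2) in (cos b * w'.1 - sin b * w'.2, sin b * w'.1 + cos b * w'.2).
  by apply/funext => -[x y]; rewrite /reflect mulr_natl mulr2n cosD sinD /=; congr pair => /=;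
    ring.
apply: area_preserving_comp (area_preserving_comp (area_preserving_rot cs c1)
  area_preserving_flip) (@area_preserving_rot (cos b) (- sin b) _ c1).
by rewrite sqrrN.
Qed.

End AreaInvariance.

(** * Measurable sets of the plane and change of variables *)

Section PlaneMeasure.
Context {R : realType}.
Local Notation mR := (measurableTypeR R).
Local Notation plane := (mR * mR)%type.
Local Notation lambda := (@lebesgue_measure R).

(** The sigma-algebra is the product one, generated by rectangles, so an open set is written with
    countably many rational boxes; those not inside [U] are replaced by [set0], which lets the union
    run over a whole countable type. *)
Lemma open_measurable_plane (U : set (R * R)) : open U -> measurable (U : set plane).
Proof.
move=> oU.
pose box (q : (rat * rat) * (rat * rat)) : set plane :=
  `]ratr q.1.1, ratr q.1.2[%classic `*` `]ratr q.2.1, ratr q.2.2[%classic.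
pose F q : set plane := if asbool (box q `<=` U) then box q else set0.
have -> : U = \bigcup_q F q.
  apply/seteqP; split=> [z Uz|z [q _]]; last first.
    by rewrite /F; case: asboolP => // qU; exact: qU.
  have /nbhs_normP[r /= r0 Br] : nbhs z U by exact: open_nbhs_nbhs.
  have lo (x : R) : x - r < x by rewrite ltrBlDr ltrDl.
  have hi (x : R) : x < x + r by rewrite ltrDl.
  have [a] := rat_in_itvoo (lo z.1); have [b] := rat_in_itvoo (hi z.1).
  have [c] := rat_in_itvoo (lo z.2); have [d] := rat_in_itvoo (hi z.2).
  rewrite !in_itv /= => /andP[d1 d2] /andP[c1 c2] /andP[b1 b2] /andP[a1 a2].
  exists ((a, b), (c, d)) => //; rewrite /F asboolT.
    by split; rewrite /= in_itv /= ?a2 ?b1 ?c2 ?d1.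
  move=> w [] /=; rewrite !in_itv /= => /andP[w1 w2] /andP[w3 w4].
  by apply: Br; rewrite /ball_ /= ltr_norm_pair /= !ltr_norml; apply/andP; split; lra.
apply: countable_bigcupT_measurable => // q; rewrite /F; case: asboolP => _ //.
by apply: measurableX; exact: measurable_itv.
Qed.

Lemma closed_measurable_plane (U : set (R * R)) : closed U -> measurable (U : set plane).
Proof.
move=> cU; rewrite -(setCK U); apply: measurableC.
by apply: open_measurable_plane; exact: closed_openC.
Qed.

Lemma continuous_measurable_plane (f : R * R -> R) : continuous f ->
  measurable_fun (setT : set plane) f.
Proof.
move=> cf; apply: (measurability _ (RGenOpens.measurableE R)).
move=> _ [_ [a [b ->]] <-]; rewrite setTI; apply: open_measurable_plane.
by move/continuousP: cf; apply; exact: interval_open.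
Qed.

Section Transport.
Variables (A : R * R -> R * R) (pA : area_preserving A).

Lemma measurable_preimage_preserving (D : set plane) : measurable D -> measurable (A @^-1` D :
  set plane).
Proof. by move=> mD; rewrite -[X in measurable X]setTI; exact: pA.1. Qed.

Lemma measurable_comp_preserving d (T : measurableType d) (D : set plane) (f : plane -> T) :
  measurable D -> measurable_fun D f -> measurable_fun (A @^-1` D) (fun z => f (A z)).
Proof.
move=> mD mf; apply: (measurable_comp mD _ mf); first by move=> _ [z Dz <-].
exact: measurable_funTS pA.1.
Qed.

Local Open Scope ereal_scope.
Lemma ge0_integral_preserving (D : set plane) (f : R * R -> \bar R) :
  measurable D -> measurable_fun D f -> (forall z, D z -> 0 <= f z) ->
  \int[area]_(z in A @^-1` D) f (A z) = \int[area]_(z in D) f z.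
Proof.
move=> mD mf f0.
have f0' : {in D, forall z, 0 <= f z} by move=> z; rewrite inE; exact: f0.
have H := @ge0_integral_pushforward _ _ plane plane R A pA.1 area D f mD mf f0'.
refine (eq_trans (esym H) _).
by apply: eq_measure_integral => [|mA X mX _]; [exact: pA.1|exact: pA.2].
Qed.

Lemma integral_preserving (D : set plane) (f : R * R -> \bar R) :
  measurable D -> measurable_fun D f ->
  \int[area]_(z in A @^-1` D) f (A z) = \int[area]_(z in D) f z.
Proof.
move=> mD mf; rewrite integralE [RHS]integralE; congr (_ - _).
  rewrite -(ge0_integral_preserving mD (measurable_funepos mf) (fun z _ => funepos_ge0 f z)).
  by apply: eq_integral => z _; rewrite !funeposE.
rewrite -(ge0_integral_preserving mD (measurable_funeneg mf) (fun z _ => funeneg_ge0 f z)).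
by apply: eq_integral => z _; rewrite !funenegE.
Qed.

Lemma integrable_preserving (D : set plane) (f : R * R -> \bar R) :
  measurable D -> area.-integrable D f ->
  area.-integrable (A @^-1` D) (fun z => f (A z)).
Proof.
move=> mD /integrableP[mf fi]; apply/integrableP; split.
  exact: measurable_comp_preserving.
rewrite (ge0_integral_preserving (f := fun z => `|f z|))//.
exact: measurableT_comp.
Qed.

End Transport.

Lemma line_null (c s : R) : s != 0 -> area [set z : plane | c * z.2 - s * z.1 = 0] = 0%E.
Proof.
move=> s0; have cl : closed [set z : R * R | c * z.2 - s * z.1 = 0].
  rewrite (_ : mkset _ = (fun z : R * R => c * z.2 - s * z.1) @^-1` [set 0])//.
  apply: preimage_closed => [z _|]; last exact: closed_eq.
  apply: cvgB; apply: cvgM; try exact: cvg_cst; [exact: cvg_snd|exact: cvg_fst].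
rewrite area_sectionE; last exact: closed_measurable_plane.
rewrite integral0_eq// => y _.
rewrite (_ : ysection _ _ = [set c * y / s]) ?lebesgue_measure_set1//.
apply/seteqP; split=> x; rewrite /ysection /= inE /=.
  move/subr0_eq => ->; rewrite mulrAC divff ?mul1r//.
by move=> ->; rewrite [s * _]mulrC divfK// subrr.
Qed.

End PlaneMeasure.

(** * Integration by parts *)

Section Parts.
Context {R : realType}.
Local Notation mR := (measurableTypeR R).
Local Notation plane := (mR * mR)%type.
Local Notation lambda := (@lebesgue_measure R).
Implicit Types (f g : R * R -> R) (K : set plane).

Definition box (r : R) : set plane := [set z | `|z.1| <= r /\ `|z.2| <= r].

Lemma boxE r : box r = `[- r, r]%classic `*` `[- r, r]%classic.
Proof.
by apply/seteqP; split=> z; rewrite /box /= !in_itv /= !ler_norml => -[].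
Qed.

Lemma measurable_box r : measurable (box r).
Proof. by rewrite boxE; apply: measurableX; exact: measurable_itv. Qed.

Lemma area_box_lty r : (area (box r) < +oo)%E.
Proof.
rewrite boxE; set I := `[_, _]%classic.
have -> : area (I `*` I : set plane) = (lambda I * lambda I)%E.
  by apply: product_measure1E; exact: measurable_itv.
rewrite /I lebesgue_measure_itv /=; case: ifP => _; last by rewrite mule0 ltry.
by rewrite -EFinB -EFinM ltry.
Qed.

Lemma integrable_bounded_box K f (M r : R) : measurable K -> measurable_fun K f ->
  (forall z, K z -> `|f z| <= M) -> (forall z, K z -> ~ box r z -> f z = 0) ->
  area.-integrable K (fun z => (f z)%:E).
Proof.
move=> mK mf fM f0.
have iI : area.-integrable K (fun z => (M * \1_(box r) z)%:E).
  have : area.-integrable K (fun z => M%:E * (\1_(box r) z)%:E)%E.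
    apply: integrableZl => //; apply: (@integrableS _ _ _ _ setT) => //.
    have mb := measurable_box r; apply/integrableP; split; first exact/measurable_EFinP.
    rewrite (eq_integral (fun z => (\1_(box r) z)%:E)); last first.
      by move=> z _; rewrite gee0_abs// lee_fin.
    by rewrite integral_indic// setIT; exact: area_box_lty.
  exact.
apply: le_integrable iI => //; first exact/measurable_EFinP.
move=> z Kz; rewrite /= lee_fin normrM indicE.
have [zb|zb] := boolP (z \in box r).
  by rewrite normr1 mulr1; exact: le_trans (fM z Kz) (ler_norm _).
by rewrite f0 ?normr0 ?mulr_ge0//; move/negP: zb; rewrite inE.
Qed.

Lemma compact_supp_box f : compact (closure [set z | f z != 0]) ->
  exists r, 0 < r /\ forall z, ~ box r z -> f z = 0.
Proof.
move=> /compact_bounded[M [Mr HM]]; exists (Num.max 1 (M + 1)); split.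
  by rewrite lt_max ltr01.
move=> z nb; apply: contrapT => /eqP fz; apply: nb.
have : `|z| <= Num.max 1 (M + 1).
  by apply: HM; [rewrite lt_max ltrDl ltr01 orbT|exact: subset_closure].
by rewrite ler_norm_pair => /andP[].
Qed.

Lemma integrable_test K f : measurable K -> continuous f ->
  compact (closure [set z | f z != 0]) -> area.-integrable K (fun z => (f z)%:E).
Proof.
move=> mK cf cs; have [M HM] := compact_supp_bounded cf cs.
have [r [_ Hr]] := compact_supp_box cs.
apply: (integrable_bounded_box (M := M) (r := r)) => // [|z _]; last exact: Hr.
by apply: measurable_funTS; exact: continuous_measurable_plane.
Qed.

Let integral_line (f df : R -> R) (r : R) : 0 < r ->
  (forall x, is_derive x (1 : R) f (df x)) -> continuous df ->
  (forall x, r < `|x| -> f x = 0 /\ df x = 0) ->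
  (\int[lambda]_(x in setT) (df x)%:E = 0)%E.
Proof.
move=> r0 dff cdf f0; pose s := r + 1.
have cf : continuous f.
  move=> x; apply: differentiable_continuous; apply/derivable1_diffP.
  exact: (@ex_derive _ _ _ _ _ _ _ (dff x)).
have -> : (\int[lambda]_(x in setT) (df x)%:E = \int[lambda]_(x in `[(- s)%R, s]) (df x)%:E)%E.
  rewrite [RHS]integral_mkcond; apply: eq_integral => x _; rewrite patchE.
  case: ifPn => //; rewrite notin_setE /= in_itv /= => /negP; rewrite -ler_norml -ltNge => sx.
  have rx : r < `|x| by move: sx; rewrite /s; lra.
  by rewrite (f0 _ rx).2.
rewrite (@continuous_FTC2 _ df f).
- have rs : r < `|s| by rewrite /s gtr0_norm; lra.
  have rs' : r < `|- s| by rewrite normrN.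
  by rewrite (f0 _ rs).1 (f0 _ rs').1 subee.
- by rewrite /s; lra.
- exact: continuous_subspaceT.
- split; first by move=> x _; exact: (@ex_derive _ _ _ _ _ _ _ (dff x)).
  + exact: cvg_within_filter (cf (- s)).
  + exact: cvg_within_filter (cf s).
- by move=> x _; rewrite derive1E (@derive_val _ _ _ _ _ _ _ (dff x)).
Qed.

(** Fubini with the inner integral along the direction of differentiation, where it is a difference
    of two zero boundary values. *)
Lemma integral_derive1_eq0 f : class_C 1 f ->
  compact (closure [set z | f z != 0]) -> (\int[area]_z ('D_e1 f z)%:E = 0)%E.
Proof.
move=> [cf df Cf] cs; have [r [r0 Hr]] := compact_supp_box cs.
have cs1 := @derive_compact_supp R _ e1 cs.
have [r' [r'0 Hr']] := compact_supp_box cs1.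
have iD : area.-integrable setT (fun z => ('D_e1 f z)%:E).
  by apply: integrable_test => //; exact: Cf.
rewrite -[LHS](integral21_prod_meas1 iD) integral0_eq// => y _; rewrite /fubini_G /=.
have aff : affine_map (fun x : R^o => ((x, y) : R * R)) (fun h : R^o => h *: e1).
  by move=> h x z; congr pair; rewrite /= -![_ *: _]/(_ * _); ring.
have cpair : continuous (fun x : R => (x, y) : R * R).
  by move=> x; apply: (@cvg_pair _ _ _ (nbhs x) (nbhs x) (nbhs y)); [exact: cvg_id|exact:
    cvg_cst].
apply: (@integral_line (fun x => f (x, y)) (fun x => 'D_e1 f (x, y)) (Num.max r r')).
- by rewrite lt_max r0.
- move=> x; apply: DeriveDef.
    by apply: (derivable_comp_affine aff); rewrite scale1r.
  by rewrite (@derive_comp_affine _ _ _ _ _ f x 1 aff) scale1r.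
- by move=> x; exact: (@continuous_comp _ _ _ (fun x : R => (x, y)) ('D_e1 f) x (cpair x) (Cf
    e1 _)).
- move=> x; rewrite gt_max => /andP[rx r'x]; split.
    by apply: Hr => -[/=]; rewrite leNgt rx.
  by apply: Hr' => -[/=]; rewrite leNgt r'x.
Qed.

Lemma integral_derive2_eq0 f : class_C 1 f ->
  compact (closure [set z | f z != 0]) -> (\int[area]_z ('D_e2 f z)%:E = 0)%E.
Proof.
move=> [cf df Cf] cs; have [r [r0 Hr]] := compact_supp_box cs.
have cs1 := @derive_compact_supp R _ e2 cs.
have [r' [r'0 Hr']] := compact_supp_box cs1.
have iD : area.-integrable setT (fun z => ('D_e2 f z)%:E).
  by apply: integrable_test => //; exact: Cf.
rewrite -[LHS](integral12_prod_meas1 iD) integral0_eq// => y _; rewrite /fubini_F /=.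
have aff : affine_map (fun x : R^o => ((y, x) : R * R)) (fun h : R^o => h *: e2).
  by move=> h x z; congr pair; rewrite /= -![_ *: _]/(_ * _); ring.
have cpair : continuous (fun x : R => (y, x) : R * R).
  by move=> x; apply: (@cvg_pair _ _ _ (nbhs x) (nbhs y) (nbhs x)); [exact: cvg_cst|exact:
    cvg_id].
apply: (@integral_line (fun x => f (y, x)) (fun x => 'D_e2 f (y, x)) (Num.max r r')).
- by rewrite lt_max r0.
- move=> x; apply: DeriveDef.
    by apply: (derivable_comp_affine aff); rewrite scale1r.
  by rewrite (@derive_comp_affine _ _ _ _ _ f x 1 aff) scale1r.
- by move=> x; exact: (@continuous_comp _ _ _ (fun x : R => (y, x)) ('D_e2 f) x (cpair x) (Cf
    e2 _)).
- move=> x; rewrite gt_max => /andP[rx r'x]; split.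
    by apply: Hr => -[_ /=]; rewrite leNgt rx.
  by apply: Hr' => -[_ /=]; rewrite leNgt r'x.
Qed.

Lemma supp_mul f g : compact (closure [set z | g z != 0]) ->
  compact (closure [set z | f z * g z != 0]).
Proof.
move=> cs; apply: (subclosed_compact (@closed_closure _ _) cs).
apply: closureS => z /=; rewrite mulf_eq0; apply: contra => ->; exact: orbT.
Qed.

(** The two integrals combine into that of the derivative of the product, which extends by zero to
    the plane since [g] lives inside [K]. The support of [f] may leave [K], as it does for the
    approximants of the form domain. *)
Lemma parts_smooth K (e : R * R) f g : measurable K -> e = e1 \/ e = e2 ->
  class_C 1 f -> class_C 1 g -> compact (closure [set z | g z != 0]) ->
  closure [set z | g z != 0] `<=` K ->
  \int[area]_(z in K) (f z * 'D_e g z) = - \int[area]_(z in K) ('D_e f z * g z).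
Proof.
move=> mK ee Cf Cg cs sK; have [cf df Cf'] := Cf; have [cg dg Cg'] := Cg.
have Cfg : class_C 1 (fun z => f z * g z) by exact: class_CM.
have Efg z : 'D_e (fun z => f z * g z) z = f z * 'D_e g z + 'D_e f z * g z.
  by rewrite [RHS]addrC [_ * g z]mulrC addrC -[RHS]deriveM.
have i1 : area.-integrable K (EFin \o (fun z => f z * 'D_e g z)).
  apply: integrable_test => //; last exact: supp_mul (@derive_compact_supp R _ e cs).
  by move=> z; apply: cvgM; [exact: cf|exact: Cg'].
have i2 : area.-integrable K (EFin \o (fun z => 'D_e f z * g z)).
  apply: integrable_test => //; last exact: supp_mul cs.
  by move=> z; apply: cvgM; [exact: Cf'|exact: cg].
apply/eqP; rewrite -addr_eq0 -RintegralD//; apply/eqP.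
rewrite /Rintegral.
have -> : (\int[area]_(z in K) (f z * 'D_e g z + 'D_e f z * g z)%:E =
   \int[area]_z ('D_e (fun z => (f z * g z)%R) z)%:E)%E.
  rewrite integral_mkcond; apply: eq_integral => z _; rewrite patchE Efg.
  case: ifPn => // /negP; rewrite inE => nK; rewrite (@derive_supp R g e) ?mulr0 ?add0r; last
    by move/sK.
  suff -> : g z = 0 by rewrite mulr0.
  by apply: contrapT => /eqP gz; apply: nK; apply: sK; exact: subset_closure.
have cfg := @supp_mul f g cs.
suff -> : (\int[area]_z ('D_e (fun z => (f z * g z)%R) z)%:E = 0)%E by [].
by case: ee => ->; [exact: integral_derive1_eq0|exact: integral_derive2_eq0].
Qed.

End Parts.

(** * Square integrable functions and the form domain *)

Section SquareIntegrable.
Context {R : realType}.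
Local Notation mR := (measurableTypeR R).
Local Notation plane := (mR * mR)%type.
Variables (K : set plane) (mK : measurable K).
Implicit Types (u v w f g : R * R -> R).

Lemma L2_mul_integrable u v : L2 K u -> L2 K v ->
  area.-integrable K (EFin \o (fun z => u z * v z)).
Proof.
move=> [mu iu] [mv iv].
have iS : area.-integrable K (fun z => (u z ^+ 2 + v z ^+ 2)%:E).
  have : area.-integrable K (fun z => (u z ^+ 2)%:E + (v z ^+ 2)%:E)%E by exact: integrableD.
  exact.
apply: le_integrable iS => //.
  by apply/measurable_EFinP; exact: measurable_funM.
move=> z Kz; rewrite /= lee_fin normrM [leRHS]ger0_norm ?addr_ge0 ?sqr_ge0//.
have := sqr_ge0 (`|u z| - `|v z|); rewrite -(real_normK (num_real (u z))) -(real_normK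
  (num_real (v z))).
by have := normr_ge0 (u z); have := normr_ge0 (v z); nra.
Qed.

Lemma L2D u v : L2 K u -> L2 K v -> L2 K (fun z => u z + v z).
Proof.
move=> Hu Hv; have [mu iu] := Hu; have [mv iv] := Hv.
split; first exact: measurable_funD.
have iS : area.-integrable K (fun z => (2 * (u z ^+ 2) + 2 * (v z ^+ 2))%:E).
  have : area.-integrable K (fun z => 2%:E * (u z ^+ 2)%:E + 2%:E * (v z ^+ 2)%:E)%E.
    by apply: integrableD => //; exact: integrableZl.
  exact.
apply: le_integrable iS => //.
  by apply/measurable_EFinP; apply: measurable_funX; exact: measurable_funD.
move=> z Kz; rewrite /= lee_fin [leLHS]ger0_norm ?sqr_ge0//.
rewrite [leRHS]ger0_norm; last by rewrite addr_ge0// mulr_ge0// sqr_ge0.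
have := sqr_ge0 (u z - v z); nra.
Qed.

Lemma L2Z (c : R) u : L2 K u -> L2 K (fun z => c * u z).
Proof.
move=> [mu iu]; split; first exact: measurable_funM.
have -> : (fun z => ((c * u z) ^+ 2)%:E) = (fun z => (c ^+ 2)%:E * (u z ^+ 2)%:E)%E.
  by apply/funext => z; rewrite -EFinM exprMn.
exact: integrableZl.
Qed.

Lemma L2B u v : L2 K u -> L2 K v -> L2 K (fun z => u z - v z).
Proof.
move=> Hu /(L2Z (-1)) /(L2D Hu).
by rewrite (_ : (fun z => u z + -1 * v z) = fun z => u z - v z)//; apply/funext => z; rewrite
  mulN1r.
Qed.

Lemma L2_compact_supp f : continuous f -> compact (closure [set z | f z != 0]) -> L2 K f.
Proof.
move=> cf cs; split.
  by apply: measurable_funTS; exact: continuous_measurable_plane.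
have -> : (fun z => (f z ^+ 2)%:E) = (fun z => (f z * f z)%:E).
  by apply/funext => z; rewrite expr2.
apply: (@integrable_test R K (fun z => f z * f z) mK); last exact: supp_mul.
by move=> z; apply: cvgM; exact: cf.
Qed.

Lemma L2_zero : L2 K (fun=> 0).
Proof.
have cs : compact (closure [set z : R * R | (fun=> 0 : R) z != 0]).
  rewrite (_ : mkset _ = set0) ?closure0; first exact: compact0.
  by apply/seteqP; split=> z //=; rewrite eqxx.
by apply: L2_compact_supp => //; exact: cst_continuous.
Qed.

Lemma L2_eq u v : (forall z, K z -> u z = v z) -> L2 K u -> L2 K v.
Proof.
move=> uv [mu iu]; split.
  by apply: eq_measurable_fun mu => z; rewrite inE => /uv.
by apply: eq_integrable iu => // z; rewrite inE => /uv ->.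
Qed.

Lemma L2_integralE u : L2 K u ->
  (\int[area]_(z in K) (u z ^+ 2)%:E)%E = (\int[area]_(z in K) (u z ^+ 2))%:E.
Proof. by move=> [mu iu]; rewrite /Rintegral fineK//; exact: integrable_fin_num. Qed.

(** A weighted replacement for Cauchy-Schwarz: with [d] free, an error of size [d ^+ 2] in the
    integral of [u ^+ 2] costs only a multiple of [d]. Pointwise it is the square of [|u| - d |v|],
    divided by [2 d]. *)
Lemma young_integral u v (d : R) : 0 < d -> L2 K u -> L2 K v ->
  `|\int[area]_(z in K) (u z * v z)| <=
  (d^-1 * \int[area]_(z in K) (u z ^+ 2) + d * \int[area]_(z in K) (v z ^+ 2)) / 2.
Proof.
move=> d0 Hu Hv; have [mu iu] := Hu; have [mv iv] := Hv.
have d1 : 0 < d^-1 by rewrite invr_gt0.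
have iuv := L2_mul_integrable Hu Hv.
apply: le_trans (le_normr_Rintegral mK iuv) _.
have i1 : area.-integrable K (EFin \o (fun z => d^-1 / 2 * (u z ^+ 2))).
  have : area.-integrable K (fun z => (d^-1 / 2)%:E * (u z ^+ 2)%:E)%E by exact: integrableZl.
  exact.
have i2 : area.-integrable K (EFin \o (fun z => d / 2 * (v z ^+ 2))).
  have : area.-integrable K (fun z => (d / 2)%:E * (v z ^+ 2)%:E)%E by exact: integrableZl.
  exact.
have -> : (d^-1 * \int[area]_(z in K) (u z ^+ 2) + d * \int[area]_(z in K) (v z ^+ 2)) / 2 =
   \int[area]_(z in K) (d^-1 / 2 * (u z ^+ 2) + d / 2 * (v z ^+ 2)).
  rewrite RintegralD// RintegralZl// RintegralZl//; ring.
apply: le_Rintegral => //.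
- by apply: (@eq_integrable _ _ _ _ _ mK _ _ _ (integrable_norm iuv)) => z _.
- have : area.-integrable K (fun z => (d^-1 / 2 * u z ^+ 2)%:E + (d / 2 * v z ^+ 2)%:E)%E by
    exact: integrableD.
  exact.
move=> z Kz; rewrite normrM.
rewrite -(real_normK (num_real (u z))) -(real_normK (num_real (v z))).
set a := `|u z|; set b := `|v z|.
have : 0 <= d^-1 / 2 * (a - d * b) ^+ 2 by rewrite mulr_ge0 ?sqr_ge0// mulr_ge0// ltW.
suff -> : d^-1 / 2 * (a - d * b) ^+ 2 = d^-1 / 2 * a ^+ 2 + d / 2 * b ^+ 2 - a * b by lra.
by field; rewrite gt_eqF.
Qed.

End SquareIntegrable.

Section Closure.
Context {R : realType}.
Local Notation mR := (measurableTypeR R).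
Local Notation plane := (mR * mR)%type.
Implicit Types (K : set plane) (u w f phi psi : R * R -> R) (g : R * R -> R * R).

Definition energy u g psi z : R :=
  (u z - psi z) ^+ 2 + ((g z).1 - 'D_e1 psi z) ^+ 2 + ((g z).2 - 'D_e2 psi z) ^+ 2.

Lemma test_class_C n U phi : test_function U phi -> class_C n phi.
Proof. by move=> [/smoothP]. Qed.

Lemma test_supp U phi : test_function U phi -> compact (closure [set z | phi z != 0]).
Proof. by case. Qed.

Lemma test_derive_continuous U phi e : test_function U phi -> continuous ('D_e phi).
Proof. by move=> /(@test_class_C 1)[_ _ /(_ e)]. Qed.

Lemma L2_test K U phi : measurable K -> test_function U phi -> L2 K phi.
Proof.
move=> mK Hphi; apply: L2_compact_supp => //; last exact: test_supp Hphi.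
exact: class_C_continuous (@test_class_C 0 _ _ Hphi).
Qed.

Lemma L2_derive_test K U phi e : measurable K -> test_function U phi -> L2 K ('D_e phi).
Proof.
move=> mK Hphi; apply: L2_compact_supp => //; first exact: test_derive_continuous Hphi.
exact: derive_compact_supp (test_supp Hphi).
Qed.

Lemma energy_ge0 u g psi z : 0 <= energy u g psi z.
Proof. by rewrite /energy !addr_ge0// sqr_ge0. Qed.

Lemma measurable_energy K u g psi U : measurable K -> L2 K u -> L2 K (fst \o g) ->
  L2 K (snd \o g) -> test_function U psi ->
  measurable_fun K (fun z => (energy u g psi z)%:E).
Proof.
move=> mK [mu _] [m1 _] [m2 _] T; apply/measurable_EFinP.
have [mp _] := L2_test mK T.
have [mp1 _] := L2_derive_test e1 mK T; have [mp2 _] := L2_derive_test e2 mK T.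
apply: measurable_funD; first apply: measurable_funD.
- by apply: measurable_funX; exact: measurable_funB mu mp.
- by apply: measurable_funX; exact: measurable_funB m1 mp1.
- by apply: measurable_funX; exact: measurable_funB m2 mp2.
Qed.

(** Integration by parts passes to L^2 limits. Hence a transplant need only be approximated, and its
    weak derivatives are never computed directly. *)
Lemma weak_derivative_closure K e u w : measurable K -> e = e1 \/ e = e2 ->
  L2 K u -> L2 K w ->
  (forall d : R, 0 < d -> exists U psi, [/\ test_function U psi,
     (\int[area]_(z in K) ((u z - psi z) ^+ 2)%:E < d%:E)%E &
     (\int[area]_(z in K) ((w z - 'D_e psi z) ^+ 2)%:E < d%:E)%E]) ->
  weak_derivative K e u w.
Proof.
move=> mK ee Hu Hw H phi Tphi.
have L2phi := L2_test mK Tphi; have L2dphi := L2_derive_test e mK Tphi.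
apply/eqP; rewrite -addr_eq0; apply/eqP.
set A := \int[area]_(z in K) _; set B := \int[area]_(z in K) _.
set M1 := \int[area]_(z in K) (('D_e phi z) ^+ 2); set M2 := \int[area]_(z in K) ((phi z) ^+ 2).
have M10 : 0 <= M1 by apply: Rintegral_ge0 => z _; exact: sqr_ge0.
have M20 : 0 <= M2 by apply: Rintegral_ge0 => z _; exact: sqr_ge0.
(* Two uses of [young_integral], each with squared error below [d ^+ 2], add up to half of
   [d + d * M1 + d + d * M2]. *)
suff bd (d : R) : 0 < d -> `|A + B| <= d * ((2 + M1 + M2) / 2).
  apply: contrapT => /eqP; rewrite -normr_gt0 => AB0.
  have C0 : 0 < 2 + M1 + M2 by lra.
  have := bd (`|A + B| / (2 + M1 + M2)) (divr_gt0 AB0 C0).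
  rewrite (_ : _ / _ * _ = `|A + B| / 2); last by field; rewrite gt_eqF.
  by move: AB0; lra.
move=> d0; have dd0 : 0 < d ^+ 2 by rewrite exprn_gt0.
have [U [psi [Tpsi Ip Idp]]] := H _ dd0.
have L2psi := L2_test mK Tpsi; have L2dpsi := L2_derive_test e mK Tpsi.
have L2a := L2B mK Hu L2psi; have L2b := L2B mK Hw L2dpsi.
rewrite (L2_integralE mK L2a) lte_fin in Ip; rewrite (L2_integralE mK L2b) lte_fin in Idp.
have P : \int[area]_(z in K) (psi z * 'D_e phi z) = - \int[area]_(z in K) ('D_e psi z * phi z).
  have [_ cs sK] := Tphi.
  by apply: parts_smooth => //; [exact: test_class_C Tpsi|exact: test_class_C Tphi].
have EA : A = \int[area]_(z in K) ((u z - psi z) * 'D_e phi z) +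
              \int[area]_(z in K) (psi z * 'D_e phi z).
  rewrite -RintegralD//; [|exact: L2_mul_integrable L2a L2dphi|exact: L2_mul_integrable L2psi
    L2dphi].
  by apply: eq_Rintegral => z _; rewrite -mulrDl subrK.
have EB : B = \int[area]_(z in K) ((w z - 'D_e psi z) * phi z) +
              \int[area]_(z in K) ('D_e psi z * phi z).
  rewrite -RintegralD//; [|exact: L2_mul_integrable L2b L2phi|exact: L2_mul_integrable L2dpsi
    L2phi].
  by apply: eq_Rintegral => z _; rewrite -mulrDl subrK.
rewrite EA EB P addrACA addNr addr0.
apply: le_trans (ler_normD _ _) _.
have Y1 := young_integral mK d0 L2a L2dphi; have Y2 := young_integral mK d0 L2b L2phi.
apply: le_trans (lerD Y1 Y2) _.
have di : d^-1 * d ^+ 2 = d by rewrite expr2 mulKf// gt_eqF.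
have d1 : 0 <= d^-1 by rewrite invr_ge0 ltW.
have := ler_wpM2l d1 (ltW Ip); have := ler_wpM2l d1 (ltW Idp); rewrite di -/M1 -/M2.
lra.
Qed.

(** The energy dominates each of its three squares, so approximability alone already yields the weak
    gradient demanded by [form_domain]. *)
Lemma form_domain_closure K D u g : measurable K -> L2 K u -> L2 K (fst \o g) ->
  L2 K (snd \o g) ->
  (forall eps : R, 0 < eps -> exists2 psi, test_function (~` closure D) psi &
     (\int[area]_(z in K) (energy u g psi z)%:E < eps%:E)%E) ->
  form_domain K D u g.
Proof.
move=> mK Hu Hg1 Hg2 H; split=> //.
have W e w : e = e1 \/ e = e2 -> L2 K w ->
    (forall psi z, (w z - 'D_e psi z) ^+ 2 <= energy u g psi z) -> weak_derivative K e u w.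
  move=> ee Hw wE; apply: weak_derivative_closure => //.
  move=> d d0; have [psi T I] := H _ d0; exists (~` closure D), psi; split=> //;
    apply: le_lt_trans I; apply: ge0_le_integral; try exact: mK.
  - by move=> z _; rewrite lee_fin sqr_ge0.
  - by have [] := L2B mK Hu (L2_test mK T) => m _; apply/measurable_EFinP; exact:
      measurable_funX.
  - exact: measurable_energy T.
  - by move=> z _; rewrite lee_fin /energy -addrA lerDl addr_ge0// sqr_ge0.
  - by move=> z _; rewrite lee_fin sqr_ge0.
  - by have [] := L2B mK Hw (L2_derive_test e mK T) => m _; apply/measurable_EFinP; exact:
      measurable_funX.
  - exact: measurable_energy T.
  - by move=> z _; rewrite lee_fin.
split=> //; apply: W => //; try by [left|right].
- by move=> psi z; rewrite /energy addrAC lerDr addr_ge0// sqr_ge0.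
- by move=> psi z; rewrite /energy lerDr addr_ge0// sqr_ge0.
Qed.

End Closure.

(** * Isospectrality from an intertwining operator *)

Section Intertwining.
Context {R : realType}.
Local Notation mR := (measurableTypeR R).
Local Notation plane := (mR * mR)%type.
Variables (K : set plane) (mK : measurable K).
Implicit Types (u v f : R * R -> R) (g h : R * R -> R * R).

Lemma ae_eq_onP u v : ae_eq_on K u v <-> exists N : set plane,
  [/\ measurable N, area N = 0%E & forall z, K z -> ~ N z -> u z = v z].
Proof.
split=> [[N [mN N0 sN]]|[N [mN N0 sN]]]; exists N; split=> //.
  by move=> z Kz Nz; apply: contrapT => uv; apply: Nz; apply: sN => /(_ Kz).
by move=> z /= /not_implyP[Kz uv]; apply: contrapT => /(sN _ Kz).
Qed.

Lemma ae_eq_on_eq u v : (forall z, K z -> u z = v z) -> ae_eq_on K u v.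
Proof. by move=> uv; apply/ae_eq_onP; exists set0; split=> // z Kz _; exact: uv. Qed.

Lemma ae_eq_on_trans u v f : ae_eq_on K u v -> ae_eq_on K v f -> ae_eq_on K u f.
Proof.
move=> /ae_eq_onP[N [mN N0 H]] /ae_eq_onP[N' [mN' N'0 H']]; apply/ae_eq_onP.
exists (N `|` N'); split; first exact: measurableU.
  by rewrite null_set_setU.
by move=> z Kz /not_orP[nN nN']; rewrite H// H'.
Qed.

Lemma ae_eq_on_comp (F : R -> R) u v : ae_eq_on K u v ->
  ae_eq_on K (fun z => F (u z)) (fun z => F (v z)).
Proof.
move=> /ae_eq_onP[N [mN N0 H]]; apply/ae_eq_onP; exists N; split=> // z Kz Nz.
by rewrite H.
Qed.

Lemma ae_eq_on_sym u v : ae_eq_on K u v -> ae_eq_on K v u.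
Proof.
move=> /ae_eq_onP[N [mN N0 H]]; apply/ae_eq_onP; exists N; split=> // z Kz Nz.
by rewrite H.
Qed.

Lemma weak_solution_ae D (lambda : R) f f' u : L2 K f -> L2 K f' -> ae_eq_on K f f' ->
  weak_solution K D lambda f u -> weak_solution K D lambda f' u.
Proof.
move=> Lf Lf' ff' [g gu H]; exists g => // v h vh; rewrite (H v h vh); congr (_ + _).
have [[Lv _ _ _ _] _] := vh.
have m1 := measurable_int _ (L2_mul_integrable mK Lf Lv).
have m2 := measurable_int _ (L2_mul_integrable mK Lf' Lv).
congr fine.
refine (@ae_eq_integral _ _ _ area K (EFin \o (fun z => f' z * v z)) (EFin \o (fun z => f z * v
  z)) mK m1 m2 _).
have /ae_eq_onP[N [mN N0 H']] := ff'; exists N; split=> //.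
move=> z /= /not_implyP[Kz fv]; apply: contrapT => /(H' _ Kz) E.
by apply: fv; rewrite /= E.
Qed.

(* Q is the action of P on gradients: an intertwiner is a self-adjoint P, with
   self-adjoint Q, such that P o P = c almost everywhere. *)
Definition intertwiner (c : R) (P : (R * R -> R) -> R * R -> R)
    (Q : (R * R -> R * R) -> R * R -> R * R) :=
  [/\ (forall n (a : 'I_n -> R) (u : 'I_n -> R * R -> R),
         P (fun z => \sum_(i < n) a i * u i z) = fun z => \sum_(i < n) a i * P (u i) z),
      (forall u, L2 K u -> L2 K (P u)) /\
      (forall u, ae_eq_on K (P (P u)) (fun z => c * u z)),
      (forall u v, ae_eq_on K u v -> ae_eq_on K (P u) (P v)),
      (forall u v, L2 K u -> L2 K v ->
         \int[area]_(z in K) (P u z * v z) = \int[area]_(z in K) (u z * P v z)) &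
      (forall g h, L2 K (fst \o g) -> L2 K (snd \o g) -> L2 K (fst \o h) -> L2 K (snd \o h) ->
         \int[area]_(z in K) ((Q g z).1 * (h z).1 + (Q g z).2 * (h z).2) =
         \int[area]_(z in K) ((g z).1 * (Q h z).1 + (g z).2 * (Q h z).2))].

Definition form_map (P : (R * R -> R) -> R * R -> R)
    (Q : (R * R -> R * R) -> R * R -> R * R) D D' :=
  forall u g, form_domain K D u g -> form_domain K D' (P u) (Q g).

Section Transfer.
Variables (c : R) (P : (R * R -> R) -> R * R -> R)
  (Q : (R * R -> R * R) -> R * R -> R * R).
Hypotheses (c0 : c != 0) (PQ : intertwiner c P Q).

Lemma intertwinerZ a u : P (fun z => a * u z) = fun z => a * P u z.
Proof.
have [/(_ 1 (fun=> a) (fun=> u)) + _ _ _ _] := PQ.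
by under eq_fun do rewrite big_ord1; under [in RHS]eq_fun do rewrite big_ord1.
Qed.

Lemma intertwiner_cancel u v : ae_eq_on K (P u) (P v) -> ae_eq_on K u v.
Proof.
have [_ [_ PP] Pae _ _] := PQ.
move=> /Pae /(ae_eq_on_trans (ae_eq_on_sym (PP u))) /ae_eq_on_trans /(_ (PP v)).
move=> /(ae_eq_on_comp (fun x => c^-1 * x)).
by under eq_fun do rewrite mulKf//; under [X in ae_eq_on _ _ X]eq_fun do rewrite mulKf//.
Qed.

(** Test the new equation with [v]: adjointness moves [P] and [Q] onto [v] and its gradient, and
    [P v] is admissible for [D] by the reverse [form_map]. Natural boundary conditions are carried
    along unseen. *)
Lemma weak_solution_transfer D D' lambda f u : form_map P Q D D' -> form_map P Q D' D ->
  L2 K f -> weak_solution K D lambda f u -> weak_solution K D' lambda (P f) (P u).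
Proof.
have [_ [LP _] _ adjP adjQ] := PQ.
move=> FM FM' Lf [g gu H]; exists (Q g); first exact: FM.
have [[Lu Lg1 Lg2 _ _] _] := gu.
move=> v h vh; have [[Lv Lh1 Lh2 _ _] _] := vh.
by rewrite adjQ// (H _ _ (FM' _ _ vh)) !adjP.
Qed.

Lemma resolvent_transfer D D' : form_map P Q D D' -> form_map P Q D' D ->
  resolvent_set K D `<=` resolvent_set K D'.
Proof.
have [_ [LP PP] Pae _ _] := PQ.
move=> FM FM' lambda Hl f Lf.
(* Up to a null set, [c^-1 * P f] is a preimage of [f] under [P]: solve with it for [D], then apply
   [P]. *)
have LPf := LP _ Lf; have Lf1 := L2Z mK c^-1 LPf.
split.
  have [[u Hu] _] := Hl _ Lf1; exists (P u).
  apply: weak_solution_ae (weak_solution_transfer FM FM' Lf1 Hu) => //; first exact: LP.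
  rewrite intertwinerZ; have := ae_eq_on_comp (fun x => c^-1 * x) (PP f).
  by under [X in ae_eq_on _ _ X]eq_fun do rewrite mulKf//.
(* Uniqueness goes the other way: [P u] and [P v] both solve the problem for [D] with right hand
   side [P f]. *)
move=> u v Hu Hv; apply: intertwiner_cancel.
have [_] := Hl _ LPf; apply.
  exact: weak_solution_transfer Hu.
exact: weak_solution_transfer Hv.
Qed.

Lemma multiplicity_transfer D D' lambda n : form_map P Q D D' -> form_map P Q D' D ->
  (exists u : 'I_n -> R * R -> R, (forall i, eigenspace K D lambda (u i)) /\ ae_free K u) ->
  exists u : 'I_n -> R * R -> R, (forall i, eigenspace K D' lambda (u i)) /\ ae_free K u.
Proof.
have [Plin [LP PP] Pae _ _] := PQ.
move=> FM FM' [u [Hu fu]]; exists (fun i => P (u i)).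
have P0 : P (fun=> 0) = fun=> 0.
  have := intertwinerZ 0 (fun=> 0); under eq_fun do rewrite mul0r.
  by move=> ->; apply/funext => z; rewrite mul0r.
have L0 := L2_zero mK.
split=> [i|a Ha].
  by rewrite /eigenspace -P0; exact: weak_solution_transfer (Hu i).
apply: fu; apply: intertwiner_cancel; rewrite P0 Plin; exact: Ha.
Qed.

Lemma intertwiner_isospectral D D' : form_map P Q D D' -> form_map P Q D' D ->
  isospectral K D D'.
Proof.
move=> FM FM'; split.
  by congr (~` _); apply/seteqP; split; exact: resolvent_transfer.
move=> lambda; congr ereal_sup; congr image; apply/seteqP.
by split=> n; exact: multiplicity_transfer.
Qed.

End Transfer.

Lemma isospectral_trans D D' D'' : isospectral K D D' -> isospectral K D' D'' ->
  isospectral K D D''.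
Proof. by move=> [s1 m1] [s2 m2]; split=> [|l]; rewrite ?s1 ?m1. Qed.

End Intertwining.

(** * Reflections and the transplantation *)

Section Reflections.
Context {R : realType}.
Implicit Types (z w : R * R) (b : R).

Definition dot z w : R := z.1 * w.1 + z.2 * w.2.

Lemma reflectK b : involutive (reflect b).
Proof.
move=> z; have := cos2Dsin2 (2 * b); rewrite /reflect.
set c := cos _; set d := sin _ => cd; rewrite [RHS]surjective_pairing; congr pair => /=.
  by rewrite -[RHS]mulr1 -cd; ring.
by rewrite -[RHS]mulr1 -cd; ring.
Qed.

Lemma reflectD b z w : reflect b (z + w) = reflect b z + reflect b w.
Proof. by congr pair => /=; ring. Qed.

Lemma reflectZ b (k : R) z : reflect b (k *: z) = k *: reflect b z.
Proof. by congr pair; rewrite /= -![_ *: _]/(_ * _); ring. Qed.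

Lemma reflectN b z : reflect b (- z) = - reflect b z.
Proof. by rewrite -scaleN1r reflectZ scaleN1r. Qed.

Lemma reflectB b z w : reflect b (z - w) = reflect b z - reflect b w.
Proof. by rewrite reflectD reflectN. Qed.

Lemma reflect_affine b : affine_map (reflect b) (reflect b).
Proof. by move=> h e z; rewrite reflectD reflectZ. Qed.

Lemma dot_reflect b z w : dot (reflect b z) w = dot z (reflect b w).
Proof. by rewrite /dot /reflect /=; ring. Qed.

Lemma dotDr z w w' : dot z (w + w') = dot z w + dot z w'.
Proof. by rewrite /dot /=; ring. Qed.

Lemma dotNr z w : dot z (- w) = - dot z w.
Proof. by rewrite /dot /=; ring. Qed.

Lemma dot_inj z w : (forall e, dot e z = dot e w) -> z = w.
Proof.
move=> H; have := H (1, 0); have := H (0, 1).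
rewrite /dot /= !mul0r !mul1r !addr0 !add0r.
by case: z w H => [a b] [a' b'] _ /= -> ->.
Qed.

(** The norm is the max norm, which reflections do not preserve. This crude factor, once per
    reflection in a composition, is the source of the powers of 2 in the constants below. *)
Lemma norm_reflect_le b z : `|reflect b z| <= 2 * `|z|.
Proof.
have h1 := norm_fst_le z; have h2 := norm_snd_le z.
have c1 : `|cos (2 * b)| <= 1 by rewrite ler_norml cos_geN1 cos_le1.
have s1 : `|sin (2 * b)| <= 1 by rewrite ler_norml sin_geN1 sin_le1.
have P (x y : R) : `|x| <= `|z| -> `|y| <= 1 -> `|x * y| <= `|z|.
  by move=> xz y1; rewrite normrM -[leRHS]mulr1; apply: ler_pM.
rewrite ler_norm_pair /=; apply/andP; split.
  apply: le_trans (ler_normD _ _) _; have := P _ _ h1 c1; have := P _ _ h2 s1; lra.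
apply: le_trans (ler_normB _ _) _; have := P _ _ h1 s1; have := P _ _ h2 c1; lra.
Qed.

Lemma reflect_continuous b : continuous (reflect b).
Proof.
move=> z; apply/cvgrPdist_lt => /= e e0; near=> w.
rewrite -reflectB; apply: le_lt_trans (norm_reflect_le b (z - w)) _.
rewrite mulrC -ltr_pdivlMr//; near: w.
by apply: cvgr_dist_lt; [exact: cvg_id|rewrite divr_gt0].
Unshelve. all: by end_near. Qed.

(* side alpha (polar r phi) = r sin (phi - 2 alpha): it is negative on K_1 and
   K_2, positive on K_3 and K_4. *)
Definition side (alpha : R) z : R := z.2 * cos (2 * alpha) - z.1 * sin (2 * alpha).

(** The reflection at angle alpha exchanges the lines at angles 0 and 2 alpha, and with them, up to
    sign, the distances to these lines. *)
Lemma side_reflect alpha z : side alpha (reflect alpha z) = - z.2.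
Proof.
have := cos2Dsin2 (2 * alpha); rewrite /side /reflect /=.
set c := cos _; set d := sin _ => cd; rewrite -[in RHS](mulr1 z.2) -cd; ring.
Qed.

Lemma snd_reflect alpha z : (reflect alpha z).2 = - side alpha z.
Proof. by rewrite /side /reflect /=; ring. Qed.

Lemma side_reflect2 alpha z : side alpha (reflect (2 * alpha) z) = - side alpha z.
Proof.
have := cos2Dsin2 (2 * alpha); rewrite /side /reflect /= (mulr_natl (2 * alpha)) mulr2n cosD
  sinD.
set c := cos _; set d := sin _ => cd.
rewrite [RHS](_ : _ = (z.1 * d - z.2 * c) * (c ^+ 2 + d ^+ 2)); last by rewrite cd; ring.
by ring.
Qed.

Lemma side_continuous alpha : continuous (side alpha).
Proof.
move=> z; rewrite /side; apply: cvgB; apply: cvgM; try exact: cvg_cst; [exact: cvg_snd|exact: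
  cvg_fst].
Qed.

End Reflections.

(** * Operators that add two reflected copies of a field on each half *)

Section Fold.
Context {R : realType}.
Local Notation mR := (measurableTypeR R).
Local Notation plane := (mR * mR)%type.
Implicit Types (X Y K : set plane) (g h : R * R -> R * R) (B : R * R -> R * R).

Definition L2v X g := L2 X (fst \o g) /\ L2 X (snd \o g).

Lemma L2_sub X Y (u : R * R -> R) : measurable X -> measurable Y -> X `<=` Y -> L2 Y u -> L2 X
  u.
Proof.
move=> mX mY XY [mu iu]; split; first exact: measurable_funS mu.
exact: integrableS iu.
Qed.

Lemma L2_comp A Y (u : R * R -> R) : area_preserving A -> measurable Y -> L2 Y u ->
  L2 (A @^-1` Y) (fun z => u (A z)).
Proof.
move=> pA mY [mu iu]; split; first exact: (measurable_comp_preserving pA).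
exact: (integrable_preserving pA mY iu).
Qed.

Lemma dot_integrable X g h : measurable X -> L2v X g -> L2v X h ->
  area.-integrable X (EFin \o (fun z => dot (g z) (h z))).
Proof.
move=> mX [g1 g2] [h1 h2].
have i1 := L2_mul_integrable mX g1 h1; have i2 := L2_mul_integrable mX g2 h2.
have : area.-integrable X (fun z => ((g z).1 * (h z).1)%:E + ((g z).2 * (h z).2)%:E)%E by
  exact: integrableD.
exact.
Qed.

(* B' is the adjoint of the isometry B. *)
Definition isometry_pair B B' := [/\ forall x y, dot (B x) y = dot x (B' y),
  forall x, dot (B x) (B x) = dot x x, forall x y, B (x - y) = B x - B y &
  forall X g, measurable X -> L2v X g -> L2v X (B \o g)].

Lemma isometry_pair_id : isometry_pair id id.
Proof. by split. Qed.

Lemma isometry_pair_opp : isometry_pair -%R -%R.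
Proof.
split=> [x y|x|x y|X g mX [g1 g2]].
- by rewrite /dot /=; ring.
- by rewrite /dot /=; ring.
- by rewrite opprD.
- have E u : (fun z => -1 * u z) = (fun z => - u z) :> (R * R -> R).
    by apply/funext => z; rewrite mulN1r.
  by have := L2Z mX (-1) g1; have := L2Z mX (-1) g2; rewrite !E; split.
Qed.

Lemma isometry_pair_reflect b : isometry_pair (reflect b) (reflect b).
Proof.
split=> [x y|x|x y|X g mX [g1 g2]].
- exact: dot_reflect.
- by rewrite dot_reflect reflectK.
- exact: reflectB.
- split.
    apply: L2_eq (L2D mX (L2Z mX (cos (2 * b)) g1) (L2Z mX (sin (2 * b)) g2)) => //.
    by move=> z _; rewrite /reflect /=; ring.
  apply: L2_eq (L2B mX (L2Z mX (sin (2 * b)) g1) (L2Z mX (cos (2 * b)) g2)) => //.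
  by move=> z _; rewrite /reflect /=; ring.
Qed.

Lemma isometry_pair_comp B B' C C' : isometry_pair B B' -> isometry_pair C C' ->
  isometry_pair (B \o C) (C' \o B').
Proof.
move=> [b1 b2 b3 b4] [c1 c2 c3 c4]; split=> [x y|x|x y|X g mX Hg] /=.
- by rewrite b1 c1.
- by rewrite b2 c2.
- by rewrite c3 b3.
- exact: (b4 _ _ mX (c4 _ _ mX Hg)).
Qed.

Lemma L2v_comp A Y g : area_preserving A -> measurable Y -> L2v Y g ->
  L2v (A @^-1` Y) (g \o A).
Proof. by move=> pA mY [g1 g2]; split; [exact: (L2_comp pA mY g1)|exact: (L2_comp pA mY g2)].
  Qed.

Lemma Rintegral_preserving A Y (f : R * R -> R) : area_preserving A -> measurable Y ->
  measurable_fun Y f ->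
  \int[area]_(z in A @^-1` Y) f (A z) = \int[area]_(z in Y) f z.
Proof.
move=> pA mY mf; congr fine.
by apply: (integral_preserving (f := EFin \o f) pA mY); exact/measurable_EFinP.
Qed.

Section Operator.
Variables (alpha : R) (halpha : 0 < alpha < pi / 2) (K : set plane) (mK : measurable K).
Local Notation tau := (reflect alpha).
Local Notation sig := (reflect (2 * alpha)).
Local Notation s := (side alpha).
Hypothesis Ksig : forall z, K z -> K (sig z).
Hypothesis Ktau : forall z, K z -> s z < 0 -> K (tau z) /\ s (tau z) < 0.

Definition halfL : set plane := K `&` [set z | s z < 0].
Definition halfR : set plane := K `&` [set z | 0 < s z].

Lemma measurable_halfL : measurable halfL.
Proof.
apply: measurableI => //; apply: open_measurable_plane.
apply: open_comp (@open_lt R 0) => z _; exact: side_continuous.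
Qed.

Lemma measurable_halfR : measurable halfR.
Proof.
apply: measurableI => //; apply: open_measurable_plane.
apply: open_comp (@open_gt R 0) => z _; exact: side_continuous.
Qed.

Let mL := measurable_halfL.
Let mRt := measurable_halfR.

Lemma area_preserving_tau : area_preserving tau.
Proof.
case/andP: halpha => a0 a1; apply: area_preserving_reflect; rewrite a0 /=.
by apply: lt_trans a1 _; have := pi_gt0 R; lra.
Qed.

Lemma area_preserving_sig : area_preserving sig.
Proof.
case/andP: halpha => a0 a1; apply: area_preserving_reflect.
by apply/andP; split; [rewrite mulr_gt0|rewrite mulrC -ltr_pdivlMr].
Qed.

Let pt := area_preserving_tau.
Let ps := area_preserving_sig.

Lemma preimage_involution (T : Type) (A : T -> T) (X Y : set T) : involutive A ->
  (forall z, X z -> Y (A z)) -> (forall z, Y z -> X (A z)) -> A @^-1` Y = X.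
Proof. by move=> AK XY YX; apply/seteqP; split=> z /=; [move/YX; rewrite AK|exact: XY]. Qed.

Lemma tau_halfL : tau @^-1` halfL = halfL.
Proof.
have H z : halfL z -> halfL (tau z) by move=> [Kz sz]; exact: Ktau.
by apply: preimage_involution => //; exact: reflectK.
Qed.

Lemma sig_halfL : sig @^-1` halfL = halfR.
Proof.
apply: preimage_involution; first exact: reflectK.
  by move=> z [Kz sz]; split; [exact: Ksig|rewrite /= side_reflect2 oppr_lt0].
by move=> z [Kz sz]; split; [exact: Ksig|rewrite /= side_reflect2 oppr_gt0].
Qed.

Lemma sig_halfR : sig @^-1` halfR = halfL.
Proof.
apply: preimage_involution; first exact: reflectK.
  by move=> z [Kz sz]; split; [exact: Ksig|rewrite /= side_reflect2 oppr_gt0].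
by move=> z [Kz sz]; split; [exact: Ksig|rewrite /= side_reflect2 oppr_lt0].
Qed.

Lemma sigtau_halfR : (fun z => sig (tau z)) @^-1` halfR = halfL.
Proof. by rewrite -[LHS]/(tau @^-1` (sig @^-1` halfR)) sig_halfR tau_halfL. Qed.

Lemma tausig_halfL : (fun z => tau (sig z)) @^-1` halfL = halfR.
Proof. by rewrite -[LHS]/(sig @^-1` (tau @^-1` halfL)) tau_halfL sig_halfL. Qed.

Lemma sigtausig_halfR : (fun z => sig (tau (sig z))) @^-1` halfR = halfR.
Proof. by rewrite -[LHS]/(sig @^-1` ((fun z => sig (tau z)) @^-1` halfR)) sigtau_halfR
  sig_halfL. Qed.

Let pst := area_preserving_comp ps pt.
Let pts := area_preserving_comp pt ps.
Let psts := area_preserving_comp ps pts.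

Definition axis : set plane := [set z | s z = 0].

Lemma measurable_axis : measurable axis.
Proof.
apply: closed_measurable_plane; rewrite (_ : axis = s @^-1` [set 0])//.
by apply: preimage_closed => [z _|]; [exact: side_continuous|exact: closed_eq].
Qed.

Lemma area_axis : area axis = 0%E.
Proof.
rewrite -(@line_null R (cos (2 * alpha)) (sin (2 * alpha))); last first.
  case/andP: halpha => a0 a1; rewrite gt_eqF// sin_gt0_pi//.
  by apply/andP; split; [rewrite mulr_gt0|rewrite mulrC -ltr_pdivlMr].
by congr (area _); apply/seteqP; split=> z; rewrite /axis /side /= ![_ * z.1]mulrC ![_ *
  z.2]mulrC.
Qed.

Lemma halves : K = (halfL `|` halfR) `|` (K `&` axis).
Proof.
apply/seteqP; split=> z; last by move=> [[[]|[]]|[]].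
by move=> Kz; have [h|h|h] := ltgtP (s z) 0; [left; left|left; right|right].
Qed.

Lemma integral_halves (f : R * R -> \bar R) : measurable_fun K f ->
  (\int[area]_(z in K) f z = \int[area]_(z in halfL) f z + \int[area]_(z in halfR) f z)%E.
Proof.
move=> mf; have mA := measurable_axis.
have mKA : measurable (K `&` axis) by exact: measurableI.
have n0 : area (K `&` axis) = 0%E.
  apply/eqP; rewrite -measure_le0 -area_axis; apply: le_measure; rewrite ?inE//.
rewrite {1}halves integral_setU//; last 3 first.
- exact: measurableU.
- by rewrite -halves.
- by apply/disj_setPS => z /= [[[_ /= h]|[_ /= h]] [_ /= h']]; move: h; rewrite h' ltxx.
rewrite [X in (_ + X)%E]null_set_integral//; last by apply: measurable_funS mf => //; exact:
  subIsetl.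
rewrite adde0 integral_setU//.
  by apply: measurable_funS mf => // z [[]|[]].
by apply/disj_setPS => z /= [[_ /= h] [_ /= h']]; move: (lt_trans h h'); rewrite ltxx.
Qed.

(** Fixing the value 0 on the axis makes the glued function measurable there; as the axis is null,
    integrals see only the halves. *)
Lemma L2_halves (w : R * R -> R) : L2 halfL w -> L2 halfR w ->
  (forall z, s z = 0 -> w z = 0) -> L2 K w.
Proof.
move=> [m1 i1] [m2 i2] w0; have mA := measurable_axis.
have mKA : measurable (K `&` axis) by exact: measurableI.
have mw : measurable_fun K w.
  rewrite halves; apply/measurable_funU => //; first exact: measurableU.
  split; first by apply/measurable_funU.
  apply: (@eq_measurable_fun _ _ plane R (K `&` axis) (fun=> 0 : R)); last exact:
    measurable_cst.
  by move=> z; rewrite inE => -[_ /= /w0 ->].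
have mw2 : measurable_fun K (fun z => (w z ^+ 2)%:E).
  by apply/measurable_EFinP; exact: measurable_funX.
split=> //; apply/integrableP; split=> //.
rewrite integral_halves; last exact: measurableT_comp.
by apply: lte_add_pinfty; [have /integrableP[] := i1|have /integrableP[] := i2].
Qed.

Lemma Rintegral_halves (f : R * R -> R) : area.-integrable K (EFin \o f) ->
  \int[area]_(z in K) f z = \int[area]_(z in halfL) f z + \int[area]_(z in halfR) f z.
Proof.
move=> fi; have mf := measurable_int _ fi.
have i1 : area.-integrable halfL (EFin \o f).
  by apply: integrableS fi => //; exact: subIsetl.
have i2 : area.-integrable halfR (EFin \o f).
  by apply: integrableS fi => //; exact: subIsetl.
rewrite /Rintegral (integral_halves mf) fineD//.
  exact: (integrable_fin_num _ i1).
exact: (integrable_fin_num _ i2).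
Qed.

(* The common form of the transplantation of functions (the B's are then the
   identity up to sign) and of that of their gradients. *)
Definition fold_field (B1 B2 B3 B4 : R * R -> R * R) g z : R * R :=
  if s z < 0 then B1 (g (tau z)) + B2 (g (sig (tau z)))
  else if 0 < s z then B3 (g (tau (sig z))) + B4 (g (sig (tau (sig z))))
  else 0.

(** The scalar majorant of [fold_field]: applied to a squared length, it collects the copies that
    meet at [z], all with coefficient 1. *)
Definition fold_density (e : R * R -> R) z : R :=
  if s z < 0 then e (tau z) + e (sig (tau z))
  else if 0 < s z then e (tau (sig z)) + e (sig (tau (sig z)))
  else 0.

Lemma L2v_sub X Y g : measurable X -> measurable Y -> X `<=` Y -> L2v Y g -> L2v X g.
Proof. by move=> mX mY XY [g1 g2]; split; [exact: L2_sub g1|exact: L2_sub g2]. Qed.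

Lemma L2vD X g h : measurable X -> L2v X g -> L2v X h -> L2v X (fun z => g z + h z).
Proof. by move=> mX [g1 g2] [h1 h2]; split; [exact: (L2D mX g1 h1)|exact: (L2D mX g2 h2)]. Qed.

Lemma L2v_eq X g h : measurable X -> (forall z, X z -> g z = h z) -> L2v X g -> L2v X h.
Proof.
move=> mX gh [g1 g2]; split.
  by apply: (L2_eq mX _ g1) => z /gh /= ->.
by apply: (L2_eq mX _ g2) => z /gh /= ->.
Qed.

Lemma dotC x y : dot x y = dot y x :> R.
Proof. by rewrite /dot ![x.1 * _]mulrC ![x.2 * _]mulrC. Qed.

Section Fields.
Variables (B1 B2 B3 B4 : R * R -> R * R).
(** The maps [tau] and [sig tau sig] are involutions, so [B1] and [B4] have to be their own
    adjoints; [sig tau] and [tau sig] are inverse to each other, so [B2] and [B3] have to be mutual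
    adjoints. *)
Hypotheses (H1 : isometry_pair B1 B1) (H2 : isometry_pair B2 B3)
  (H3 : isometry_pair B3 B2) (H4 : isometry_pair B4 B4).
Local Notation fold := (fold_field B1 B2 B3 B4).

Let L2v_term A X Y B B' g : measurable X -> measurable Y -> area_preserving A ->
  A @^-1` Y = X -> isometry_pair B B' -> L2v Y g -> L2v X (B \o (g \o A)).
Proof.
by move=> mX mY pA AE [_ _ _ HB] Hg; apply: (HB _ _ mX); rewrite -AE; exact: (L2v_comp pA mY
  Hg).
Qed.

Section Terms.
Variable g : R * R -> R * R.
Hypothesis Hg : L2v K g.
Let gL : L2v halfL g. Proof. by apply: (L2v_sub _ mK _ Hg) => //; exact: subIsetl. Qed.
Let gR : L2v halfR g. Proof. by apply: (L2v_sub _ mK _ Hg) => //; exact: subIsetl. Qed.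

Lemma L2v_term1 : L2v halfL (B1 \o (g \o tau)).
Proof. exact: (L2v_term mL mL pt tau_halfL H1 gL). Qed.

Lemma L2v_term2 : L2v halfL (B2 \o (g \o (fun z => sig (tau z)))).
Proof. exact: (L2v_term mL mRt pst sigtau_halfR H2 gR). Qed.

Lemma L2v_term3 : L2v halfR (B3 \o (g \o (fun z => tau (sig z)))).
Proof. exact: (L2v_term mRt mL pts tausig_halfL H3 gL). Qed.

Lemma L2v_term4 : L2v halfR (B4 \o (g \o (fun z => sig (tau (sig z))))).
Proof. exact: (L2v_term mRt mRt psts sigtausig_halfR H4 gR). Qed.

Lemma L2v_fold : L2v K (fold g).
Proof.
have eL z : halfL z -> B1 (g (tau z)) + B2 (g (sig (tau z))) = fold g z.
  by move=> [_ /= sz]; rewrite /fold_field sz.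
have eR z : halfR z -> B3 (g (tau (sig z))) + B4 (g (sig (tau (sig z)))) = fold g z.
  by move=> [_ /= sz]; rewrite /fold_field sz ltNge ltW.
have [l1 l2] := L2v_eq mL eL (L2vD mL L2v_term1 L2v_term2).
have [r1 r2] := L2v_eq mRt eR (L2vD mRt L2v_term3 L2v_term4).
by split; apply: L2_halves => // z sz; rewrite /= /fold_field sz ltxx.
Qed.

Lemma Rintegral_fold h : L2v K h ->
  \int[area]_(z in K) dot (fold g z) (h z) =
  \int[area]_(z in halfL) dot (B1 (g (tau z))) (h z) +
  \int[area]_(z in halfL) dot (B2 (g (sig (tau z)))) (h z) +
  (\int[area]_(z in halfR) dot (B3 (g (tau (sig z)))) (h z) +
   \int[area]_(z in halfR) dot (B4 (g (sig (tau (sig z))))) (h z)).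
Proof.
move=> Hh; have hL : L2v halfL h by apply: L2v_sub Hh => //; exact: subIsetl.
have hR : L2v halfR h by apply: L2v_sub Hh => //; exact: subIsetl.
have dotDl x y z : dot (x + y) z = dot x z + dot y z :> R by rewrite /dot /=; ring.
rewrite Rintegral_halves; last exact: dot_integrable L2v_fold Hh.
rewrite -RintegralD//; [|exact: dot_integrable L2v_term1 hL|exact: dot_integrable L2v_term2 hL].
rewrite -RintegralD//; [|exact: dot_integrable L2v_term3 hR|exact: dot_integrable L2v_term4 hR].
congr (_ + _); apply: eq_Rintegral => z; rewrite inE => -[_ /= sz].
  by rewrite /fold_field sz dotDl.
by rewrite /fold_field sz ltNge (ltW sz) dotDl.
Qed.

End Terms.

Let Rintegral_transport A A' X Y B B' g h : measurable X -> measurable Y ->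
  area_preserving A -> area_preserving A' -> A @^-1` Y = X -> A' @^-1` X = Y ->
  (forall z, A' (A z) = z) -> isometry_pair B B' -> isometry_pair B' B ->
  L2v K g -> L2v K h -> X `<=` K -> Y `<=` K ->
  \int[area]_(z in X) dot (B (g (A z))) (h z) = \int[area]_(z in Y) dot (B' (h (A' z))) (g z).
Proof.
move=> mX mY pA pA' AE AE' AK HB HB' Hg Hh XK YK.
have mf : measurable_fun Y (fun z => dot (B' (h (A' z))) (g z)).
  have hX := L2v_sub mX mK XK Hh; have gY := L2v_sub mY mK YK Hg.
  have /measurable_int := dot_integrable mY (L2v_term mY mX pA' AE' HB' hX) gY.
  by move/measurable_EFinP.
rewrite -(Rintegral_preserving pA mY mf) AE; apply: eq_Rintegral => z _.
by have [Ba _ _ _] := HB; rewrite AK Ba dotC.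
Qed.

(** In the block form given by [halfL] and [halfR], the diagonal blocks are self-adjoint and the
    off-diagonal ones are each other's adjoints; each block is moved by an area-preserving
    substitution. *)
Lemma fold_adjoint g h : L2v K g -> L2v K h ->
  \int[area]_(z in K) dot (fold g z) (h z) = \int[area]_(z in K) dot (g z) (fold h z).
Proof.
move=> Hg Hh; have LK : halfL `<=` K by exact: subIsetl.
have RK : halfR `<=` K by exact: subIsetl.
rewrite (Rintegral_fold Hg Hh).
under [RHS]eq_Rintegral do rewrite dotC; rewrite (Rintegral_fold Hh Hg).
have tK := @reflectK R alpha; have sK := @reflectK R (2 * alpha).
rewrite (Rintegral_transport mL mL pt pt tau_halfL tau_halfL tK H1 H1 Hg Hh)//.
rewrite (Rintegral_transport mL mRt pst pts sigtau_halfR tausig_halfL _ H2 H3 Hg Hh)//; last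
  first.
  by move=> z; rewrite sK tK.
rewrite (Rintegral_transport mRt mL pts pst tausig_halfL sigtau_halfR _ H3 H2 Hg Hh)//; last
  first.
  by move=> z; rewrite tK sK.
rewrite (Rintegral_transport mRt mRt psts psts sigtausig_halfR sigtausig_halfR _ H4 H4 Hg
  Hh)//; last first.
  by move=> z; rewrite sK tK sK.
by rewrite addrACA [X in X + _]addrC [X in _ = _ + X]addrC; ring.
Qed.

Lemma fold_norm_le g z :
  dot (fold g z) (fold g z) <= 2 * fold_density (fun w => dot (g w) (g w)) z.
Proof.
have Q (x y : R * R) : dot (x + y) (x + y) <= 2 * (dot x x + dot y y).
  rewrite -subr_ge0 (_ : _ - _ = dot (x - y) (x - y)); last by rewrite /dot /=; ring.
  by rewrite /dot -!expr2 addr_ge0// sqr_ge0.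
have [_ n1 _ _] := H1; have [_ n2 _ _] := H2; have [_ n3 _ _] := H3; have [_ n4 _ _] := H4.
rewrite /fold_field /fold_density; case: ifP => _; first by apply: le_trans (Q _ _) _; rewrite
  n1 n2.
case: ifP => _; first by apply: le_trans (Q _ _) _; rewrite n3 n4.
by rewrite /dot /= !mulr0 addr0.
Qed.

Lemma fold_fieldB g h z : fold g z - fold h z = fold (fun w => g w - h w) z.
Proof.
have [_ _ n1 _] := H1; have [_ _ n2 _] := H2; have [_ _ n3 _] := H3; have [_ _ n4 _] := H4.
rewrite /fold_field; case: ifP => _; first by rewrite n1 n2 opprD addrACA.
by case: ifP => _; [rewrite n3 n4 opprD addrACA|rewrite subrr].
Qed.

End Fields.

(** Each half receives one area-preserving copy of each half, so the integral doubles exactly. *)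
Lemma integral_fold_density (e : R * R -> R) : measurable_fun K e -> (forall z, 0 <= e z) ->
  (\int[area]_(z in K) (fold_density e z)%:E = 2%:E * \int[area]_(z in K) (e z)%:E)%E /\
  measurable_fun K (fold_density e).
Proof.
move=> me e0; have mA := measurable_axis.
have mKA : measurable (K `&` axis) by exact: measurableI.
have eL : measurable_fun halfL e by apply: measurable_funS me => //; exact: subIsetl.
have eR : measurable_fun halfR e by apply: measurable_funS me => //; exact: subIsetl.
have m1 : measurable_fun halfL (fun z => e (tau z)).
  by rewrite -{1}tau_halfL; exact: (measurable_comp_preserving pt).
have m2 : measurable_fun halfL (fun z => e (sig (tau z))).
  by rewrite -{1}sigtau_halfR; exact: (measurable_comp_preserving pst).
have m3 : measurable_fun halfR (fun z => e (tau (sig z))).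
  by rewrite -{1}tausig_halfL; exact: (measurable_comp_preserving pts).
have m4 : measurable_fun halfR (fun z => e (sig (tau (sig z)))).
  by rewrite -{1}sigtausig_halfR; exact: (measurable_comp_preserving psts).
have dL z : halfL z -> fold_density e z = e (tau z) + e (sig (tau z)).
  by move=> [_ /= sz]; rewrite /fold_density sz.
have dR z : halfR z -> fold_density e z = e (tau (sig z)) + e (sig (tau (sig z))).
  by move=> [_ /= sz]; rewrite /fold_density sz ltNge ltW.
have mF : measurable_fun K (fold_density e).
  rewrite {1}halves; apply/measurable_funU => //; first exact: measurableU.
  split; first apply/measurable_funU => //; first split.
  - apply: (eq_measurable_fun (fun z => e (tau z) + e (sig (tau z)))).
      by move=> z; rewrite inE => /dL.
    exact: measurable_funD.
  - apply: (eq_measurable_fun (fun z => e (tau (sig z)) + e (sig (tau (sig z))))).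
      by move=> z; rewrite inE => /dR.
    exact: measurable_funD.
  - apply: (@eq_measurable_fun _ _ plane R (K `&` axis) (fun=> 0 : R)); last exact:
      measurable_cst.
    by move=> z; rewrite inE => -[_ /= sz]; rewrite /fold_density sz ltxx.
split=> //.
have T A X Y : area_preserving A -> measurable Y -> A @^-1` Y = X -> measurable_fun Y e ->
    (\int[area]_(z in X) (e (A z))%:E = \int[area]_(z in Y) (e z)%:E)%E.
  move=> pA mY AE mY'; rewrite -AE.
  by apply: (ge0_integral_preserving (f := EFin \o e) pA mY) => //;
    [exact/measurable_EFinP|move=> z _; rewrite lee_fin].
rewrite !integral_halves; [|exact/measurable_EFinP|exact/measurable_EFinP].
set IL := (\int[area]_(z in halfL) (e z)%:E)%E; set IR := (\int[area]_(z in halfR) (e z)%:E)%E.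
have -> : (\int[area]_(z in halfL) (fold_density e z)%:E = IL + IR)%E.
  transitivity (\int[area]_(z in halfL) ((e (tau z))%:E + (e (sig (tau z)))%:E))%E.
    apply: eq_integral.
    by move=> z; rewrite inE => /dL ->.
  rewrite ge0_integralD//; try (by move=> z _; rewrite lee_fin); try exact/measurable_EFinP.
  by rewrite (T _ _ _ pt mL tau_halfL eL) (T _ _ _ pst mRt sigtau_halfR eR).
have -> : (\int[area]_(z in halfR) (fold_density e z)%:E = IL + IR)%E.
  transitivity (\int[area]_(z in halfR) ((e (tau (sig z)))%:E + (e (sig (tau (sig z))))%:E))%E.
    apply: eq_integral.
    by move=> z; rewrite inE => /dR ->.
  rewrite ge0_integralD//; try (by move=> z _; rewrite lee_fin); try exact/measurable_EFinP.
  by rewrite (T _ _ _ pts mL tausig_halfL eL) (T _ _ _ psts mRt sigtausig_halfR eR).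
by rewrite mule_natl mule2n.
Qed.

End Operator.
End Fold.

Section Operators.
Context {R : realType}.
Local Notation mR := (measurableTypeR R).
Local Notation plane := (mR * mR)%type.
Implicit Types (u v f : R * R -> R) (g h : R * R -> R * R).
Variables (alpha : R) (halpha : 0 < alpha < pi / 2) (K : set plane) (mK : measurable K).
Local Notation tau := (reflect alpha).
Local Notation sig := (reflect (2 * alpha)).
Local Notation s := (side alpha).
Hypothesis Ksig : forall z, K z -> K (sig z).
Hypothesis Ktau : forall z, K z -> s z < 0 -> K (tau z) /\ s (tau z) < 0.

(* Read back on K_1 through the reflections, u becomes the quadruple
   (u_1, u_2, u_3, u_4) of its values on K_1, ..., K_4, and its transplant is
   (u_2 + u_3, u_1 + u_4, u_1 - u_4, u_2 - u_3).  The four formulas collapse to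
   two because the reflection tau exchanges K_1 and K_2. *)
Definition transplant u z : R :=
  if s z < 0 then u (tau z) + u (sig (tau z))
  else if 0 < s z then u (tau (sig z)) - u (sig (tau (sig z)))
  else 0.

(** Coefficients dictated by the chain rule: the gradient of [u] composed with [sig \o tau] is
    [tau \o sig] applied to the gradient of [u]. Hence the reversed orders, and the minus sign of
    the last term of [transplant]. *)
Definition transplant_field : (R * R -> R * R) -> R * R -> R * R :=
  fold_field alpha tau (tau \o sig) (sig \o tau) (-%R \o (sig \o (tau \o sig))).

Let pair2 : isometry_pair (tau \o sig) (sig \o tau).
Proof. exact: isometry_pair_comp (isometry_pair_reflect _) (isometry_pair_reflect _). Qed.

Let pair3 : isometry_pair (sig \o tau) (tau \o sig).
Proof. exact: isometry_pair_comp (isometry_pair_reflect _) (isometry_pair_reflect _). Qed.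

Lemma transplant_pair4 : isometry_pair (-%R \o (sig \o (tau \o sig))) (-%R \o (sig \o (tau \o
  sig))).
Proof.
have := isometry_pair_comp (isometry_pair_opp (R := R))
  (isometry_pair_comp (isometry_pair_reflect (2 * alpha)) pair2).
have -> : (((sig \o tau) \o sig) \o -%R) = (-%R \o (sig \o (tau \o sig))) :> (R * R -> R * R).
  by apply/funext => z /=; rewrite !reflectN.
exact.
Qed.

(** Placing a function in the first component of a field lets the adjointness and norm bounds of
    [fold_field] serve functions and gradients alike. *)
Lemma transplant_pair u z :
  fold_field alpha id id id -%R (fun w => (u w, 0)) z = (transplant u z, 0).
Proof.
rewrite /fold_field /transplant; case: ifP => _; first by congr pair => /=; rewrite addr0.
by case: ifP => _ //; congr pair => /=; rewrite oppr0 addr0.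
Qed.

Lemma L2v_pair u : L2 K u -> L2v K (fun z => (u z, 0)).
Proof. by move=> Hu; split; [exact: Hu|exact: L2_zero mK]. Qed.

Lemma ae_eq_on_preimage A u v : area_preserving A ->
  (exists N : set plane, [/\ measurable N, area N = 0%E & forall z, K z -> ~ N z -> u z = v z])
    ->
  exists N : set plane, [/\ measurable N, area N = 0%E & forall z, K (A z) -> ~ N z -> u (A z)
    = v (A z)].
Proof.
move=> pA [N [mN N0 H]]; exists (A @^-1` N); split=> [||z KA NA]; last exact: H.
- exact: measurable_preimage_preserving.
- by rewrite pA.2.
Qed.

Lemma transplant_intertwiner : intertwiner K 2 transplant transplant_field.
Proof.
split.
- move=> n a u; apply/funext => z; rewrite /transplant.
  case: ifP => _; first by rewrite -big_split; apply: eq_bigr => i _; rewrite mulrDr.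
  case: ifP => _; first by rewrite -sumrB; apply: eq_bigr => i _; rewrite mulrBr.
  by rewrite big1// => i _; rewrite mulr0.
- split=> [u Hu|u].
    have [+ _] := L2v_fold halpha mK Ksig Ktau (isometry_pair_id (R := R))
      (isometry_pair_id (R := R)) (isometry_pair_id (R := R)) (isometry_pair_opp (R := R))
        (L2v_pair Hu).
    by apply: L2_eq => // z _; rewrite /= transplant_pair.
  (* On the axis [transplant] is 0 by convention. Elsewhere the second application yields [u z]
     twice and [u (sig z)] twice with opposite signs. *)
  apply/ae_eq_onP; exists (axis alpha); split; first exact: measurable_axis.
    exact: area_axis.
  move=> z Kz /= sz; rewrite /transplant; have [sz'|sz'|//] := ltgtP (s z) 0.
    have [_ st] := Ktau Kz sz'.
    rewrite st side_reflect2 oppr_lt0 oppr_gt0 st ltNge ltW//= !reflectK; ring.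
  have Ks := Ksig Kz; have ss : s (sig z) < 0 by rewrite side_reflect2 oppr_lt0.
  have [_ st] := Ktau Ks ss.
  rewrite st side_reflect2 oppr_lt0 oppr_gt0 st ltNge (ltW st)/= !reflectK; ring.
- move=> u v /ae_eq_onP E; apply/ae_eq_onP.
  have pt := area_preserving_tau halpha; have ps := area_preserving_sig halpha.
  have [N1 [m1 z1 E1]] := ae_eq_on_preimage pt E.
  have [N2 [m2 z2 E2]] := ae_eq_on_preimage (area_preserving_comp ps pt) E.
  have [N3 [m3 z3 E3]] := ae_eq_on_preimage (area_preserving_comp pt ps) E.
  have [N4 [m4 z4 E4]] := ae_eq_on_preimage (area_preserving_comp ps (area_preserving_comp pt
    ps)) E.
  exists ((N1 `|` N2) `|` (N3 `|` N4)); split.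
  + by do 2 (apply: measurableU => //); exact: measurableU.
  + by rewrite !null_set_setU//; exact: measurableU.
  + move=> z Kz /not_orP[/not_orP[n1 n2] /not_orP[n3 n4]]; rewrite /transplant.
    case: ifP => sz.
      have [Kt _] := Ktau Kz sz; rewrite E1// E2//; exact: Ksig.
    case: ifP => // sz'; have Ks := Ksig Kz; have ss : s (sig z) < 0 by rewrite side_reflect2
      oppr_lt0.
    have [Kt _] := Ktau Ks ss; rewrite E3// E4//; exact: Ksig.
- move=> u v Hu Hv.
  have := fold_adjoint halpha mK Ksig Ktau (isometry_pair_id (R := R))
      (isometry_pair_id (R := R)) (isometry_pair_id (R := R)) (isometry_pair_opp (R := R))
        (L2v_pair Hu) (L2v_pair Hv).
  under eq_Rintegral do rewrite transplant_pair /dot /= mulr0 addr0.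
  by under [X in _ = X -> _]eq_Rintegral do rewrite transplant_pair /dot /= mulr0 addr0.
- move=> g h g1 g2 h1 h2.
  exact: (fold_adjoint halpha mK Ksig Ktau (isometry_pair_reflect _) pair2 pair3
    transplant_pair4 (conj g1 g2) (conj h1 h2)).
Qed.

End Operators.

(** * The mixed problem reflected in the axis at angle 2 alpha *)

Section ReflectedProblem.
Context {R : realType}.
Local Notation mR := (measurableTypeR R).
Local Notation plane := (mR * mR)%type.
Implicit Types (u v f psi : R * R -> R) (g h : R * R -> R * R).

Definition grad psi z : R * R := ('D_e1 psi z, 'D_e2 psi z).

Lemma derive_dot psi e z : class_C 1 psi -> 'D_e psi z = dot e (grad psi z).
Proof. by move=> C; rewrite {1}(surjective_pairing e) deriveDdir. Qed.

Lemma derive_comp_reflect psi b e z :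
  'D_e (fun z => psi (reflect b z)) z = 'D_(reflect b e) psi (reflect b z).
Proof. exact: derive_comp_affine (reflect_affine b). Qed.

Lemma class_C_comp_reflect n psi b : class_C n psi -> class_C n (fun z => psi (reflect b z)).
Proof. by apply: class_C_comp_affine (reflect_affine b) _; exact: reflect_continuous. Qed.

Lemma grad_reflect psi b z : class_C 1 psi ->
  grad (fun z => psi (reflect b z)) z = reflect b (grad psi (reflect b z)).
Proof.
move=> C; rewrite {1}/grad !derive_comp_reflect !(derive_dot _ _ C) !dot_reflect.
by rewrite [RHS]surjective_pairing; congr pair; rewrite /dot /=; ring.
Qed.

Lemma energyE u g psi z : energy u g psi z =
  (u z - psi z) ^+ 2 + dot (g z - grad psi z) (g z - grad psi z).
Proof. by rewrite /energy /dot /= -!expr2 addrA. Qed.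

Lemma image_reflectK b (A : set (R * R)) : reflect b @` (reflect b @` A) = A.
Proof.
apply/seteqP; split=> [_ [_ [w Aw <-] <-]|w Aw]; first by rewrite reflectK.
by exists (reflect b w); [exists w|rewrite reflectK].
Qed.

Lemma closure_reflect b (A : set (R * R)) z :
  closure (reflect b @` A) z -> closure A (reflect b z).
Proof.
move=> Hz; have cl : closed (reflect b @^-1` closure A).
  by apply: preimage_closed => [w _|]; [exact: reflect_continuous|exact: closed_closure].
apply: (closure_subset_closed cl) Hz => _ [w Aw <-] /=.
by rewrite reflectK; exact: subset_closure.
Qed.

Lemma closure_reflectP b (A : set (R * R)) z :
  closure A (reflect b z) -> closure (reflect b @` A) z.
Proof.
by rewrite -{1}(image_reflectK b A) => /closure_reflect; rewrite reflectK.
Qed.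

Lemma test_function_reflect b (A : set (R * R)) psi :
  test_function (~` closure A) psi ->
  test_function (~` closure (reflect b @` A)) (fun z => psi (reflect b z)).
Proof.
move=> T; have [_ cs sA] := T.
have sub : closure [set z | psi (reflect b z) != 0] `<=`
    reflect b @^-1` closure [set z | psi z != 0].
  apply: closure_subset_closed.
    by apply: preimage_closed => [w _|]; [exact: reflect_continuous|exact: closed_closure].
  by move=> z /= pz; exact: subset_closure.
split.
- by apply/smoothP => n; apply: class_C_comp_reflect; exact: test_class_C T.
- have cI : compact (reflect b @` closure [set z | psi z != 0]).
    apply: continuous_compact cs; apply: continuous_subspaceT; exact: reflect_continuous.
  apply: (subclosed_compact (@closed_closure _ _) cI) => z /sub /= Hz.
  by exists (reflect b z) => //; rewrite reflectK.
- by move=> z /sub /= /sA nA /closure_reflect.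
Qed.

Section Sigma.
Variables (alpha : R) (halpha : 0 < alpha < pi / 2) (K : set plane) (mK : measurable K).
Local Notation sig := (reflect (2 * alpha)).
Hypothesis Ksig : forall z, K z -> K (sig z).

Definition reflect_fun u z : R := u (sig z).
Definition reflect_field g z : R * R := sig (g (sig z)).

Let ps := area_preserving_sig halpha.

Let sigK : sig @^-1` K = K.
Proof. by apply: preimage_involution => //; exact: reflectK. Qed.

Lemma reflect_intertwiner : intertwiner K 1 reflect_fun reflect_field.
Proof.
split=> [//||u v /ae_eq_onP E|u v Hu Hv|g h g1 g2 h1 h2].
- split=> [u Hu|u]; first by rewrite -sigK; exact: L2_comp.
  by apply: ae_eq_on_eq => z _; rewrite /reflect_fun reflectK mul1r.
- apply/ae_eq_onP; have [N [mN N0 H]] := ae_eq_on_preimage ps E.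
  by exists N; split=> // z Kz; apply: H; exact: Ksig.
- have mf : measurable_fun K (fun z => u z * reflect_fun v z).
    have Lv : L2 K (reflect_fun v) by rewrite -sigK; exact: L2_comp.
    by have /measurable_int/measurable_EFinP := L2_mul_integrable mK Hu Lv.
  rewrite -(Rintegral_preserving ps mK mf) sigK; apply: eq_Rintegral => z _.
  by rewrite /reflect_fun reflectK.
- have mf : measurable_fun K (fun z => dot (g z) (reflect_field h z)).
    have Lh : L2v K (reflect_field h).
      have [_ _ _ Hb] := isometry_pair_reflect (2 * alpha).
      by apply: (Hb _ (h \o sig)) => //; rewrite -sigK; exact: L2v_comp.
    by have /measurable_int/measurable_EFinP := dot_integrable mK (conj g1 g2) Lh.
  rewrite -[RHS](Rintegral_preserving ps mK mf) sigK; apply: eq_Rintegral => z _.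
  by rewrite -[LHS]/(dot (reflect_field g z) (h z)) /reflect_field dot_reflect reflectK.
Qed.

Lemma reflect_form_map (D : set (R * R)) :
  form_map K reflect_fun reflect_field D (sig @` D).
Proof.
move=> u g [[Lu L1 L2' W1 W2] H].
have Lg : L2v K (reflect_field g).
  have [_ _ _ Hb] := isometry_pair_reflect (2 * alpha).
  by apply: (Hb _ (g \o sig)) => //; rewrite -sigK; exact: L2v_comp.
apply: form_domain_closure => //; try exact: Lg.1; try exact: Lg.2.
  by rewrite -sigK; exact: L2_comp.
move=> eps eps0; have [psi T I] := H _ eps0.
exists (fun z => psi (sig z)); first exact: test_function_reflect.
apply: le_lt_trans I.
have me := measurable_energy mK Lu L1 L2' T.
have -> : (\int[area]_(z in K) (energy (reflect_fun u) (reflect_field g) (fun z => psi (sig z))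
  z)%:E =
   \int[area]_(z in sig @^-1` K) (energy u g psi (sig z))%:E)%E.
  rewrite sigK; apply: eq_integral => z _.
  rewrite !energyE grad_reflect; last exact: test_class_C T.
  by rewrite /reflect_field -reflectB dot_reflect reflectK.
by rewrite (ge0_integral_preserving ps mK me)// => z _; rewrite lee_fin energy_ge0.
Qed.

End Sigma.
End ReflectedProblem.

(** * Approximation of a transplanted test function *)

Section Vanishing.
Context {R : realType}.
Local Notation mR := (measurableTypeR R).
Local Notation plane := (mR * mR)%type.

(** Dominated convergence, with a constant on a fixed box as majorant. It suffices that every point
    off [N] eventually leaves the strips on which the error lives. *)
Lemma eventually_small_integral (K N : set plane) (e : nat -> R * R -> R) (M r : R) :
  measurable K -> (forall n, measurable_fun K (e n)) ->
  measurable N -> area N = 0%E ->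
  (forall n z, K z -> ~ N z -> 0 <= e n z <= M) ->
  (forall n z, K z -> ~ N z -> ~ box r z -> e n z = 0) ->
  (forall z, K z -> ~ N z -> exists n0, forall n, (n0 <= n)%N -> e n z = 0) ->
  forall eps : R, 0 < eps -> exists n, (\int[area]_(z in K) (e n z)%:E < eps%:E)%E.
Proof.
move=> mK me mN N0 eM er ez eps eps0.
have iI : area.-integrable K (fun z => (`|M| * \1_(box r) z)%:E).
  apply: (@integrable_bounded_box _ _ _ `|M| r) => //.
  - by apply: measurable_funM => //; apply: measurable_indic; exact: measurable_box.
  - move=> z _; rewrite normrM normr_id indicE.
    by case: (_ \in _); rewrite /= ?normr1 ?normr0 ?mulr1 ?mulr0.
  - by move=> z _ nb; rewrite indicE memNset// mulr0.
have ae0 : {ae area, forall z, K z -> (e ^~ z n)%:E @[n --> \oo] --> (0 : R)%:E}.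
  exists N; split=> // z /= /not_implyP[Kz nc]; apply: contrapT => Nz; apply: nc.
  have [n0 H] := ez z Kz Nz.
  by apply: cvg_near_cst; exists n0 => // n /= /H ->.
have aeM : {ae area, forall z n, K z -> (`|(e n z)%:E| <= (`|M| * \1_(box r) z)%:E)%E}.
  exists N; split=> // z /= /existsNP[n /not_implyP[Kz nc]]; apply: contrapT => Nz; apply: nc.
  rewrite lee_fin indicE; have [zb|zb] := boolP (z \in box r).
    have /andP[e0 eM'] := eM n z Kz Nz; rewrite ger0_norm// mulr1.
    exact: le_trans eM' (ler_norm _).
  by rewrite er ?normr0 ?mulr0//; move/negP: zb; rewrite inE.
have [_ _ H] := @dominated_convergence _ plane R area K mK (fun n z => (e n z)%:E)
  (fun=> 0%:E) (fun z => (`|M| * \1_(box r) z)%:E)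
  (fun n => (measurable_EFinP _ _).2 (me n)) (measurable_cst _) ae0 iI aeM.
have I0 : (\int[area]_(z in K) (0 : R)%:E = 0)%E by exact: integral0.
rewrite I0 in H.
have [n _ Hn] : \forall n \near \oo, (\int[area]_(z in K) (e n z)%:E < eps%:E)%E.
  by have := H _ (nbhs_open_ereal_lt _); apply; exact: eps0.
by exists n; apply: Hn => /=.
Qed.

End Vanishing.

Section Cutoff.
Context {R : realType}.
Implicit Types (psi : R * R -> R) (z w e : R * R).

Lemma derive_step (t e : R) : 'D_e step t = e * 'D_1 step t.
Proof.
have dif : differentiable (step : R^o -> R^o) t.
  by apply/derivable1_diffP; have [_ + _] := @class_C_step R 1; exact.
by rewrite deriveE// deriv1E ?derive1E//; exact/derivable1_diffP.
Qed.

Lemma derive_step_out (t : R) : t < 0 \/ 1 < t -> 'D_1 step t = 0.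
Proof.
move=> [t0|t1].
  rewrite (@near_eq_derive R R^o R^o _ (cst 0)) ?derive_cst//; near=> x.
  by apply: step_le0; apply: ltW; near: x; exact: lt_nbhsl.
rewrite (@near_eq_derive R R^o R^o _ (cst 1)) ?derive_cst//; near=> x.
by apply: step_ge1; apply: ltW; near: x; exact: lt_nbhsr.
Unshelve. all: by end_near. Qed.

Lemma derive_step_bounded : exists H : R, forall t : R, `|'D_1 step t| <= H.
Proof.
have [_ _ /(_ 1) cd] := @class_C_step R 1.
have cI : compact ((fun t : R => 'D_1 step t : R) @` `[0, 1]%classic).
  by apply: continuous_compact; [exact: continuous_subspaceT|exact: segment_compact].
have [M [Mr HM]] := compact_bounded cI; exists (Num.max 0 (M + 1)) => t.
have [t0|t0] := ltP t 0; first by rewrite derive_step_out ?normr0 ?le_max ?lexx//; left.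
have [t1|t1] := ltP 1 t; first by rewrite derive_step_out ?normr0 ?le_max ?lexx//; right.
rewrite le_max; apply/orP; right; apply: (HM (M + 1)); first by rewrite ltrDl.
by exists t => //; rewrite /= in_itv /= t0.
Qed.

Lemma compact_closed_separated (A B : set (R * R)) : compact A -> closed B -> A `<=` ~` B ->
  exists2 d : R, 0 < d & forall z w, A z -> B w -> d <= `|z - w|.
Proof.
move=> cA cB AB.
have H : \forall d \near (0 : R)^'+, A `<=` [set z | forall w, B w -> d <= `|z - w|].
  apply: ((compact_near_coveringP A).1 cA) => z Az.
  have /nbhs_normP[r /= r0 Hr] : nbhs z (~` B).
    by apply: open_nbhs_nbhs; split; [exact: closed_openC|exact: AB].
  exists (ball z (r / 2), [set d | d < r / 2]); first split => /=.
  - by apply: nbhsx_ballx; rewrite divr_gt0.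
  - by apply: nbhs_right_lt; rewrite divr_gt0.
  move=> [x d] /= [zx dr] w Bw; rewrite leNgt; apply/negP => xw.
  apply: (Hr w) Bw; rewrite /ball_ /=.
  move: zx; rewrite -ball_normE /ball_ /= => zx.
  by rewrite -(subrKA x); apply: le_lt_trans (ler_normD _ _) _; lra.
near (0 : R)^'+ => d.
have Hd : A `<=` [set z | forall w, B w -> d <= `|z - w|] by near: d.
by exists d => // z w Az; exact: Hd.
Unshelve. all: by end_near. Qed.

Lemma test_function_facts D psi : test_function (~` closure D) psi ->
  [/\ exists2 d0 : R, 0 < d0 & forall z w, closure D w -> `|z - w| < d0 -> psi z = 0,
      exists2 L : R, 0 <= L & (forall z w, `|psi z - psi w| <= L * `|z - w|) /\
         (forall z e, `|'D_e psi z| <= L * `|e|) /\ (forall z, `|psi z| <= L) &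
      exists2 r, 0 < r & forall z, r < `|z| -> psi z = 0 /\ forall e, 'D_e psi z = 0].
Proof.
move=> T; have C1 := test_class_C 1 T; have [cps dps Dps] := C1; have [_ cs sD] := T.
split.
- have [d d0 H] := compact_closed_separated cs (@closed_closure _ D) sD.
  exists d => // z w Dw zw; apply: contrapT => /eqP pz.
  by have := H z w (@subset_closure _ [set z | psi z != 0] z pz) Dw; rewrite leNgt zw.
- have [M0 H0] := compact_supp_bounded cps cs.
  have [M1 H1] := compact_supp_bounded (Dps e1) (@derive_compact_supp _ _ e1 cs).
  have [M2 H2] := compact_supp_bounded (Dps e2) (@derive_compact_supp _ _ e2 cs).
  pose M := Num.max M0 (Num.max M1 M2).
  have G0 z : `|psi z| <= M by rewrite le_max H0.
  have G1 z : `|'D_e1 psi z| <= M by rewrite !le_max H1 orbT.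
  have G2 z : `|'D_e2 psi z| <= M by rewrite !le_max H2 !orbT.
  have M00 : 0 <= M := le_trans (normr_ge0 _) (G0 0).
  exists (2 * M); first by rewrite mulr_ge0.
  split; first exact: lipschitz_of_bounded_derive.
  split=> [z e|z]; last by have := G0 z; lra.
  rewrite derive_dot// /dot /=; apply: le_trans (ler_normD _ _) _; rewrite !normrM.
  have := ler_pM (normr_ge0 _) (normr_ge0 _) (norm_fst_le e) (G1 z).
  have := ler_pM (normr_ge0 _) (normr_ge0 _) (norm_snd_le e) (G2 z).
  lra.
- have [r0 [r00 H0]] := compact_supp_box cs.
  have [r1 [r10 H1]] := compact_supp_box (@derive_compact_supp _ _ e1 cs).
  have [r2 [r20 H2]] := compact_supp_box (@derive_compact_supp _ _ e2 cs).
  exists (Num.max r0 (Num.max r1 r2)); first by rewrite lt_max r00.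
  have nb r z : r < `|z| -> ~ box r z.
    by move=> rz -[h1 h2]; move: rz; rewrite ltNge ler_norm_pair h1 h2.
  move=> z; rewrite !gt_max => /and3P[/nb/H0 ? /nb/H1 d1 /nb/H2 d2]; split=> // e.
  by rewrite derive_dot// /dot /= d1 d2 !mulr0 addr0.
Qed.

(** The displacement is twice the signed distance to the axis times a unit normal, whose coordinates
    are at most 1. *)
Lemma reflect2_sub alpha z : `|reflect (2 * alpha) z - z| <= 2 * `|side alpha z|.
Proof.
have -> : reflect (2 * alpha) z - z = (2 * side alpha z) *: (sin (2 * alpha), - cos (2 *
  alpha)).
  have := cos2Dsin2 (2 * alpha); rewrite /side /reflect (mulr_natl (2 * alpha)) mulr2n cosD
    sinD.
  set c := cos _; set d := sin _ => cd; congr pair; rewrite /= -![_ *: _]/(_ * _).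
    by rewrite (_ : c * c - d * d = (c ^+ 2 + d ^+ 2) - 2 * d ^+ 2); [rewrite cd; ring|ring].
  by rewrite (_ : c * c - d * d = 2 * c ^+ 2 - (c ^+ 2 + d ^+ 2)); [rewrite cd; ring|ring].
rewrite normrZ normrM ger0_norm// -[leRHS]mulr1 ler_pM// ?mulr_ge0//.
by rewrite ler_norm_pair /= normrN !ler_norml cos_geN1 cos_le1 sin_geN1 sin_le1.
Qed.

End Cutoff.

(** * Gluing the two halves of a transplant by cut-offs *)

Section Blend.
Context {R : realType}.
Local Notation mR := (measurableTypeR R).
Local Notation plane := (mR * mR)%type.
Variables (alpha : R) (psi : R * R -> R).
Local Notation tau := (reflect alpha).
Local Notation sig := (reflect (2 * alpha)).
Local Notation s := (side alpha).

(* The transplant of psi is leftpart where s < 0 and rightpart where s > 0; they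
   agree on the part of the line s = 0 that meets the closure of K, and
   rightpart vanishes on the line through the outer ray, where
   (sig z).2 = 0. *)
Definition leftpart z : R := psi (tau z) + psi (sig (tau z)).
Definition rightpart z : R := psi (tau (sig z)) - psi (sig (tau (sig z))).
(** Rises from 0 at [s z = - d] to 1 at [s z = d]. In turn [raycut] rises from 0 at height d to 1 at
    height 2 d over the line of the outer ray: being 0 in a neighbourhood of the ray, it keeps the
    closed support of the blend away from it. *)
Definition rightness (d : R) z : R := step ((s z / d + 1) / 2).
Definition raycut (d : R) z : R := step ((sig z).2 / d - 1).
Definition blend (d : R) z : R :=
  leftpart z + rightness d z * (raycut d z * rightpart z - leftpart z).

Lemma rightness_affine d :
  affine_map (fun z : R * R => (s z / d + 1) / 2 : R^o) (fun e => s e / d / 2).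
Proof. by move=> h e z; rewrite /side /= -![_ *: _]/(_ * _); ring. Qed.

Lemma raycut_affine d :
  affine_map (fun z : R * R => (sig z).2 / d - 1 : R^o) (fun e => (sig e).2 / d).
Proof. by move=> h e z; rewrite reflectD reflectZ /= -![_ *: _]/(_ * _); ring. Qed.

Lemma snd_reflect_continuous b : continuous (fun z : R * R => (reflect b z).2).
Proof.
move=> z; apply: (@continuous_comp _ _ _ (reflect b) snd); first exact: reflect_continuous.
exact: cvg_snd.
Qed.

Lemma class_C_rightness n d : class_C n (rightness d).
Proof.
apply: (class_C_comp_affine (rightness_affine d)); last exact: class_C_step.
move=> z; apply: cvgM; last exact: cvg_cst; apply: cvgD; last exact: cvg_cst.
by apply: cvgM; [exact: side_continuous|exact: cvg_cst].
Qed.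

Lemma class_C_raycut n d : class_C n (raycut d).
Proof.
apply: (class_C_comp_affine (raycut_affine d)); last exact: class_C_step.
move=> z; apply: cvgB; last exact: cvg_cst.
by apply: cvgM; [exact: snd_reflect_continuous|exact: cvg_cst].
Qed.

Lemma derive_rightness d e z :
  'D_e (rightness d) z = s e / d / 2 * 'D_1 step ((s z / d + 1) / 2).
Proof. by rewrite (@derive_comp_affine _ _ _ _ _ step z e (rightness_affine d)) derive_step.
  Qed.

Lemma derive_raycut d e z :
  'D_e (raycut d) z = (sig e).2 / d * 'D_1 step ((sig z).2 / d - 1).
Proof. by rewrite (@derive_comp_affine _ _ _ _ _ step z e (raycut_affine d)) derive_step. Qed.

Section Smooth.
Hypothesis Cpsi : forall n, class_C n psi.

Lemma class_C_leftpart n : class_C n leftpart.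
Proof.
have Cs : class_C n (fun z => psi (sig z)) by exact: class_C_comp_reflect.
by apply: class_CD; [exact: class_C_comp_reflect|exact: (class_C_comp_reflect alpha Cs)].
Qed.

Lemma class_C_rightpart n : class_C n rightpart.
Proof.
have Cs : class_C n (fun z => psi (sig z)) by exact: class_C_comp_reflect.
have Cst := class_C_comp_reflect alpha Cs.
have Ct : class_C n (fun z => psi (tau z)) by exact: class_C_comp_reflect.
apply: class_CD; first exact: (class_C_comp_reflect (2 * alpha) Ct).
by apply: class_CN; exact: (class_C_comp_reflect (2 * alpha) Cst).
Qed.

Lemma class_C_blend n d : class_C n (blend d).
Proof.
have CF := class_C_leftpart n.
have CkG := class_CM (class_C_raycut n d) (class_C_rightpart n).
exact: class_CD CF (class_CM (class_C_rightness n d) (class_CD CkG (class_CN CF))).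
Qed.

Lemma derive_blend d e z : 'D_e (blend d) z =
  (1 - rightness d z) * 'D_e leftpart z + rightness d z * raycut d z * 'D_e rightpart z
  + 'D_e (rightness d) z * (raycut d z * rightpart z - leftpart z)
  + rightness d z * 'D_e (raycut d) z * rightpart z.
Proof.
exact: (derive_interpolation (class_C_derivable (@class_C_rightness 1 d))
  (class_C_derivable (@class_C_raycut 1 d)) (class_C_derivable (@class_C_leftpart 1))
  (class_C_derivable (@class_C_rightpart 1))).
Qed.

Lemma derive_leftpart e z : 'D_e leftpart z =
  'D_(tau e) psi (tau z) + 'D_(sig (tau e)) psi (sig (tau z)).
Proof.
have [_ d1 _] := class_C_comp_reflect alpha (Cpsi 1).
have [_ d2 _] := class_C_comp_reflect alpha (class_C_comp_reflect (2 * alpha) (Cpsi 1)).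
rewrite /leftpart (@deriveD _ _ _ (fun z => psi (tau z)) (fun z => psi (sig (tau z))))//.
rewrite derive_comp_reflect; congr (_ + _).
by rewrite (@derive_comp_reflect _ (fun z => psi (sig z)) alpha) derive_comp_reflect.
Qed.

Lemma derive_rightpart e z : 'D_e rightpart z =
  'D_(tau (sig e)) psi (tau (sig z)) - 'D_(sig (tau (sig e))) psi (sig (tau (sig z))).
Proof.
have C1 := class_C_comp_reflect alpha (Cpsi 1).
have C2 := class_C_comp_reflect alpha (class_C_comp_reflect (2 * alpha) (Cpsi 1)).
have [_ d1 _] := class_C_comp_reflect (2 * alpha) C1.
have [_ d2 _] := class_C_comp_reflect (2 * alpha) C2.
rewrite /rightpart (@deriveB _ _ _ (fun z => psi (tau (sig z))) (fun z => psi (sig (tau (sig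
  z)))))//.
rewrite (@derive_comp_reflect _ (fun z => psi (tau z))) derive_comp_reflect; congr (_ - _).
rewrite (@derive_comp_reflect _ (fun z => psi (sig (tau z)))).
by rewrite (@derive_comp_reflect _ (fun z => psi (sig z)) alpha) derive_comp_reflect.
Qed.

Lemma transplant_grad z : s z != 0 ->
  transplant_field alpha (grad psi) z = if s z < 0 then grad leftpart z else grad rightpart z.
Proof.
move=> sz; have Cp := Cpsi 1; apply: dot_inj => e.
rewrite /transplant_field /fold_field; case: ifP => s0.
  rewrite -(derive_dot e z (class_C_leftpart 1)) derive_leftpart !(derive_dot _ _ Cp).
  by rewrite dotDr /= !dot_reflect.
rewrite ifT; last by rewrite lt_def sz leNgt s0.
rewrite -(derive_dot e z (class_C_rightpart 1)) derive_rightpart !(derive_dot _ _ Cp).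
by rewrite dotDr /= dotNr !dot_reflect.
Qed.

End Smooth.
End Blend.

(** * The blend as an admissible test function *)

Section BlendSupport.
Context {R : realType}.
Variables (alpha : R) (halpha : 0 < alpha < pi / 2) (D D' : set (R * R)) (psi : R * R -> R).
Local Notation tau := (reflect alpha).
Local Notation sig := (reflect (2 * alpha)).
Local Notation s := (side alpha).
Local Notation F := (leftpart alpha psi).
Local Notation G := (rightpart alpha psi).
Hypothesis T : test_function (~` closure D) psi.
Hypothesis D0 : closure D 0.

(* What makes the transplant of a function which vanishes near D vanish on D':
   each value of the transplant at p combines two values of the function, taken
   at points of the closure of D -- or equal ones that cancel, in the last case. *)
Definition mirrors_boundary := forall p, closure D' p ->
  [\/ [/\ s p <= 0, closure D (tau p) & closure D (sig (tau p))],
      [/\ 0 <= s p, closure D (tau (sig p)) & closure D (sig (tau (sig p)))] |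
      0 <= s p /\ (sig p).2 = 0].
Hypothesis HD' : mirrors_boundary.

Lemma sin2_gt0 : 0 < sin (2 * alpha).
Proof.
case/andP: halpha => a0 a1; apply: sin_gt0_pi.
by apply/andP; split; [rewrite mulr_gt0|rewrite mulrC -ltr_pdivlMr].
Qed.

Lemma side_lipschitz (z w : R * R) : `|s z - s w| <= 2 * `|z - w|.
Proof.
have -> : s z - s w = - (tau (z - w)).2 by rewrite snd_reflect opprK /side /=; ring.
by rewrite normrN; exact: le_trans (norm_snd_le _) (norm_reflect_le _ _).
Qed.

Lemma reflect_dist b (z w : R * R) : `|reflect b z - reflect b w| <= 2 * `|z - w|.
Proof. by rewrite -reflectB; exact: norm_reflect_le. Qed.

Let Z (d0 : R) := forall z w, closure D w -> `|z - w| < d0 -> psi z = 0.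

(** Farther than [d] from the axis only one of the two parts is active, and it vanishes or is cut
    off near [p]. Within [d] both are active: in the first two alternatives [sig p] is within
    [2 * d] of [p], so both parts vanish; in the third [p] is close to the origin. *)
Lemma blend_vanishes d0 d p : Z d0 -> 0 < d -> 16 * d < d0 ->
  16 * d < d0 * sin (2 * alpha) -> closure D' p ->
  exists2 r, 0 < r & forall z, `|z - p| < r -> blend alpha psi d z = 0.
Proof.
move=> Hd d_gt0 dd0 dsin /HD' Hp; have d00 : 0 < d0 by lra.
have rho0 : 0 < d0 / 16 by rewrite divr_gt0.
have r0 z : s z < - d -> rightness alpha d z = 0.
  move=> sz; apply: step_le0; have : s z / d < -1 by rewrite ltr_pdivrMr// mulN1r.
  by lra.
have r1 z : d < s z -> rightness alpha d z = 1.
  move=> sz; apply: step_ge1; have : 1 < s z / d by rewrite ltr_pdivlMr// mul1r.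
  by lra.
have k0 z : (sig z).2 < d -> raycut alpha d z = 0.
  move=> sz; apply: step_le0; have : (sig z).2 / d < 1 by rewrite ltr_pdivrMr// mul1r.
  by lra.
have dist3 (x y w : R * R) (a b : R) : `|x - y| <= a -> `|y - w| <= b -> `|x - w| <= a + b.
  by move=> xy yw; rewrite -(subrKA y); exact: le_trans (ler_normD _ _) (lerD xy yw).
have Hs := reflect2_sub alpha p.
have [[sp Dt Dst]|[sp Dt Dst]|[sp yp]] := Hp.
- have F0 z : `|z - p| < d0 / 16 -> F z = 0.
    move=> zp; rewrite /leftpart.
    have t1 := reflect_dist alpha z p; have t2 := reflect_dist (2 * alpha) (tau z) (tau p).
    by rewrite (Hd _ _ Dt) ?(Hd _ _ Dst) ?addr0//; lra.
  have [spd|spd] := ltP (s p) (- d).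
    exists (Num.min (d0 / 16) ((- d - s p) / 2)); first by rewrite lt_min rho0 /=; lra.
    move=> z; rewrite lt_min => /andP[z1 z2]; rewrite /blend F0// r0 ?mul0r ?addr0//.
    by have := side_lipschitz z p; have := ler_norm (s z - s p); lra.
  exists (d0 / 16) => // z zp; rewrite /blend F0// subr0 add0r.
  rewrite (_ : G z = 0) ?mulr0//; rewrite /rightpart.
  rewrite ler0_norm// in Hs.
  (* Three reflections double three times: 8 (d0 / 16) + 8 d < d0. This fixes the radius d0 / 16 and
     the condition 16 d < d0. *)
  have u1 := dist3 _ _ _ _ _ (reflect_dist (2 * alpha) z p) Hs.
  have u2 := le_trans (reflect_dist alpha (sig z) p) (ler_wpM2l (ler0n _ 2) u1).
  have u3 := le_trans (reflect_dist (2 * alpha) (tau (sig z)) (tau p)) (ler_wpM2l (ler0n _ 2)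
    u2).
  by rewrite (Hd _ _ Dt) ?(Hd _ _ Dst) ?subr0//; lra.
- have G0 z : `|z - p| < d0 / 16 -> G z = 0.
    move=> zp; rewrite /rightpart.
    have t0 := reflect_dist (2 * alpha) z p.
    have t1 := reflect_dist alpha (sig z) (sig p); have t2 := reflect_dist (2 * alpha) (tau
      (sig z)) (tau (sig p)).
    by rewrite (Hd _ _ Dt) ?(Hd _ _ Dst) ?subr0//; lra.
  have [spd|spd] := ltP d (s p).
    exists (Num.min (d0 / 16) ((s p - d) / 2)); first by rewrite lt_min rho0 /=; lra.
    move=> z; rewrite lt_min => /andP[z1 z2]; rewrite /blend G0// r1 ?mulr0 ?sub0r ?mul1r
      ?subrr//.
    by have := side_lipschitz z p; have := ler_norm (s p - s z); rewrite (distrC (s p)); lra.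
  exists (d0 / 16) => // z zp; rewrite /blend G0// mulr0 sub0r.
  rewrite (_ : F z = 0) ?oppr0 ?mulr0 ?addr0//; rewrite /leftpart.
  rewrite ger0_norm// distrC in Hs.
  have u1 := dist3 _ _ _ _ _ (ltW zp) Hs.
  have u2 := le_trans (reflect_dist alpha z (sig p)) (ler_wpM2l (ler0n _ 2) u1).
  have u3 := le_trans (reflect_dist (2 * alpha) (tau z) (tau (sig p))) (ler_wpM2l (ler0n _ 2)
    u2).
  by rewrite (Hd _ _ Dt) ?(Hd _ _ Dst) ?addr0//; lra.
- have K0 z : `|z - p| < d / 2 -> raycut alpha d z = 0.
    move=> zp; apply: k0; have := reflect_dist (2 * alpha) z p.
    have := norm_snd_le (sig z - sig p).
    have -> : (sig z - sig p).2 = (sig z).2 by rewrite -[LHS]/((sig z).2 - (sig p).2) yp subr0.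
    by have := ler_norm (sig z).2; lra.
  have [spd|spd] := ltP d (s p).
    exists (Num.min (d / 2) ((s p - d) / 2)); first by rewrite lt_min divr_gt0//=; lra.
    move=> z; rewrite lt_min => /andP[z1 z2]; rewrite /blend K0// r1 ?mul0r ?sub0r ?mul1r
      ?subrr//.
    by have := side_lipschitz z p; have := ler_norm (s p - s z); rewrite (distrC (s p)); lra.
  (* On the outer ray the distance to the axis is the distance to the origin times
     [sin (2 * alpha)]. So [p] is near the origin, where [psi] vanishes because 0 lies in the
     closure of [D]. *)
  have sp' : s p = (sig p).1 * sin (2 * alpha).
    by rewrite -[LHS]opprK -side_reflect2 /side yp mul0r sub0r opprK.
  have np : `|p| < d0 / 8.
    have Ep : p = sig (sig p) by rewrite reflectK.
    have ns : `|sig p| <= `|(sig p).1| by rewrite ler_norm_pair yp normr0 lexx /=.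
    have n1 : `|(sig p).1| < d0 / 16.
      have S0 := sin2_gt0; rewrite ger0_norm; last by rewrite -(pmulr_lge0 _ S0) -sp'.
      by rewrite -(ltr_pM2r S0) -sp'; lra.
    by have := norm_reflect_le (2 * alpha) (sig p); rewrite -Ep; lra.
  exists (Num.min (d / 2) (d0 / 16)); first by rewrite lt_min divr_gt0.
  move=> z; rewrite lt_min => /andP[z1 z2]; rewrite /blend K0// mul0r sub0r.
  rewrite (_ : F z = 0) ?oppr0 ?mulr0 ?addr0//; rewrite /leftpart.
  have nz : `|z| <= `|z - p| + `|p| by rewrite -{1}(subrK p z); exact: ler_normD.
  have u2 := norm_reflect_le alpha z; have u3 := norm_reflect_le (2 * alpha) (tau z).
  by rewrite (Hd _ _ D0) ?(Hd _ _ D0) ?subr0 ?addr0//; lra.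
Qed.

Lemma blend_supp r (z : R * R) : (forall z, r < `|z| -> psi z = 0) -> 8 * r < `|z| ->
  F z = 0 /\ G z = 0.
Proof.
move=> Hr zr.
have N (b : R) (w : R * R) : `|w| <= 2 * `|reflect b w| by have := norm_reflect_le b (reflect b
  w); rewrite reflectK.
have n1 := N alpha z; have n2 := N (2 * alpha) (tau z); have n3 := N (2 * alpha) z.
have n4 := N alpha (sig z); have n5 := N (2 * alpha) (tau (sig z)).
have z0 := normr_ge0 z.
by rewrite /leftpart /rightpart !Hr ?addr0 ?subr0//; lra.
Qed.

Lemma test_function_blend d0 r d : Z d0 -> (forall z, r < `|z| -> psi z = 0) ->
  0 < d -> 16 * d < d0 -> 16 * d < d0 * sin (2 * alpha) ->
  test_function (~` closure D') (blend alpha psi d).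
Proof.
move=> Hd Hr d_gt0 dd0 dsin; split.
- by apply/smoothP => n; apply: class_C_blend => m; exact: test_class_C T.
- have cB : compact (`[- (8 * r), 8 * r]%classic `*` `[- (8 * r), 8 * r]%classic : set (R * R)).
    by apply: compact_setX; exact: segment_compact.
  apply: (subclosed_compact (@closed_closure _ _) cB).
  apply: closure_subset_closed; first by apply: compact_closed cB; exact: norm_hausdorff.
  move=> z /= bz; have : `|z| <= 8 * r.
    rewrite leNgt; apply: contraNN bz => zr.
    by have [F0 G0] := blend_supp Hr zr; rewrite /blend F0 G0 mulr0 subr0 mulr0 addr0.
  by rewrite ler_norm_pair !ler_norml => /andP[h1 h2]; split; rewrite /= in_itv.
- move=> p Hp /(blend_vanishes Hd d_gt0 dd0 dsin)[rho rho0 H].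
  have /Hp [z [/= /eqP bz zp]] : nbhs p [set z | `|z - p| < rho].
    have := nbhsx_ballx p _ rho0; rewrite -ball_normE; apply: filterS => z.
    by rewrite /ball_ /= distrC.
  by apply: bz; exact: H.
Qed.

End BlendSupport.

(** * Uniform bound for the energy density of the error *)

Section BlendError.
Context {R : realType}.
Local Notation mR := (measurableTypeR R).
Local Notation plane := (mR * mR)%type.
Variables (alpha : R) (K : set plane) (psi : R * R -> R).
Local Notation tau := (reflect alpha).
Local Notation sig := (reflect (2 * alpha)).
Local Notation s := (side alpha).
Local Notation F := (leftpart alpha psi).
Local Notation G := (rightpart alpha psi).
Hypothesis Ksig : forall z, K z -> K (sig z).
Hypothesis Ktau : forall z, K z -> s z < 0 -> K (tau z) /\ s (tau z) < 0.
Hypothesis Cpsi : forall n, class_C n psi.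
Variables (L m H : R) (L0 : 0 <= L).
Hypothesis psi_lip : forall z w, `|psi z - psi w| <= L * `|z - w|.
Hypothesis psi_der : forall z e, `|'D_e psi z| <= L * `|e|.
Hypothesis psi_bd : forall z, `|psi z| <= L.
Hypothesis psi_ray : forall z, K z -> 0 < s z -> `|(sig z).2| < m -> psi z = 0.
Hypothesis step_bd : forall t : R, `|'D_1 step t| <= H.

Let H0 : 0 <= H. Proof. exact: le_trans (normr_ge0 _) (step_bd 0). Qed.

Lemma halfL_upper z : K z -> s z < 0 -> 0 < z.2.
Proof. by move=> Kz sz; have [_] := Ktau Kz sz; rewrite side_reflect oppr_lt0. Qed.

Lemma halfR_upper z : K z -> 0 < s z -> 0 < (sig z).2.
Proof.
move=> Kz sz; apply: halfL_upper; first exact: Ksig.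
by rewrite side_reflect2 oppr_lt0.
Qed.

(** The two points in [rightpart] are mirror images in the axis of [sig], at distance [|(sig z).2|]
    from it: the transplant vanishes on the outer ray by continuity of [psi] across the axis. *)
Lemma rightpart_le z : `|G z| <= 2 * L * `|(sig z).2|.
Proof.
apply: le_trans (psi_lip _ _) _; rewrite distrC [2 * L]mulrC -mulrA; apply: ler_wpM2l => //.
by apply: le_trans (reflect2_sub _ _) _; rewrite side_reflect normrN.
Qed.

(** Here the Dirichlet condition on the outer ray enters. The first values of the two parts differ
    by at most [4 * L * d]. The second ones add up, but one of them vanishes, its point lying in [K]
    within [m] of the outer ray; so their sum is a difference up to sign and costs [8 * L * d]. *)
Lemma left_right_le z d : K z -> s z != 0 -> `|s z| <= d -> d < m ->
  `|F z - G z| <= 12 * L * d.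
Proof.
move=> Kz sz sd dm; have d0 : 0 <= d := le_trans (normr_ge0 _) sd.
have zs : `|z - sig z| <= 2 * d.
  by rewrite distrC; apply: le_trans (reflect2_sub _ _) _; rewrite ler_wpM2l.
have ts := le_trans (reflect_dist alpha z (sig z)) (ler_wpM2l (ler0n _ 2) zs).
have ss := le_trans (reflect_dist (2 * alpha) (tau z) (tau (sig z))) (ler_wpM2l (ler0n _ 2) ts).
have P1 := le_trans (psi_lip _ _) (ler_wpM2l L0 ts).
have P2 := le_trans (psi_lip _ _) (ler_wpM2l L0 ss).
have small (x y : R) : `|x - y| <= L * (2 * (2 * (2 * d))) -> x = 0 \/ y = 0 ->
    `|x + y| <= L * (2 * (2 * (2 * d))).
  by move=> + [E|E]; rewrite E ?sub0r ?normrN ?add0r ?subr0 ?addr0.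
have Q : `|psi (sig (tau z)) + psi (sig (tau (sig z)))| <= L * (2 * (2 * (2 * d))).
  (* The side of [z] decides which of the two points is known to lie in the right half of [K]. *)
  apply: small P2 _; have [s0|s0|s0] := ltgtP (s z) 0; last by rewrite s0 eqxx in sz.
    left; have [Kt st] := Ktau Kz s0; apply: psi_ray; first exact: Ksig.
      by rewrite side_reflect2 oppr_gt0.
    by rewrite reflectK snd_reflect normrN; exact: le_lt_trans sd dm.
  right; have Ks := Ksig Kz; have ssz : s (sig z) < 0 by rewrite side_reflect2 oppr_lt0.
  have [Kt st] := Ktau Ks ssz; apply: psi_ray; first exact: Ksig.
    by rewrite side_reflect2 oppr_gt0.
  by rewrite reflectK snd_reflect normrN side_reflect2 normrN; exact: le_lt_trans sd dm.
have -> : F z - G z = (psi (tau z) - psi (tau (sig z))) + (psi (sig (tau z)) + psi (sig (tau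
  (sig z)))).
  by rewrite /leftpart /rightpart; ring.
by apply: le_trans (ler_normD _ _) _; lra.
Qed.

Lemma side_unit_le e : `|e| <= 1 -> `|s e| <= 2.
Proof.
move=> e1; have := norm_snd_le (tau e); rewrite snd_reflect normrN.
by have := norm_reflect_le alpha e; lra.
Qed.

(** The slope of [rightness] is at most [H / d], and zero unless [|s z| <= d]. There the other
    factor is at most [12 * L * d], from the gap between the parts, plus [4 * L * d], from replacing
    [raycut] by 1. *)
Lemma rightness_term z d e : K z -> s z != 0 -> 0 < d -> d < m -> `|e| <= 1 ->
  `|'D_e (rightness alpha d) z * (raycut alpha d z * G z - F z)| <= 16 * L * H.
Proof.
move=> Kz sz d0 dm e1; have LH : 0 <= L * H by rewrite mulr_ge0.
rewrite derive_rightness.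
have [sd|sd] := ltP d `|s z|.
  rewrite derive_step_out ?mulr0 ?mul0r ?normr0; first by rewrite -mulrA mulr_ge0.
  have [s0|s0] := leP 0 (s z).
    rewrite ger0_norm// in sd; right; have : 1 < s z / d by rewrite ltr_pdivlMr// mul1r.
    by lra.
  rewrite ltr0_norm// in sd; left; have : s z / d < -1 by rewrite ltr_pdivrMr// mulN1r; lra.
  by lra.
have FG := left_right_le Kz sz sd dm.
have k0 := step_ge0 ((sig z).2 / d - 1); have k1 := step_le1 ((sig z).2 / d - 1).
have kG : `|(1 - raycut alpha d z) * G z| <= 4 * L * d.
  have [yd|yd] := leP (2 * d) (sig z).2.
    rewrite /raycut step_ge1 ?subrr ?mul0r ?normr0 ?mulr_ge0 ?(ltW d0)//.
    by have : 2 <= (sig z).2 / d; [rewrite ler_pdivlMr|lra].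
  (* Since [raycut] is 0 at all negative heights, a lower bound is needed as well: on the left half
     [z.2] is positive and [sig] moves [z] by at most [2 * d]. *)
  have yl : - (2 * d) <= (sig z).2.
    have [s0|s0|s0] := ltgtP (s z) 0; last by rewrite s0 eqxx in sz.
      have := halfL_upper Kz s0; have := norm_snd_le (sig z - z).
      have := reflect2_sub alpha z; have := ler_norm (- (sig z - z).2); rewrite normrN.
      by rewrite -[(sig z - z).2]/((sig z).2 - z.2); lra.
    by have := halfR_upper Kz s0; lra.
  have yn : `|(sig z).2| <= 2 * d by rewrite ler_norml yl ltW.
  rewrite normrM -[leRHS]mul1r ler_pM//; first by rewrite ger0_norm /raycut; lra.
  apply: le_trans (rightpart_le z) _; have := ler_wpM2l L0 yn; lra.
have kGF : `|raycut alpha d z * G z - F z| <= 16 * L * d.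
  have -> : raycut alpha d z * G z - F z = - ((F z - G z) + (1 - raycut alpha d z) * G z) by
    ring.
  by rewrite normrN; apply: le_trans (ler_normD _ _) _; lra.
have dr : `|s e / d / 2 * 'D_1 step ((s z / d + 1) / 2)| <= H / d.
  rewrite normrM !normrM !normfV (gtr0_norm d0) (@ger0_norm _ 2)//.
  rewrite [H / d]mulrC; apply: ler_pM => //; rewrite ?mulr_ge0 ?invr_ge0 ?(ltW d0)//.
  rewrite ler_pdivrMr// mulrC; apply: ler_wpM2l; first by rewrite invr_ge0 ltW.
  exact: side_unit_le.
rewrite normrM (_ : 16 * L * H = H / d * (16 * L * d)); last by field; rewrite gt_eqF.
exact: ler_pM.
Qed.

Lemma raycut_term z d e : 0 < d -> `|e| <= 1 ->
  `|'D_e (raycut alpha d) z * G z| <= 8 * L * H.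
Proof.
move=> d0 e1; have LH : 0 <= L * H by rewrite mulr_ge0.
rewrite derive_raycut.
have [yd|yd] := ltP (2 * d) `|(sig z).2|.
  rewrite derive_step_out ?mulr0 ?mul0r ?normr0; first by rewrite -mulrA mulr_ge0.
  have [s0|s0] := leP 0 (sig z).2.
    rewrite ger0_norm// in yd; right; have : 2 < (sig z).2 / d by rewrite ltr_pdivlMr.
    by lra.
  left; have : (sig z).2 / d < 0 by rewrite ltr_pdivrMr// mul0r.
  by lra.
have G1 : `|G z| <= 4 * L * d.
  by apply: le_trans (rightpart_le z) _; have := ler_wpM2l L0 yd; lra.
have dk : `|(sig e).2 / d * 'D_1 step ((sig z).2 / d - 1)| <= 2 * H / d.
  rewrite normrM normrM normfV (gtr0_norm d0) (_ : 2 * H / d = 2 / d * H); last by ring.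
  apply: ler_pM => //; first by rewrite mulr_ge0// invr_ge0 ltW.
  apply: ler_wpM2r; first by rewrite invr_ge0 ltW.
  by have := norm_snd_le (sig e); have := norm_reflect_le (2 * alpha) e; lra.
rewrite normrM (_ : 8 * L * H = 2 * H / d * (4 * L * d)); last by field; rewrite gt_eqF.
exact: ler_pM.
Qed.

Lemma derive_parts_le z e : `|e| <= 1 -> `|'D_e F z| <= 6 * L /\ `|'D_e G z| <= 12 * L.
Proof.
move=> e1; rewrite derive_leftpart// derive_rightpart//.
have n1 := norm_reflect_le alpha e; have n2 := norm_reflect_le (2 * alpha) (tau e).
have n3 := norm_reflect_le (2 * alpha) e; have n4 := norm_reflect_le alpha (sig e).
have n5 := norm_reflect_le (2 * alpha) (tau (sig e)).
have P z' e' (c : R) : `|e'| <= c -> `|'D_e' psi z'| <= c * L.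
  by move=> ec; apply: le_trans (psi_der z' e') _; rewrite mulrC ler_wpM2r.
split.
  apply: le_trans (ler_normD _ _) _.
  have := P (tau z) (tau e) 2; have := P (sig (tau z)) (sig (tau e)) 4.
  by move=> /(_ ltac:(lra)) h1 /(_ ltac:(lra)) h2; lra.
apply: le_trans (ler_normB _ _) _.
have := P (tau (sig z)) (tau (sig e)) 4; have := P (sig (tau (sig z))) (sig (tau (sig e))) 8.
by move=> /(_ ltac:(lra)) h1 /(_ ltac:(lra)) h2; lra.
Qed.

(** Derivatives of the two parts account for 6 + 12, the two cut-off terms for 16 + 8, the values of
    the parts for 2 + 2. *)
Let B := 18 * L + 24 * L * H + 4 * L.

Lemma blend_error_le z d : K z -> s z != 0 -> 0 < d -> d < m ->
  energy (transplant alpha psi) (transplant_field alpha (grad psi)) (blend alpha psi d) z <=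
  3 * B ^+ 2.
Proof.
move=> Kz sz d0 dm; have LH : 0 <= L * H by rewrite mulr_ge0.
have LH24 : 0 <= 24 * L * H by rewrite -mulrA mulr_ge0.
have L1 := L0; have B0 : 0 <= B by rewrite /B; lra.
have sq (x : R) : `|x| <= B -> x ^+ 2 <= B ^+ 2.
  by move=> xB; rewrite -(real_normK (num_real x)) lerXn2r// ?nnegrE.
have r0 := step_ge0 ((s z / d + 1) / 2); have r1 := step_le1 ((s z / d + 1) / 2).
have k0 := step_ge0 ((sig z).2 / d - 1); have k1 := step_le1 ((sig z).2 / d - 1).
have ML (t x X : R) : 0 <= t <= 1 -> `|x| <= X -> `|t * x| <= X.
  move=> /andP[t0 t1] xX; rewrite normrM -[leRHS]mul1r ler_pM//.
  by rewrite ger0_norm.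
have rk : 0 <= rightness alpha d z * raycut alpha d z <= 1.
  by rewrite mulr_ge0//= -[leRHS]mulr1 ler_pM.
have F1 : `|F z| <= 2 * L.
  by apply: le_trans (ler_normD _ _) _; have := psi_bd (tau z); have := psi_bd (sig (tau z));
    lra.
have G1 : `|G z| <= 2 * L.
  by apply: le_trans (ler_normB _ _) _; have := psi_bd (tau (sig z)); have := psi_bd (sig (tau
    (sig z))); lra.
have part (p : R * R -> R) : (p = F \/ p = G) ->
    `|p z - blend alpha psi d z| <= B /\
    forall e, `|e| <= 1 -> `|'D_e p z - 'D_e (blend alpha psi d) z| <= B.
  move=> pp; split.
    have a1 := ML (rightness alpha d z) _ _ ltac:(by rewrite r0 r1) F1.
    have a2 := ML _ _ _ rk G1.
    have a3 := ML (1 - rightness alpha d z) _ _ ltac:(by rewrite /rightness; lra) F1.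
    have a4 := ML (1 - rightness alpha d z * raycut alpha d z) _ _ ltac:(by lra) G1.
    case: pp => ->; rewrite /blend.
      rewrite (_ : _ - _ = rightness alpha d z * F z - rightness alpha d z * raycut alpha d z *
        G z); last by ring.
      by apply: le_trans (ler_normB _ _) _; rewrite /B; lra.
    rewrite (_ : _ - _ = (1 - rightness alpha d z * raycut alpha d z) * G z - (1 - rightness
      alpha d z) * F z); last by ring.
    by apply: le_trans (ler_normB _ _) _; rewrite /B; lra.
  move=> e e1; rewrite derive_blend//.
  have [DF DG] := derive_parts_le z e1.
  have t1 := rightness_term Kz sz d0 dm e1.
  have t2 := ML (rightness alpha d z) _ _ ltac:(by rewrite r0 r1) (raycut_term z d0 e1).
  rewrite mulrA in t2.
  have a1 := ML (rightness alpha d z) _ _ ltac:(by rewrite r0 r1) DF.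
  have a2 := ML _ _ _ rk DG.
  have a3 := ML (1 - rightness alpha d z) _ _ ltac:(by rewrite /rightness; lra) DF.
  have a4 := ML (1 - rightness alpha d z * raycut alpha d z) _ _ ltac:(by lra) DG.
  move: t1 t2; set t1 := 'D_e (rightness alpha d) z * _; set t2 := rightness alpha d z * _ * G
    z => t1B t2B.
  case: pp => ->.
    rewrite (_ : _ - _ = rightness alpha d z * 'D_e F z - rightness alpha d z * raycut alpha d
      z * 'D_e G z - t1 - t2); last by ring.
    do 3 (apply: le_trans (ler_normB _ _) _; rewrite -?lerBrDr).
    by rewrite /B; lra.
  rewrite (_ : _ - _ = (1 - rightness alpha d z * raycut alpha d z) * 'D_e G z - (1 - rightness
    alpha d z) * 'D_e F z - t1 - t2); last by ring.
  do 3 (apply: le_trans (ler_normB _ _) _; rewrite -?lerBrDr).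
  by rewrite /B; lra.
have n1 : `|e1 : R * R| <= 1 by rewrite ler_norm_pair /= normr1 normr0 lexx ler01.
have n2 : `|e2 : R * R| <= 1 by rewrite ler_norm_pair /= normr1 normr0 lexx ler01.
rewrite (_ : 3 * B ^+ 2 = B ^+ 2 + B ^+ 2 + B ^+ 2); last by ring.
rewrite /energy (transplant_grad Cpsi sz) /transplant.
have [s0|s0|s0] := ltgtP (s z) 0; last by rewrite s0 eqxx in sz.
  have [p1 p2] := part F (or_introl erefl).
  exact: lerD (lerD (sq _ p1) (sq _ (p2 _ n1))) (sq _ (p2 _ n2)).
have [p1 p2] := part G (or_intror erefl).
exact: lerD (lerD (sq _ p1) (sq _ (p2 _ n1))) (sq _ (p2 _ n2)).
Qed.

End BlendError.

(** * From test functions to the form domain *)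

Section TransplantForm.
Context {R : realType}.
Local Notation mR := (measurableTypeR R).
Local Notation plane := (mR * mR)%type.
Variables (alpha : R) (halpha : 0 < alpha < pi / 2) (K : set plane) (mK : measurable K).
Local Notation tau := (reflect alpha).
Local Notation sig := (reflect (2 * alpha)).
Local Notation s := (side alpha).
Hypothesis Ksig : forall z, K z -> K (sig z).
Hypothesis Ktau : forall z, K z -> s z < 0 -> K (tau z) /\ s (tau z) < 0.
Variables (D D' : set (R * R)).
Hypothesis D0 : closure D 0.
Hypothesis HD' : mirrors_boundary alpha D D'.
Hypothesis Hray : forall psi : R * R -> R, test_function (~` closure D) psi ->
  exists2 m : R, 0 < m & forall z, K z -> 0 < s z -> `|(sig z).2| < m -> psi z = 0.

Lemma blend_exact psi z d : (forall n, class_C n psi) -> K z -> 0 < d ->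
  s z < - d \/ (d < s z /\ 2 * d < (sig z).2) ->
  energy (transplant alpha psi) (transplant_field alpha (grad psi)) (blend alpha psi d) z = 0.
Proof.
move=> Cp Kz d0 Hd.
have sz : s z != 0 by case: Hd => [h|[h _]]; [rewrite lt_eqF//|rewrite gt_eqF//]; lra.
rewrite energyE (transplant_grad Cp sz).
have E (p : R * R -> R) : transplant alpha psi z = p z -> blend alpha psi d z = p z ->
    (forall e, 'D_e (blend alpha psi d) z = 'D_e p z) ->
    (transplant alpha psi z - blend alpha psi d z) ^+ 2 +
    dot (grad p z - grad (blend alpha psi d) z) (grad p z - grad (blend alpha psi d) z) = 0.
  by move=> -> -> De; rewrite /grad !De !subrr expr0n /= add0r /dot /= !mulr0 addr0.
case: Hd => [h|[h1 h2]].
  have s0 : s z < 0 by lra.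
  have a : s z / d < -1 by rewrite ltr_pdivrMr// mulN1r.
  have r0 : rightness alpha d z = 0 by apply: step_le0; lra.
  rewrite s0; apply: E => [||e]; first by rewrite /transplant s0.
    by rewrite /blend r0 mul0r addr0.
  by rewrite derive_blend// derive_rightness derive_step_out ?r0; [ring|left; lra].
have s0 : 0 < s z by lra.
have a : 1 < s z / d by rewrite ltr_pdivlMr// mul1r.
have b : 2 < (sig z).2 / d by rewrite ltr_pdivlMr.
have r1 : rightness alpha d z = 1 by apply: step_ge1; lra.
have k1 : raycut alpha d z = 1 by apply: step_ge1; lra.
rewrite ltNge (ltW s0) /=; apply: E => [||e]; first by rewrite /transplant ltNge (ltW s0) s0.
  by rewrite /blend r1 k1; ring.
rewrite derive_blend// derive_rightness derive_raycut !derive_step_out ?r1 ?k1; [ring|right;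
  lra|right; lra].
Qed.

Lemma blend_outside psi z d r : (forall n, class_C n psi) -> K z -> s z != 0 ->
  (forall z, r < `|z| -> psi z = 0 /\ forall e, 'D_e psi z = 0) -> 8 * r < `|z| ->
  energy (transplant alpha psi) (transplant_field alpha (grad psi)) (blend alpha psi d) z = 0.
Proof.
move=> Cp Kz sz Hr zr.
have N (b : R) (w : R * R) : `|w| <= 2 * `|reflect b w| by have := norm_reflect_le b (reflect b
  w); rewrite reflectK.
have n1 := N alpha z; have n2 := N (2 * alpha) (tau z); have n3 := N (2 * alpha) z.
have n4 := N alpha (sig z); have n5 := N (2 * alpha) (tau (sig z)).
have z0 := normr_ge0 z.
have [q1 q1'] : psi (tau z) = 0 /\ forall e, 'D_e psi (tau z) = 0 by apply: Hr; lra.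
have [q2 q2'] : psi (sig (tau z)) = 0 /\ forall e, 'D_e psi (sig (tau z)) = 0 by apply: Hr; lra.
have [q3 q3'] : psi (tau (sig z)) = 0 /\ forall e, 'D_e psi (tau (sig z)) = 0 by apply: Hr; lra.
have [q4 q4'] : psi (sig (tau (sig z))) = 0 /\ forall e, 'D_e psi (sig (tau (sig z))) = 0 by
  apply: Hr; lra.
have F0 : leftpart alpha psi z = 0 by rewrite /leftpart q1 q2 addr0.
have G0 : rightpart alpha psi z = 0 by rewrite /rightpart q3 q4 subr0.
have DF e : 'D_e (leftpart alpha psi) z = 0 by rewrite derive_leftpart// q1' q2' addr0.
have DG e : 'D_e (rightpart alpha psi) z = 0 by rewrite derive_rightpart// q3' q4' subr0.
have b0 : blend alpha psi d z = 0 by rewrite /blend F0 G0; ring.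
have Db e : 'D_e (blend alpha psi d) z = 0 by rewrite derive_blend// F0 G0 DF DG; ring.
rewrite energyE (transplant_grad Cp sz) b0 /grad !Db !DF !DG.
have -> : transplant alpha psi z = 0.
  by rewrite /transplant q1 q2 q3 q4 addr0 subr0 !if_same.
by rewrite if_same !subrr expr0n /= add0r /dot /= !mulr0 addr0.
Qed.

Let TI := transplant_intertwiner halpha mK Ksig Ktau.

Lemma L2v_transplant g : L2v K g -> L2v K (transplant_field alpha g).
Proof.
have pr := @isometry_pair_reflect R.
apply: (L2v_fold halpha mK Ksig Ktau (pr alpha) _ _ (transplant_pair4 alpha)).
  exact: isometry_pair_comp.
exact: isometry_pair_comp.
Qed.

Lemma transplant_test_approx psi (eps : R) : test_function (~` closure D) psi -> 0 < eps ->
  exists2 chi, test_function (~` closure D') chi &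
    (\int[area]_(z in K) (energy (transplant alpha psi)
       (transplant_field alpha (grad psi)) chi z)%:E < eps%:E)%E.
Proof.
move=> T eps0; have Cp n := test_class_C n T.
have [[d0 d00 Hd0] [L L0 [Llip [Lder Lbd]]] [r r0 Hr]] := test_function_facts T.
have [m m0 Hm] := Hray T; have [H HH] := @derive_step_bounded R.
have S0 := sin2_gt0 halpha.
(* [m] serves the comparison across the axis, the other two bounds the vanishing of the blend near
   [D']. *)
pose q := Num.min m (Num.min (d0 / 16) (d0 * sin (2 * alpha) / 16)).
have q0 : 0 < q by rewrite !lt_min m0 /= !divr_gt0//= mulr_gt0.
(* With [n.+2] in place of [n.+1], [d n] is strictly below [q] from the start. *)
pose d n : R := q / n.+2%:R.
have n2 n : 0 < n.+2%:R :> R by rewrite ltr0n.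
have dn n : 0 < d n by rewrite divr_gt0.
have dq n : d n < q by rewrite ltr_pdivrMr// ltr_pMr// ltr1n.
have dm n : d n < m by apply: lt_le_trans (dq n) _; rewrite ge_min lexx.
have dd0 n : 16 * d n < d0.
  have : q <= d0 / 16 by rewrite !ge_min lexx /= orbT.
  by have := dq n; lra.
have dsin n : 16 * d n < d0 * sin (2 * alpha).
  have : q <= d0 * sin (2 * alpha) / 16 by rewrite !ge_min lexx !orbT.
  by have := dq n; lra.
have Tn n : test_function (~` closure D') (blend alpha psi (d n)).
  by apply: (test_function_blend halpha T D0 HD' Hd0 _ (dn n) (dd0 n) (dsin n)) => z /Hr[].
have Lp := L2_test mK T.
have [_ [LT _] _ _ _] := TI.
have LW := LT _ Lp.
have [LG1 LG2] : L2v K (transplant_field alpha (grad psi)).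
  by apply: L2v_transplant; split; exact: (L2_derive_test _ mK T).
have mA := measurable_axis alpha.
suff [n Hn] : exists n, (\int[area]_(z in K) (energy (transplant alpha psi)
    (transplant_field alpha (grad psi)) (blend alpha psi (d n)) z)%:E < eps%:E)%E.
  by exists (blend alpha psi (d n)).
apply: (@eventually_small_integral R K (axis alpha)
  (fun n => energy (transplant alpha psi) (transplant_field alpha (grad psi)) (blend alpha psi
    (d n)))
  (3 * (18 * L + 24 * L * H + 4 * L) ^+ 2) (8 * r) mK
  (fun n => (measurable_EFinP _ _).1 (measurable_energy mK LW LG1 LG2 (Tn n))) mA (area_axis
    halpha)
  _ _ _ eps eps0).
- move=> n z Kz /eqP sz; rewrite energy_ge0 /=.
  exact: (blend_error_le Ksig Ktau Cp L0 Llip Lder Lbd Hm HH Kz sz (dn n) (dm n)).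
- move=> n z Kz /eqP sz nb; apply: (@blend_outside psi z (d n) r Cp Kz sz Hr).
  rewrite ltNge; apply/negP; rewrite ler_norm_pair => /andP[h1 h2]; exact: nb.
(* A fixed point off the axis leaves both strips: [s z] is nonzero, and in the right half
   [(sig z).2] is positive by [halfR_upper]. *)
- move=> z Kz /eqP sz.
  have small (x : R) : 0 < x -> exists n0, forall n, (n0 <= n)%N -> d n < x.
    move=> x0; have [k Hk] : exists k : nat, q / x < k%:R.
      by exists (Num.truncn (q / x)).+1; apply: truncnS_gt.
    exists k => n kn; rewrite /d ltr_pdivrMr// mulrC -ltr_pdivrMr//.
    by apply: lt_le_trans Hk _; rewrite ler_nat; do 2 apply: leqW.
  have [s0|s0|s0] := ltgtP (s z) 0; last by rewrite s0 eqxx in sz.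
    have [n0 Hn0] := small (- s z) ltac:(by rewrite oppr_gt0).
    exists n0 => n /Hn0 h; apply: blend_exact => //; left; lra.
  have y0 := halfR_upper Ksig Ktau Kz s0.
  have [n0 Hn0] := small (s z) s0; have [n1 Hn1] := small ((sig z).2 / 2) ltac:(by rewrite
    divr_gt0).
  exists (maxn n0 n1) => n; rewrite geq_max => /andP[/Hn0 h /Hn1 h'].
  by apply: blend_exact => //; right; split=> //; lra.
Qed.

(** Split [W u - chi] into [W (u - psi)] and [W psi - chi]. Squaring this sum costs a factor 2, and
    the two summands in each value of W another 2. *)
Lemma transplant_energy_le u g psi chi z :
  energy (transplant alpha u) (transplant_field alpha g) chi z <=
  4 * fold_density alpha (energy u g psi) z +
  2 * energy (transplant alpha psi) (transplant_field alpha (grad psi)) chi z.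
Proof.
have pr := @isometry_pair_reflect R.
have p2 := isometry_pair_comp (pr alpha) (pr (2 * alpha)).
have p3 := isometry_pair_comp (pr (2 * alpha)) (pr alpha).
have p4 := transplant_pair4 alpha.
have pid := @isometry_pair_id R; have pop := @isometry_pair_opp R.
have Q (x y w : R * R) : dot (x - w) (x - w) <= 2 * dot (x - y) (x - y) + 2 * dot (y - w) (y -
  w).
  have E : 2 * dot (x - y) (x - y) + 2 * dot (y - w) (y - w) - dot (x - w) (x - w) =
    dot (x - y - (y - w)) (x - y - (y - w)) by rewrite /dot /=; ring.
  by rewrite -subr_ge0 E /dot -!expr2 addr_ge0// sqr_ge0.
have q (x y w : R) : (x - w) ^+ 2 <= 2 * (x - y) ^+ 2 + 2 * (y - w) ^+ 2.
  have E : 2 * (x - y) ^+ 2 + 2 * (y - w) ^+ 2 - (x - w) ^+ 2 = (x - y - (y - w)) ^+ 2 by ring.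
  by rewrite -subr_ge0 E sqr_ge0.
have N1 := fold_norm_le alpha (pr alpha) p2 p3 p4 (fun w => g w - grad psi w) z.
rewrite -(fold_fieldB alpha (pr alpha) p2 p3 p4) in N1.
have N2 := fold_norm_le alpha pid pid pid pop (fun w => (u w - psi w, 0)) z.
rewrite transplant_pair in N2.
have E1 : transplant alpha (fun w => u w - psi w) z = transplant alpha u z - transplant alpha
  psi z.
  by rewrite /transplant; case: ifP => _; [ring|case: ifP => _; ring].
rewrite E1 {1}/dot /= mulr0 addr0 -expr2 in N2.
have E2 : fold_density alpha (energy u g psi) z =
  fold_density alpha (fun w => dot (u w - psi w, 0) (u w - psi w, 0)) z +
  fold_density alpha (fun w => dot (g w - grad psi w) (g w - grad psi w)) z.
  have En w : energy u g psi w = dot (u w - psi w, 0) (u w - psi w, 0) + dot (g w - grad psi w)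
    (g w - grad psi w).
    by rewrite energyE {2}/dot /= mulr0 addr0 expr2.
  by rewrite /fold_density !En; case: ifP => _; [ring|case: ifP => _; ring].
rewrite !energyE E2.
have := Q (transplant_field alpha g z) (transplant_field alpha (grad psi) z) (grad chi z).
have := q (transplant alpha u z) (transplant alpha psi z) (chi z).
move: N1 N2; rewrite -/(transplant_field alpha) /=.
set a1 := dot _ _; set a2 := (_ - _) ^+ 2; set a3 := fold_density _ _ _; set a4 := fold_density
  _ _ _.
set a5 := (_ - _) ^+ 2; set a6 := (_ - _) ^+ 2; set a7 := dot _ _; set a8 := dot _ _.
lra.
Qed.

Lemma transplant_form_map :
  form_map K (transplant alpha) (transplant_field alpha) D D'.
Proof.
move=> u g [[Lu L1 L2' W1 W2] Happ].
have [_ [LT _] _ _ _] := TI; have LW := LT _ Lu.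
have [LG1 LG2] : L2v K (transplant_field alpha g) by apply: L2v_transplant; split.
apply: form_domain_closure => // eps eps0.
(* Ten of these are spent: the factor 4 is doubled by [integral_fold_density], and 2 more come from
   the second term. *)
have e0 : 0 < eps / 32 by rewrite divr_gt0.
have [psi T I] := Happ _ e0.
have [chi Tchi Ichi] := transplant_test_approx T e0.
exists chi => //.
have mE := measurable_energy mK Lu L1 L2' T.
have [ID mD] := integral_fold_density halpha mK Ksig Ktau ((measurable_EFinP _ _).1 mE)
  (fun z => energy_ge0 u g psi z).
have [LGp1 LGp2] : L2v K (transplant_field alpha (grad psi)).
  by apply: L2v_transplant; split; exact: (L2_derive_test _ mK T).
have mC := measurable_energy mK (LT _ (L2_test mK T)) LGp1 LGp2 Tchi.
pose f1 z : \bar R := (4%:E * (fold_density alpha (energy u g psi) z)%:E)%E.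
pose f2 z : \bar R := (2%:E * (energy (transplant alpha psi) (transplant_field alpha (grad
  psi)) chi z)%:E)%E.
have dens0 z : 0 <= fold_density alpha (energy u g psi) z.
  rewrite /fold_density; case: ifP => _; first by rewrite addr_ge0// energy_ge0.
  by case: ifP => _ //; rewrite addr_ge0// energy_ge0.
have m1 : measurable_fun K f1 by exact: (measurable_funeM 4%:E ((measurable_EFinP _ _).2 mD)).
have m2 : measurable_fun K f2 by exact: (measurable_funeM 2%:E mC).
have f10 z : (0 <= f1 z)%E by rewrite mule_ge0// lee_fin.
have f20 z : (0 <= f2 z)%E by rewrite mule_ge0// lee_fin energy_ge0.
have step1 : (\int[area]_(z in K) (energy (transplant alpha u) (transplant_field alpha g) chi
  z)%:E
   <= \int[area]_(z in K) (f1 z + f2 z))%E.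
  apply: ge0_le_integral; first exact: mK.
  - by move=> z _; rewrite lee_fin energy_ge0.
  - exact: (measurable_energy mK LW LG1 LG2 Tchi).
  - exact: emeasurable_funD.
  - by move=> z _; rewrite /f1 /f2 -!EFinM -EFinD lee_fin; exact: transplant_energy_le.
apply: le_lt_trans step1 _.
rewrite ge0_integralD//.
have -> : (\int[area]_(z in K) f1 z = 4%:E * \int[area]_(z in K) (fold_density alpha (energy u
  g psi) z)%:E)%E.
  apply: ge0_integralZl; [exact: mK|exact/measurable_EFinP|by move=> z _; rewrite lee_fin|by
    rewrite lee_fin].
have -> : (\int[area]_(z in K) f2 z = 2%:E * \int[area]_(z in K) (energy (transplant alpha psi)
  (transplant_field alpha (grad psi)) chi z)%:E)%E.
  apply: ge0_integralZl; [exact: mK|exact: mC|by move=> z _; rewrite lee_fin energy_ge0|by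
    rewrite lee_fin].
rewrite ID.
move: I Ichi; set I1 := integral _ _ _; set I2 := integral _ _ _ => I1e I2e.
have I10 : (0 <= I1)%E by apply: integral_ge0 => z _; rewrite lee_fin energy_ge0.
have I20 : (0 <= I2)%E by apply: integral_ge0 => z _; rewrite lee_fin energy_ge0.
case: I1 I10 I1e => [x| |]//; case: I2 I20 I2e => [y| |]//.
by rewrite -!EFinM -EFinD !lte_fin => _ hy _ hx; lra.
Qed.

End TransplantForm.

(** * Geometry of the unfolded domain *)

Section Inside.
Context {R : realType}.
Implicit Types (z w v : R * R) (A B J : set (R * R)).

Lemma segment_component A z v : (forall t : R, 0 <= t <= 1 -> A (z + t *: v)) ->
  connected_component A z (z + v).
Proof.
move=> H; exists ((fun t : R => z + t *: v) @` `[0, 1]%classic); last first.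
  by exists 1; rewrite ?scale1r//= in_itv /= ler01 lexx.
split.
- by exists 0; rewrite ?scale0r ?addr0//= in_itv /= ler01 lexx.
- by move=> _ [t /= + <-]; rewrite in_itv /=; exact: H.
- apply: connected_continuous_connected; first exact: segment_connected.
  apply: continuous_subspaceT => t; apply: cvgD; first exact: cvg_cst.
  exact: (@scalel_continuous _ _ v t).
Qed.

Definition lform (a b : R) z : R := a * z.1 + b * z.2.

Lemma lformD a b z w : lform a b (z + w) = lform a b z + lform a b w.
Proof. by rewrite /lform /=; ring. Qed.

Lemma lformZ a b (t : R) z : lform a b (t *: z) = t * lform a b z.
Proof. by rewrite /lform /= -![_ *: _]/(_ * _); ring. Qed.

Lemma lform_continuous a b : continuous (lform a b).
Proof.
move=> z; rewrite /lform; apply: cvgD; apply: cvgM; try exact: cvg_cst; [exact: cvg_fst|exact: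
  cvg_snd].
Qed.

Lemma closed_lform_le a b : closed [set z | lform a b z <= 0].
Proof. by apply: (preimage_closed _ (@closed_le R 0)) => z _; exact: lform_continuous. Qed.

(** From a point beyond the line one escapes to infinity along the normal [(a, b)] without meeting
    [J], so its component is unbounded. *)
Lemma inside_halfplane a b J : (a, b) != 0 -> J `<=` [set z | lform a b z <= 0] ->
  inside J `<=` [set z | lform a b z <= 0].
Proof.
move=> ab JH z [nJ [M [Mr HM]]]; rewrite /= leNgt; apply/negP => lz.
have nab : 0 < `|(a, b)| by rewrite normr_gt0.
have lab : 0 <= lform a b (a, b) by rewrite /lform /= -!expr2 addr_ge0// sqr_ge0.
(* The walk has length [|M| + 2 + |z|], so its end has norm at least [|M| + 2], above the bound
   [|M| + 1]. *)
pose T := (`|M| + 2 + `|z|) / `|(a, b)|.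
have T0 : 0 <= T by rewrite divr_ge0// !addr_ge0.
have C : connected_component (~` J) z (z + T *: (a, b)).
  apply: segment_component => t /andP[t0 _] /JH /=.
  rewrite scalerA lformD lformZ leNgt => /negP; apply.
  by apply: ltr_wpDr => //; rewrite mulr_ge0// mulr_ge0.
have M1 : M < `|M| + 1 by rewrite (le_lt_trans (ler_norm M))// ltrDl.
have /= Cb := HM _ M1 _ C; move: Cb.
have : `|T *: (a, b)| <= `|z + T *: (a, b)| + `|z|.
  by rewrite -{1}(addKr z (T *: (a, b))) addrC; exact: ler_normB.
by rewrite normrZ ger0_norm// /T divfK ?gt_eqF//; lra.
Qed.

Lemma inside_component J z w : inside J z -> connected_component (~` J) z w -> inside J w.
Proof.
move=> [nJ bz] zw; split; first exact: connected_component_sub zw.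
by rewrite -(same_connected_component zw).
Qed.

Lemma interior_lform_lt a b A z : (a, b) != 0 -> A `<=` [set z | lform a b z <= 0] ->
  A° z -> lform a b z < 0.
Proof.
move=> ab AH /nbhs_normP[r /= r0 Hr].
have nab : 0 < `|(a, b)| by rewrite normr_gt0.
have lab : 0 < lform a b (a, b).
  have [a0|a0] := eqVneq a 0.
    have b0 : b != 0 by apply: contra ab => /eqP b0; rewrite a0 b0.
    by rewrite /lform /= -!expr2 ltr_wpDl ?sqr_ge0// exprn_even_gt0.
  by rewrite /lform /= -!expr2 ltr_wpDr ?sqr_ge0// exprn_even_gt0.
pose t := r / 2 / `|(a, b)|; have t0 : 0 < t by rewrite !divr_gt0.
have /AH /= : A (z + t *: (a, b)).
  apply: Hr; rewrite /ball_ /= opprD addNKr normrN normrZ gtr0_norm// /t divfK ?gt_eqF//; lra.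
by rewrite lformD lformZ; have := mulr_gt0 t0 lab; lra.
Qed.

(** Off [J], a whole ball about [z] would belong to [inside J]; but it crosses the line, beyond
    which [inside J] has no point. *)
Lemma closure_inside_frontier J z a b : closed J -> (a, b) != 0 ->
  J `<=` [set z | lform a b z <= 0] -> lform a b z = 0 -> closure (inside J) z -> J z.
Proof.
move=> cJ ab JH lz cz; apply: contrapT => nJz.
have /nbhs_normP[r /= r0 Hr] : nbhs z (~` J).
  by apply: open_nbhs_nbhs; split=> //; exact: closed_openC.
have [v [Kv /= vz]] : (inside J `&` [set w | `|z - w| < r]) !=set0.
  apply: cz; have := nbhsx_ballx z _ r0; rewrite -ball_normE; apply: filterS => w //.
have B (w : R * R) : `|z - w| < r -> inside J w.
  move=> wz; apply: inside_component Kv _; rewrite -(subrKC v w).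
  apply: segment_component => t /andP[t0 t1]; apply: Hr; rewrite /ball_ /=.
  have -> : z - (v + t *: (w - v)) = (1 - t) *: (z - v) + t *: (z - w).
    by congr pair; rewrite /= -![_ *: _]/(_ * _); ring.
  apply: le_lt_trans (ler_normD _ _) _; rewrite !normrZ !ger0_norm ?subr_ge0//.
  have [->|tn] := eqVneq t 0; first by rewrite subr0 mul1r mul0r addr0.
  have tp : 0 < t by rewrite lt_def tn.
  have : t * `|z - w| < t * r by rewrite ltr_pM2l.
  have : (1 - t) * `|z - v| <= (1 - t) * r by rewrite ler_wpM2l ?subr_ge0// ltW.
  lra.
have Iz : (inside J)° z.
  by have := nbhsx_ballx z _ r0; rewrite -ball_normE; apply: filterS => w; exact: B.
by have := interior_lform_lt ab (inside_halfplane ab JH) Iz; rewrite lz ltxx.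
Qed.

End Inside.

(** * Symmetries, rays and boundary parts of the unfolded domain *)

Section Unfolding.
Context {R : realType}.
Variables (alpha : R) (halpha : 0 < alpha < pi / 2) (z1 z2 : R * R)
  (hz1 : has_arg z1 0) (hz2 : has_arg z2 alpha) (gamma : R -> R * R)
  (hgamma : simple_curve gamma z1 z2 (open_sector 0 alpha)).
Local Notation tau := (reflect alpha).
Local Notation sig := (reflect (2 * alpha)).
Local Notation s := (side alpha).

Let a0 : 0 < alpha. Proof. by case/andP: halpha. Qed.
Let a1 : alpha < pi / 2. Proof. by case/andP: halpha. Qed.
Let sin_pos : 0 < sin alpha.
Proof. by apply: sin_gt0_pihalf. Qed.
Let cos_pos : 0 < cos alpha.
Proof. by apply: cos_gt0_pihalf; rewrite a1 andbT; apply: lt_trans a0; have := pi_gt0 R; lra.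
  Qed.

Definition midside (z : R * R) : R := lform (- sin alpha) (cos alpha) z.
(** The closed sector as two half-planes, so that [inside_halfplane] applies to each. *)
Definition sector : set (R * R) := [set z | 0 <= z.2 /\ midside z <= 0].

Let ypair : ((0 : R), (-1 : R)) != 0.
Proof. by apply/eqP => -[]; lra. Qed.

Let mpair : (- sin alpha, cos alpha) != 0.
Proof. by apply/eqP => -[_] c0; have := cos_pos; rewrite c0 ltxx. Qed.

Lemma sectorE : sector = [set z | lform 0 (-1) z <= 0] `&` [set z | midside z <= 0].
Proof.
by apply/seteqP; split=> z [h1 h2]; split=> //; move: h1; rewrite /lform /= mul0r add0r mulN1r
  oppr_le0.
Qed.

Lemma closed_sector : closed sector.
Proof. by rewrite sectorE; apply: closedI; exact: closed_lform_le. Qed.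

(** This is sin (phi - 2 alpha) + sin phi = 2 cos alpha sin (phi - alpha) in polar form. As cos
    alpha > 0, it puts the sector on the negative side of the axis of [sig]. *)
Lemma side_midside z : s z = 2 * cos alpha * midside z - z.2.
Proof.
have cd := cos2Dsin2 alpha.
rewrite /side /midside /lform (mulr_natl alpha) mulr2n cosD sinD.
move: cd; set c := cos alpha; set d := sin alpha => cd.
transitivity (2 * c * (- d * z.1 + c * z.2) - z.2 * (c ^+ 2 + d ^+ 2)); first by ring.
by rewrite cd mulr1.
Qed.

Lemma midside_tau z : midside (tau z) = - midside z.
Proof.
have cd := cos2Dsin2 alpha.
rewrite /reflect /midside /lform /= mulr_natl mulr2n cosD sinD.
move: cd; set c := cos alpha; set d := sin alpha => cd.
transitivity ((d * z.1 - c * z.2) * (c ^+ 2 + d ^+ 2)); first by ring.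
by rewrite cd; ring.
Qed.

Lemma sector_side z : sector z -> s z <= 0.
Proof.
move=> [h1 h2]; rewrite side_midside.
have : cos alpha * midside z <= 0 by rewrite pmulr_rle0.
by rewrite -mulrA; lra.
Qed.

Local Notation J := (radius z1 `|` radius z2 `|` trace_of gamma).

Lemma sector_scale (t : R) z : 0 <= t -> sector z -> sector (t *: z).
Proof.
move=> t0 [h1 h2]; split; first by rewrite /= -[_ *: _]/(_ * _) mulr_ge0.
by rewrite /midside lformZ mulr_ge0_le0.
Qed.

Lemma midside_polar r phi : midside (polar r phi) = r * sin (phi - alpha).
Proof. by rewrite /midside /lform /polar /= sinB; ring. Qed.

Lemma z1_form : 0 < z1.1 /\ z1.2 = 0.
Proof. by case: hz1 => r r0 ->; rewrite /polar cos0 sin0 mulr1 mulr0. Qed.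

Lemma z2_form : 0 < z2.2 /\ midside z2 = 0.
Proof.
case: hz2 => r r0 ->; rewrite midside_polar subrr sin0 mulr0.
by rewrite /polar /= mulr_gt0.
Qed.

Lemma z1_sector : sector z1.
Proof.
have [h1 h2] := z1_form; split; first by rewrite h2.
by rewrite /midside /lform h2 mulr0 addr0 mulNr oppr_le0 mulr_ge0// ltW.
Qed.

Lemma z2_sector : sector z2.
Proof. by have [h1 h2] := z2_form; split; [exact: ltW|rewrite h2]. Qed.

Lemma open_sector_sector z : open_sector 0 alpha z -> 0 < z.2 /\ sector z.
Proof.
move=> [r [phi [r0 /andP[p0 pa] ->]]].
have pp : 0 < sin phi by apply: sin_gt0_pihalf; rewrite p0 (lt_trans pa).
have yp : 0 < (polar r phi).2 by rewrite /polar /= mulr_gt0.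
split=> //; split; first exact: ltW.
rewrite midside_polar -opprB sinN mulrN oppr_le0 mulr_ge0 ?ltW//.
by apply: sin_gt0_pihalf; rewrite subr_gt0 pa /=; apply: lt_trans a1; lra.
Qed.

Lemma trace_sector z : trace_of gamma z -> sector z /\ (z.2 = 0 -> z = z1).
Proof.
have [g0 g1 _ gS _] := hgamma.
move=> [t + <-]; rewrite /= in_itv /= => /andP[t0 t1].
have [->|tn0] := eqVneq t 0; first by rewrite g0; split=> //; exact: z1_sector.
have [->|tn1] := eqVneq t 1.
  rewrite g1; split; first exact: z2_sector.
  by have [h _] := z2_form => h'; move: h; rewrite h' ltxx.
have [h1 h2] : 0 < (gamma t).2 /\ sector (gamma t).
  by apply: open_sector_sector; apply: gS; rewrite !lt_def tn0 t0 eq_sym tn1 t1.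
by split=> // h; move: h1; rewrite h ltxx.
Qed.

Lemma frontier_sector z : J z -> sector z.
Proof.
move=> [[|]|]; last by move=> /trace_sector[].
  by move=> [t /= + <-]; rewrite in_itv /= => /andP[t0 _]; exact: sector_scale z1_sector.
by move=> [t /= + <-]; rewrite in_itv /= => /andP[t0 _]; exact: sector_scale z2_sector.
Qed.

Lemma frontier_axis z : J z -> z.2 = 0 -> radius z1 z.
Proof.
move=> [[//|]|]; last first.
  move=> /trace_sector[_ /[apply] ->]; exists 1; rewrite ?scale1r//= in_itv /= ler01 lexx//.
move=> [t /= t01 <-] /eqP; have [h _] := z2_form.
rewrite -[(t *: z2).2]/(t * z2.2) mulf_eq0 (gt_eqF h) orbF => /eqP t0.
by exists 0; rewrite ?t0 ?scale0r//= in_itv /= ler01 lexx.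
Qed.

Lemma compact_radius (w : R * R) : compact (radius w).
Proof.
apply: continuous_compact; last exact: segment_compact.
by apply: continuous_subspaceT => t; exact: (@scalel_continuous _ _ w t).
Qed.

Lemma closed_frontier : closed J.
Proof.
have [_ _ _ _ [cg _]] := hgamma.
have cl (A : set (R * R)) : compact A -> closed A by apply: compact_closed; exact:
  norm_hausdorff.
apply: closedU; last by apply: cl; apply: continuous_compact cg _; exact: segment_compact.
by apply: closedU; apply: cl; exact: compact_radius.
Qed.

Local Notation K1 := (base_domain z1 z2 (trace_of gamma)).

Lemma base_sector : K1 `<=` sector.
Proof.
have JS := frontier_sector; rewrite sectorE in JS *.
by move=> z Kz; split; apply: inside_halfplane Kz => // w /JS[].
Qed.

Local Notation half := (closure (K1 `|` tau @` K1)).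
Local Notation K := (unfolded_domain alpha z1 z2 (trace_of gamma)).

Let clI (A : set (R * R)) (f : R * R -> R) : continuous f -> (forall z, A z -> f z <= 0) ->
  forall z, closure A z -> f z <= 0.
Proof.
move=> cf Af; have cl : closed [set z | f z <= 0] by apply: (preimage_closed _ (@closed_le R 0)) =>
  z _; exact: cf.
exact: (closure_subset_closed cl).
Qed.

Let cside : continuous (fun z => - s z).
Proof. by move=> z; apply: cvgN; exact: side_continuous. Qed.

Let ccmid : continuous (fun z => - midside z).
Proof. by move=> z; apply: cvgN; exact: lform_continuous. Qed.

Lemma half_upper z : half z -> lform 0 (-1) z <= 0.
Proof.
apply: clI; first exact: lform_continuous.
move=> w [/base_sector[h _]|[v /base_sector Sv <-]]; first by rewrite /lform mul0r add0r mulN1r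
  oppr_le0.
by rewrite /lform mul0r add0r mulN1r snd_reflect opprK; exact: sector_side.
Qed.

Lemma half_left z : half z -> s z <= 0.
Proof.
apply: clI; first exact: side_continuous.
move=> w [/base_sector|[v /base_sector[h _] <-]]; first exact: sector_side.
by rewrite side_reflect oppr_le0.
Qed.

Lemma half_tau z : half z -> half (tau z).
Proof.
rewrite !closureU => -[H|H]; [right|left]; last exact: closure_reflect.
by apply: closure_reflectP; rewrite reflectK.
Qed.

Local Notation pieces := (K1 `|` copy2 alpha K1 `|` copy3 alpha K1 `|` copy4 alpha K1).

(** The third and fourth copies stay in the closed right half-plane of the axis, so to its left only
    [half], a set that [tau] preserves, contributes to the closure. *)
Lemma unfolded_left z : s z < 0 -> K z <-> half° z.
Proof.
move=> sz; split=> Kz; last first.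
  apply: (@filterS _ (nbhs z) _ _ _ _ Kz) => w; apply: closureS => v [Kv|Kv]; first by left;
    left; left.
  by left; left; right.
have oS : nbhs z [set w | s w < 0].
  by apply: open_nbhs_nbhs; split=> //; apply: (open_comp _ (@open_lt R 0)) => w _; exact:
    side_continuous.
have Kz' : nbhs z (closure pieces) := Kz.
apply: (@filterS _ (nbhs z) _ _ _ _ (filterI Kz' oS)) => w [Hw /= sw]; move: Hw.
rewrite -setUA closureU => -[//|Hw]; exfalso.
have : - s w <= 0.
  apply: (@clI _ _ cside _ _ Hw).
  move=> v [[_ [x /base_sector[h _] <-] <-]|[x /base_sector Sx <-]].
    by rewrite side_reflect2 side_reflect !opprK oppr_le0.
  by rewrite side_reflect2 opprK; exact: sector_side.
by rewrite oppr_le0 leNgt sw.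
Qed.

Lemma unfolded_tau z : K z -> s z < 0 -> K (tau z) /\ s (tau z) < 0.
Proof.
move=> Kz sz; have Hz := (unfolded_left sz).1 Kz.
have stz : s (tau z) < 0.
  rewrite side_reflect oppr_lt0; have := interior_lform_lt ypair half_upper Hz.
  by rewrite /lform mul0r add0r mulN1r oppr_lt0.
split=> //; apply/(unfolded_left stz).
have : nbhs (tau z) (tau @^-1` half) by apply: reflect_continuous; rewrite reflectK.
by apply: filterS => w /= /half_tau; rewrite reflectK.
Qed.

Lemma unfolded_sig z : K z -> K (sig z).
Proof.
have P w : pieces w -> pieces (sig w).
  move=> [[[Kw|Kw]|[v Kv <-]]|[v Kv <-]]; rewrite ?reflectK.
  - by right; exists w.
  - by left; right; exists w.
  - by left; left; right.
  - by left; left; left.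
have C w : closure pieces w -> closure pieces (sig w).
  move=> Hw; have : closure (sig @` pieces) (sig w) by apply: closure_reflectP; rewrite
    reflectK.
  by apply: closureS => _ [v Kv <-]; exact: P.
move=> Kz; have : nbhs (sig z) (sig @^-1` closure pieces) by apply: reflect_continuous; rewrite
  reflectK.
by apply: filterS => w /= /C; rewrite reflectK.
Qed.

Lemma radius_sig w : radius z1 w -> radius (sig z1) (sig w).
Proof. by move=> [t t01 <-]; exists t => //; rewrite reflectZ. Qed.

(** Reflected by [sig], the line becomes the real axis. There [half_left] excludes the negative
    part, the sign of [midside] excludes the reflected copy of [K1], and [closure_inside_frontier]
    leaves only points of the bounding curve, which on this axis belong to the radius. *)
Lemma unfolded_ray z : closure (K `&` [set w | 0 < s w]) z -> (sig z).2 = 0 ->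
  radius (sig z1) z.
Proof.
move=> Hz yz; rewrite -[z](reflectK (2 * alpha)); apply: radius_sig.
have Hw : half (sig z).
  have : closure (sig @` (K `&` [set w | 0 < s w])) (sig z) by apply: closure_reflectP; rewrite
    reflectK.
  apply: (closure_subset_closed (@closed_closure _ _)) => _ [w [Kw /= sw] <-].
  have sw' : s (sig w) < 0 by rewrite side_reflect2 oppr_lt0.
  exact: interior_subset ((unfolded_left sw').1 (unfolded_sig Kw)).
move: (sig z) yz Hw => w yw Hw {z Hz}.
have [w0|wn0] := eqVneq w 0.
  by exists 0; rewrite ?scale0r ?w0//= in_itv /= ler01 lexx.
have w1 : 0 < w.1.
  have := half_left Hw; rewrite /side yw mul0r sub0r oppr_le0 (pmulr_lge0 _ (sin2_gt0 halpha)).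
  rewrite le_eqVlt => /orP[/eqP h|//]; case/negP: wn0; apply/eqP.
  by rewrite [w]surjective_pairing yw -h.
move: Hw; rewrite closureU => -[Hw|Hw]; last first.
  have : - midside w <= 0.
    apply: (@clI _ _ ccmid _ _ Hw).
    by move=> _ [v /base_sector[_ h] <-]; rewrite midside_tau opprK.
  by rewrite /midside /lform yw mulr0 addr0 mulNr opprK leNgt mulr_gt0.
apply: frontier_axis (yw); apply: (closure_inside_frontier closed_frontier ypair) Hw.
  move=> v /frontier_sector[h _]; by rewrite /= /lform mul0r add0r mulN1r oppr_le0.
by rewrite /lform yw mulr0 mul0r addr0.
Qed.

(** A test function may be nonzero on the line of the outer ray away from [K], so its support is
    first cut with the closure of the right half. On this compact set the height has no zero, by
    [unfolded_ray], hence a positive minimum. *)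
Lemma ray_cutoff G1 G2 psi : test_function (~` closure (boundary1 alpha z1 G1 G2)) psi ->
  exists2 m : R, 0 < m & forall z, K z -> 0 < s z -> `|(sig z).2| < m -> psi z = 0.
Proof.
move=> [_ cs sD]; pose P := closure [set z | psi z != 0] `&` closure (K `&` [set w | 0 < s w]).
have cP : compact P by apply: compact_closedI => //; exact: closed_closure.
have cf : continuous (fun z : R * R => `|(sig z).2|).
  move=> z; apply: cvg_norm; exact: snd_reflect_continuous.
have pos z : P z -> 0 < `|(sig z).2|.
  move=> [Sz Cz]; rewrite normr_gt0; apply/eqP => yz.
  apply: (sD _ Sz); apply: subset_closure; right; exact: unfolded_ray.
have [P0|/set0P[]] := eqVneq P set0.
  exists 1 => // z Kz sz _; apply: contrapT => /eqP pz.
  by have : P z by [split; exact: subset_closure]; rewrite P0.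
move=> p Pp; have [c cP' Hc] := compact_EVT_min (ex_intro _ p Pp) cP (continuous_subspaceT cf).
exists `|(sig c).2|; first by apply: pos; rewrite inE in cP'.
move=> z Kz sz; apply: contraTeq => pz; rewrite -leNgt; apply: Hc; rewrite inE.
by split; exact: subset_closure.
Qed.

Lemma zero_in_boundary G1 G2 : closure (boundary1 alpha z1 G1 G2) 0.
Proof.
apply: subset_closure; right; exists 0; rewrite ?scale0r//= in_itv /= ler01 lexx //.
Qed.

(** On each curved part the alternation of [G1] and [G2] sends both points entering the transplant
    to Dirichlet arcs of the first problem. On the outer ray the values cancel instead: third
    alternative. *)
Lemma boundary1_mirrors G1 G2 : G1 `<=` trace_of gamma -> G2 `<=` trace_of gamma ->
  mirrors_boundary alpha (boundary1 alpha z1 G1 G2) (boundary1 alpha z1 G2 G1).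
Proof.
move=> T1 T2 p; rewrite /boundary1 !closureU /copy2 /copy3 /copy4.
have cS (A : set (R * R)) : A `<=` trace_of gamma -> closure A `<=` sector.
  by move=> AT; apply: (closure_subset_closed closed_sector) => z /AT /trace_sector[].
have clR (b : R) (A : set (R * R)) z : closure A z -> closure (reflect b @` A) (reflect b z).
  by move=> H; apply: closure_reflectP; rewrite reflectK.
move=> [[[[H|H]|H]|H]|H].
- apply: Or31; split; first exact: sector_side (cS _ T2 _ H).
    by left; left; left; right; exact: clR.
  by left; left; right; do 2 apply: (clR).
- have H' := closure_reflect H.
  apply: Or31; split; first by rewrite -[p](reflectK alpha) side_reflect oppr_le0; have [] :=
    cS _ T1 _ H'.
    by left; left; left; left.
  by left; right; exact: clR.
- have H' := closure_reflect H; have H'' := closure_reflect H'.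
  apply: Or32; split.
  + rewrite -[p](reflectK (2 * alpha)) side_reflect2 -[sig p](reflectK alpha) side_reflect
      opprK.
    by have [] := cS _ T1 _ H''.
  + by left; left; left; left.
  + by left; right; exact: clR.
- have H' := closure_reflect H.
  apply: Or32; split.
  + by rewrite -[p](reflectK (2 * alpha)) side_reflect2 oppr_ge0; exact: sector_side (cS _ T2 _
      H').
  + by left; left; left; right; exact: clR.
  + by left; left; right; do 2 apply: (clR).
- have {H}[t /= t01 pE] : radius (sig z1) p.
    by move: H; apply: (closure_subset_closed _ (fun _ => id)); apply: compact_closed;
      [exact: norm_hausdorff|exact: compact_radius].
  have [h1 h2] := z1_form.
  have sp : sig p = t *: z1 by rewrite -pE reflectZ reflectK.
  rewrite in_itv /= in t01; have /andP[t0 _] := t01.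
  have y0 : (sig p).2 = 0 by rewrite sp -[LHS]/(t * z1.2) h2 mulr0.
  apply: Or33; split=> //.
  rewrite -[p](reflectK (2 * alpha)) side_reflect2 /side y0 sp mul0r sub0r opprK.
  rewrite -[(t *: z1).1]/(t * z1.1).
  by rewrite !mulr_ge0 ?(ltW h1) ?(ltW (sin2_gt0 halpha)).
Qed.

(** The reflection [sig] exchanges the first copy with the fourth, the second with the third, and
    the two bounding radii. *)
Lemma boundary2E G1 G2 :
  boundary2 alpha z1 G1 G2 = sig @` boundary1 alpha z1 G2 G1.
Proof.
have KK := @reflectK R (2 * alpha).
rewrite /boundary1 /boundary2 /copy2 /copy3 /copy4 !image_setU.
have Er : sig @` radius (sig z1) = radius z1.
  apply/seteqP; split=> [_ [_ [t t01 <-] <-]|_ [t t01 <-]].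
    by exists t => //; rewrite reflectZ KK.
  by exists (sig (t *: z1)); [exists t => //; rewrite reflectZ|rewrite KK].
rewrite !image_reflectK Er; apply/seteqP; split=> z /=; tauto.
Qed.

End Unfolding.

Theorem theorem3p2p2 (R : realType) (alpha : R) (halpha : 0 < alpha < pi / 2)
    (z1 z2 : R * R) (hz1 : has_arg z1 0) (hz2 : has_arg z2 alpha)
    (gamma : R -> R * R)
    (hgamma : simple_curve gamma z1 z2 (open_sector 0 alpha))
    (Gamma11 Gamma12 : set (R * R))
    (hGamma : decomposition gamma Gamma11 Gamma12) :
  isospectral (unfolded_domain alpha z1 z2 (trace_of gamma))
    (boundary1 alpha z1 Gamma11 Gamma12)
    (boundary2 alpha z1 Gamma11 Gamma12).
Proof.
set K := unfolded_domain _ _ _ _.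
have mK : measurable (K : set (measurableTypeR R * measurableTypeR R)).
  by apply: open_measurable_plane; exact: open_interior.
have Ksig := @unfolded_sig R alpha z1 z2 gamma.
have Ktau := unfolded_tau halpha hz1 hz2 hgamma.
have [G1 G2] : Gamma11 `<=` trace_of gamma /\ Gamma12 `<=` trace_of gamma.
  by case: hGamma => _ _ _ <-; split=> z Gz; apply: subset_closure; [left|right].
have ray A B psi := @ray_cutoff R alpha halpha z1 z2 hz1 hz2 gamma hgamma A B psi.
(* Kept general in the two parts, because the transplant must map the form domains into each other
   in both directions. *)
have W A B : A `<=` trace_of gamma -> B `<=` trace_of gamma ->
    form_map K (transplant alpha) (transplant_field alpha)
      (boundary1 alpha z1 A B) (boundary1 alpha z1 B A).
  move=> HA HB; apply: (transplant_form_map halpha mK Ksig Ktau) => //.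
  - exact: zero_in_boundary.
  - exact: (boundary1_mirrors halpha hz1 hz2 hgamma).
  - exact: ray.
have two : (2 : R) != 0 by rewrite pnatr_eq0.
apply: (isospectral_trans
  (intertwiner_isospectral mK two (transplant_intertwiner halpha mK Ksig Ktau)
    (W _ _ G1 G2) (W _ _ G2 G1))).
have S D := reflect_form_map halpha mK Ksig (D := D).
(* So far the Dirichlet condition has stayed on the outer ray; [sig], an intertwiner with constant
   1, carries it to the radius of [z1]. *)
rewrite boundary2E; apply: (intertwiner_isospectral mK (oner_neq0 R)
  (reflect_intertwiner halpha mK Ksig) (S _)).
rewrite -{2}[boundary1 _ _ _ _](image_reflectK (2 * alpha)); exact: S.
Qed.
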